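(* Let $m\ge 3$ and $k\ge 0$ be integers. There is an isomorphism of $\mathfrak{so}_{2m}$-modules $$S^\bullet(\mathfrak{so}_{2m})/\langle \mathrm U(\mathfrak{gl}_{2m})\circ e_\theta^{k+1}\rangle\ \simeq\ \bigoplus_{\substack{\lambda=\sum_{i=1}^m a_i\omega_i\\ (\sum_{i=1}^{m-2}2a_i)+a_{m-1}+a_m\le k\\ k-a_{m-1}-a_m\equiv 0\ (\mathrm{mod}\ 2)}}V(\lambda)\otimes V(\lambda)^*,$$ where the $a_i$ are non-negative integers. It provides a surjection of the $C_2$-algebra $A_{[2]}(\mathfrak{so}_{2m};k)$ onto the right hand side (a surjection of $\mathfrak{so}_{2m}$-modules).
   Context: Ground field $\mathbb C$. $e_\theta$ is a highest root vector of $\mathfrak{so}_{2m}$, $\theta=\epsilon_1+\epsilon_2$. The $C_2$-algebra is $A_{[2]}(\mathfrak{so}_{2m};k)=S^\bullet(\mathfrak{so}_{2m})/\langle \mathrm U(\mathfrak{so}_{2m})\circ e_\theta^{k+1}\rangle$, where $\circ$ is the action on the symmetric algebra induced by the adjoint action and $\langle\cdot\rangle$ denotes the generated ideal. The adjoint $\mathfrak{so}_{2m}$-module $\mathfrak{so}_{2m}$ is identified with $\Lambda^2(\mathbb C^{2m})^*$ as $\mathfrak{so}_{2m}$-module, where $\mathfrak{so}_{2m}\subset\mathfrak{gl}_{2m}$ acts naturally on $\mathbb C^{2m}$. Thus $\mathfrak{gl}_{2m}$ acts on the vector space $\mathfrak{so}_{2m}=\Lambda^2(\mathbb C^{2m})^*$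 and hence on $S^\bullet(\mathfrak{so}_{2m})$; $\mathrm U(\mathfrak{gl}_{2m})\circ e_\theta^{k+1}$ is the $\mathfrak{gl}_{2m}$-submodule generated by $e_\theta^{k+1}\in S^{k+1}(\mathfrak{so}_{2m})$. $V(\lambda)$ is the irreducible $\mathfrak{so}_{2m}$-module of highest weight $\lambda$. Fundamental weights (Bourbaki): $\omega_i=\epsilon_1+\dots+\epsilon_i$ for $i\le m-2$, $\omega_{m-1}=\frac12(\epsilon_1+\dots+\epsilon_{m-1}-\epsilon_m)$, $\omega_m=\frac12(\epsilon_1+\dots+\epsilon_m)$. The right hand side is an $\mathfrak{so}_{2m}$-module via the diagonal action on tensor products. *)

(* Defs.v *)
From HB Require Import structures.
From mathcomp Require Import all_boot all_order all_algebra.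
From mathcomp Require Import ring_quotient.
From mathcomp.real_closed Require Export complex.
From mathcomp Require Export boolp reals.
From mathcomp Require Export mpoly.

Set Implicit Arguments.
Unset Strict Implicit.
Unset Printing Implicit Defensive.

Import Order.TTheory GRing.Theory Num.Theory.
Import VectorInternalTheory.

Local Open Scope ring_scope.
Local Open Scope quotient_scope.

Record lieAlgebra (K : fieldType) := LieAlgebra {
  lie_sort :> vectType K;
  bracket : lie_sort -> lie_sort -> lie_sort;
  bracket_linear_r : forall x, linear (bracket x);
  bracket_linear_l : forall y, linear (bracket^~ y);
  bracketxx : forall x, bracket x x = 0;
  bracket_jacobi : forall x y z,
    bracket (bracket x y) z = bracket x (bracket y z) - bracket y (bracket x z)
}.

Definition lie_action (K : fieldType) (L : lieAlgebra K) (M : lmodType K)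
    (act : L -> M -> M) : Prop :=
  [/\ forall x, linear (act x),
      forall v, linear (act^~ v)
    & forall x y v, act (bracket x y) v = act x (act y v) - act y (act x v)].

Record lieModule (K : fieldType) (L : lieAlgebra K) := LieModule {
  mod_sort :> lmodType K;
  mod_act : L -> mod_sort -> mod_sort;
  mod_actP : lie_action mod_act
}.

Record fdModule (K : fieldType) (L : lieAlgebra K) := FdModule {
  fd_sort :> vectType K;
  fd_act : L -> fd_sort -> fd_sort;
  fd_actP : lie_action fd_act
}.

Coercion mod_of_fd (K : fieldType) (L : lieAlgebra K) (V : fdModule L) :
  lieModule L := LieModule (fd_actP V).

Definition lie_hom (K : fieldType) (L : lieAlgebra K) (M N : lieModule L)
    (f : M -> N) : Prop :=
  linear f /\ forall x v, f (mod_act x v) = mod_act x (f v).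

Record submodule (K : fieldType) (L : lieAlgebra K) (M : lieModule L) :=
  Submodule {
    sub_mem :> M -> Prop;
    sub_mem0 : sub_mem 0;
    sub_memD : forall u v, sub_mem u -> sub_mem v -> sub_mem (u + v);
    sub_memZ : forall a v, sub_mem v -> sub_mem (a *: v);
    sub_mem_act : forall x v, sub_mem v -> sub_mem (mod_act x v)
  }.

Definition irreducible (K : fieldType) (L : lieAlgebra K) (M : lieModule L) :
    Prop :=
  (exists v : M, v != 0) /\
  forall N : submodule M, (forall v, N v -> v = 0) \/ (forall v, N v).

(* The submodule U(L) o v: since L generates the enveloping algebra U(L), it is
   the least subspace containing v and stable under the action of L. *)
Inductive U_span (K : fieldType) (L : lieAlgebra K) (M : lieModule L) (v : M) :
    M -> Prop :=
| U_span_gen : U_span v v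
| U_span0 : U_span v 0
| U_spanD w1 w2 : U_span v w1 -> U_span v w2 -> U_span v (w1 + w2)
| U_spanZ a w : U_span v w -> U_span v (a *: w)
| U_span_act x w : U_span v w -> U_span v (mod_act x w).

Section Quotient.
Variables (K : fieldType) (L : lieAlgebra K) (M : lieModule L).
Variable N : submodule M.

Definition sub_pred : {pred M} := fun v => `[< N v >].

Fact sub_pred_zmod_closed : zmod_closed sub_pred.
Proof.
split=> [|u v]; first exact/asboolP/sub_mem0.
move=> /asboolP Nu /asboolP Nv; apply/asboolP.
by apply: sub_memD => //; rewrite -scaleN1r; apply: sub_memZ.
Qed.

HB.instance Definition _ :=
  GRing.isZmodClosed.Build M sub_pred sub_pred_zmod_closed.

Definition mquot : Type := Quotient.quot sub_pred.
HB.instance Definition _ := GRing.Zmodule.on mquot.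

Definition mquot_proj (v : M) : mquot := \pi_(Quotient.quot sub_pred) v.

Definition mquot_repr (q : mquot) : M := repr (q : Quotient.quot sub_pred).

Lemma mquot_reprK q : mquot_proj (mquot_repr q) = q.
Proof. exact: reprK. Qed.

Lemma mquot_projP u v : (mquot_proj u = mquot_proj v) <-> N (u - v).
Proof.
split=> [/eqP|Nuv]; first by rewrite /mquot_proj -Quotient.idealrBE => /asboolP.
by apply/eqP; rewrite /mquot_proj -Quotient.idealrBE; apply/asboolP.
Qed.

Lemma mquot_projD u v : mquot_proj (u + v) = mquot_proj u + mquot_proj v.
Proof. exact: (raddfD (\pi_(Quotient.quot sub_pred))). Qed.

Lemma mquot_projB u v : mquot_proj (u - v) = mquot_proj u - mquot_proj v.
Proof. exact: (raddfB (\pi_(Quotient.quot sub_pred))). Qed.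

Definition mquot_scale (a : K) (q : mquot) : mquot :=
  mquot_proj (a *: mquot_repr q).

Lemma mquot_scaleE a v : mquot_scale a (mquot_proj v) = mquot_proj (a *: v).
Proof.
apply/mquot_projP; rewrite -scalerBr; apply: sub_memZ.
by apply/mquot_projP; rewrite mquot_reprK.
Qed.

Fact mquot_scalerA a b q :
  mquot_scale a (mquot_scale b q) = mquot_scale (a * b) q.
Proof. by rewrite -[q]mquot_reprK !mquot_scaleE scalerA. Qed.

Fact mquot_scale1r : left_id 1 mquot_scale.
Proof. by move=> q; rewrite -[q]mquot_reprK mquot_scaleE scale1r. Qed.

Fact mquot_scalerDr : right_distributive mquot_scale +%R.
Proof.
move=> a p q; rewrite -[p]mquot_reprK -[q]mquot_reprK -mquot_projD.
by rewrite !mquot_scaleE scalerDr mquot_projD.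
Qed.

Fact mquot_scalerDl q : {morph mquot_scale^~ q : a b / a + b}.
Proof.
by move=> a b; rewrite -[q]mquot_reprK !mquot_scaleE scalerDl mquot_projD.
Qed.

HB.instance Definition _ := GRing.Zmodule_isLmodule.Build K mquot
  mquot_scalerA mquot_scale1r mquot_scalerDr mquot_scalerDl.

Lemma mquot_proj_linear : linear mquot_proj.
Proof. by move=> a u v; rewrite mquot_projD -mquot_scaleE. Qed.

Definition mquot_act (x : L) (q : mquot) : mquot :=
  mquot_proj (mod_act x (mquot_repr q)).

Lemma mquot_actE x v : mquot_act x (mquot_proj v) = mquot_proj (mod_act x v).
Proof.
have [lin_act _ _] := mod_actP M.
apply/mquot_projP; rewrite addrC -scaleN1r -lin_act; apply: sub_mem_act.
by rewrite scaleN1r addrC; apply/mquot_projP; rewrite mquot_reprK.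
Qed.

Fact mquot_actP : lie_action mquot_act.
Proof.
have [actr actl actB] := mod_actP M.
split=> [x a p q|q a x y|x y q].
- rewrite -[p]mquot_reprK -[q]mquot_reprK -mquot_proj_linear !mquot_actE actr.
  exact: mquot_proj_linear.
- by rewrite -[q]mquot_reprK /= !mquot_actE actl mquot_proj_linear.
- by rewrite -[q]mquot_reprK !mquot_actE actB mquot_projB.
Qed.

Definition quot_mod : lieModule L := LieModule mquot_actP.

Definition quot_proj : M -> quot_mod := mquot_proj.

End Quotient.

Section Constructions.
Variables (K : fieldType) (L : lieAlgebra K).

Fact adjoint_actP : lie_action (@bracket K L).
Proof.
split; [exact: bracket_linear_r | exact: bracket_linear_l |].
exact: bracket_jacobi.
Qed.

Definition adjoint : fdModule L := FdModule adjoint_actP.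

Section Dual.
Variable V : fdModule L.

HB.instance Definition _ (x : L) := @GRing.isLinear.Build K V V *:%R (fd_act x)
  (let: And3 lin _ _ := fd_actP V in lin x).

Definition dual_act (x : L) (f : 'Hom(V, K^o)) : 'Hom(V, K^o) :=
  - (f \o linfun (fd_act x))%VF.

Lemma dual_actE x f v : dual_act x f v = - f (fd_act x v).
Proof. by rewrite /dual_act opp_lfunE comp_lfunE lfunE. Qed.

Fact dual_actP : lie_action dual_act.
Proof.
have [actr actl actB] := fd_actP V.
split=> [x a f g|f a x y|x y f]; apply/lfunP => v; rewrite /=.
- by rewrite !(add_lfunE, scale_lfunE, dual_actE) opprD scalerN.
- rewrite !(add_lfunE, scale_lfunE, dual_actE) actl linearP opprD.
  by rewrite scalerN.
- rewrite !(dual_actE, add_lfunE, opp_lfunE) !opprK actB linearB /= opprB.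
  by rewrite addrC.
Qed.

Definition dual_mod : fdModule L := FdModule dual_actP.

End Dual.

Section Tensor.
Variables V W : fdModule L.

(* V (x) W in coordinates: matrices, with the outer products v^T w of the
   coordinate rows of v and w as pure tensors. *)
Definition tensor_space : vectType K := 'M[K]_(dim V, dim W).

Definition tens (v : V) (w : W) : tensor_space := (v2r v)^T *m v2r w.

Definition act_mx (U : fdModule L) (x : L) : 'M[K]_(dim U) :=
  lin1_mx (v2r \o fd_act x \o r2v : 'rV_(dim U) -> 'rV_(dim U)).

Lemma act_mxE (U : fdModule L) (x : L) (u : U) :
  v2r u *m act_mx U x = v2r (fd_act x u).
Proof.
by rewrite mul_rV_lin1 /= v2rK.
Qed.

Definition tensor_act (x : L) (T : tensor_space) : tensor_space :=
  (act_mx V x)^T *m T + T *m act_mx W x.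

Lemma tensor_act_tens x v w :
  tensor_act x (tens v w) = tens (fd_act x v) w + tens v (fd_act x w).
Proof.
by rewrite /tensor_act /tens !(mulmxA, =^~ trmx_mul) act_mxE -mulmxA act_mxE.
Qed.

Lemma act_mx_linear (U : fdModule L) : linear (act_mx U).
Proof.
have [_ actl _] := fd_actP U.
move=> a x y; apply/row_matrixP => i.
rewrite !rowE mulmxDr -scalemxAr -[delta_mx 0 i]r2vK !act_mxE -linearP /=.
by rewrite actl.
Qed.

Lemma act_mx_bracket (U : fdModule L) x y : act_mx U (bracket x y) =
  act_mx U y *m act_mx U x - act_mx U x *m act_mx U y.
Proof.
have [_ _ actB] := fd_actP U.
apply/row_matrixP => i; rewrite !rowE mulmxBr !mulmxA.
by rewrite -[delta_mx 0 i]r2vK !act_mxE actB linearB.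
Qed.

Fact tensor_actP : lie_action tensor_act.
Proof.
split=> [x a S T|T a x y|x y T]; rewrite /tensor_act /=.
- rewrite mulmxDr mulmxDl -scalemxAr -scalemxAl scalerDr -!addrA.
  by congr (_ + _); rewrite addrCA.
- rewrite !act_mx_linear linearP /= mulmxDl mulmxDr -scalemxAl -scalemxAr.
  by rewrite scalerDr -!addrA; congr (_ + _); rewrite addrCA.
- rewrite !act_mx_bracket linearB /= !trmx_mul.
  rewrite !(mulmxDr, mulmxDl, mulmxN, mulNmx, mulmxA, opprD, addrA).
  rewrite [RHS](AC 8 (1*5*4*8*(2*7)*(3*6)))%AC /=.
  by rewrite !subrr !addr0.
Qed.

Definition tensor_mod : fdModule L := FdModule tensor_actP.

End Tensor.

Section DirectSum.
Variables (I : finType) (V : I -> lieModule L).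

Definition dsum : Type := {dffun forall i, V i}.
HB.instance Definition _ := Choice.on dsum.

Definition dsum0 : dsum := [ffun i => 0].
Definition dsum_opp (f : dsum) : dsum := [ffun i => - f i].
Definition dsum_add (f g : dsum) : dsum := [ffun i => f i + g i].
Definition dsum_scale (a : K) (f : dsum) : dsum := [ffun i => a *: f i].

Fact dsum_addA : associative dsum_add.
Proof. by move=> f g h; apply/ffunP => i; rewrite !ffunE addrA. Qed.
Fact dsum_addC : commutative dsum_add.
Proof. by move=> f g; apply/ffunP => i; rewrite !ffunE addrC. Qed.
Fact dsum_add0 : left_id dsum0 dsum_add.
Proof. by move=> f; apply/ffunP => i; rewrite !ffunE add0r. Qed.
Fact dsum_addN : left_inverse dsum0 dsum_opp dsum_add.
Proof. by move=> f; apply/ffunP => i; rewrite !ffunE addNr. Qed.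
HB.instance Definition _ :=
  GRing.isZmodule.Build dsum dsum_addA dsum_addC dsum_add0 dsum_addN.

Fact dsum_scaleA a b f : dsum_scale a (dsum_scale b f) = dsum_scale (a * b) f.
Proof. by apply/ffunP => i; rewrite !ffunE scalerA. Qed.
Fact dsum_scale1 : left_id 1 dsum_scale.
Proof. by move=> f; apply/ffunP => i; rewrite !ffunE scale1r. Qed.
Fact dsum_scaleDr : right_distributive dsum_scale +%R.
Proof. by move=> a f g; apply/ffunP => i; rewrite !ffunE scalerDr. Qed.
Fact dsum_scaleDl f : {morph dsum_scale^~ f : a b / a + b}.
Proof. by move=> a b; apply/ffunP => i; rewrite !ffunE scalerDl. Qed.
HB.instance Definition _ := GRing.Zmodule_isLmodule.Build K dsum
  dsum_scaleA dsum_scale1 dsum_scaleDr dsum_scaleDl.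

Definition dsum_act (x : L) (f : dsum) : dsum := [ffun i => mod_act x (f i)].

Fact dsum_actP : lie_action dsum_act.
Proof.
split=> [x a f g|f a x y|x y f]; apply/ffunP => i; rewrite !ffunE /=;
  have [actr actl actB] := mod_actP (V i).
- exact: actr.
- exact: actl.
- exact: actB.
Qed.

Definition dsum_mod : lieModule L := LieModule dsum_actP.

End DirectSum.

End Constructions.

(* S(V), with variables indexed by the coordinate basis r2v (delta_mx 0 i). *)
Definition Sym (K : fieldType) (V : vectType K) := {mpoly K[dim V]}.

Definition Sym_inj (K : fieldType) (V : vectType K) (v : V) : Sym V :=
  \sum_(i < dim V) v2r v 0 i *: 'X_i.

(* The derivation of S(V) extending an endomorphism f of V. *)
Definition Sym_der (K : fieldType) (V : vectType K) (f : V -> V) (p : Sym V) :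
    Sym V :=
  \sum_(i < dim V) Sym_inj (f (r2v (delta_mx 0 i))) * p^`M(i).

Section SymTheory.
Variables (K : fieldType) (V : vectType K).

Lemma Sym_inj_linear : linear (@Sym_inj K V).
Proof.
move=> a u v; rewrite /Sym_inj scaler_sumr -big_split /=.
by apply: eq_bigr => i _; rewrite linearP /= !mxE scalerDl scalerA.
Qed.

HB.instance Definition _ :=
  @GRing.isLinear.Build K V (Sym V) *:%R (@Sym_inj K V) Sym_inj_linear.

Lemma Sym_inj_der (v : V) i : (Sym_inj v)^`M(i) = (v2r v 0 i)%:MP.
Proof.
rewrite /Sym_inj raddf_sum /= (bigD1 i) //= big1 ?addr0 => [|j ji].
  by rewrite mderivZ mderivX mnm1E eqxx scale1r -{1}[U_(i)%MM]add0m addmK mpolyX0 alg_mpolyC.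
by rewrite mderivZ mderivX mnm1E (negPf ji) scale0r scaler0.
Qed.

Lemma Sym_der_inj (f : {linear V -> V}) v :
  Sym_der f (Sym_inj v) = Sym_inj (f v).
Proof.
rewrite /Sym_der -{2}[v]v2rK [v2r v]row_sum_delta !linear_sum /=.
apply: eq_bigr => i _; rewrite Sym_inj_der !linearZ /=.
by rewrite mulrC mul_mpolyC.
Qed.

Lemma Sym_derM (f : V -> V) (p q : Sym V) :
  Sym_der f (p * q) = Sym_der f p * q + p * Sym_der f q.
Proof.
rewrite /Sym_der mulr_suml mulr_sumr -big_split; apply: eq_bigr => i _ /=.
by rewrite mderivM mulrDr; congr (_ + _); [exact: mulrA | exact: mulrCA].
Qed.

Lemma Sym_der_linear (f : V -> V) : linear (@Sym_der K V f).
Proof.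
move=> a p q; rewrite /Sym_der scaler_sumr -big_split; apply: eq_bigr => i _ /=.
by rewrite linearP mulrDr scalerAr.
Qed.

End SymTheory.

Section SymModule.
Variables (K : fieldType) (L : lieAlgebra K) (V : fdModule L).

Definition Sym_act (x : L) : Sym V -> Sym V := Sym_der (fd_act x).

Lemma Sym_der_comm (f g : {linear V -> V}) (p : Sym V) :
  Sym_der f (Sym_der g p) - Sym_der g (Sym_der f p) =
  Sym_der (fun v => f (g v) - g (f v)) p.
Proof.
have E (f1 f2 : {linear V -> V}) : Sym_der f1 (Sym_der f2 p) =
    \sum_i Sym_inj (f1 (f2 (r2v (delta_mx 0 i)))) * p^`M(i) +
    \sum_i \sum_j Sym_inj (f2 (r2v (delta_mx 0 i))) *
       (Sym_inj (f1 (r2v (delta_mx 0 j))) * p^`M(i)^`M(j)).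
  rewrite {2}/Sym_der.
  have -> (F : 'I_(dim V) -> Sym V) :
      Sym_der f1 (\sum_i F i) = \sum_i Sym_der f1 (F i).
    elim/big_rec2: _ => [|i u v _ <-].
      by rewrite /Sym_der big1 // => i _; rewrite linear0 mulr0.
    by rewrite -[F i]scale1r Sym_der_linear !scale1r.
  rewrite -big_split; apply: eq_bigr => i _ /=.
  rewrite Sym_derM Sym_der_inj; congr (_ + _).
  by rewrite mulr_sumr.
rewrite !E opprD addrACA -sumrB.
rewrite [X in _ + (X - _)]exchange_big /=.
rewrite [X in _ + X](_ : _ = 0) ?addr0.
  by apply: eq_bigr => i _; rewrite linearB mulrBl.
apply/eqP; rewrite subr_eq0; apply/eqP.
apply: eq_bigr => i _; apply: eq_bigr => j _.
by rewrite mulrCA mderiv_comm.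
Qed.

Fact Sym_actP : @lie_action K L (Sym V) Sym_act.
Proof.
have [actr actl actB] := fd_actP V.
pose lact x : {linear V -> V} :=
  HB.pack (fd_act x) (@GRing.isLinear.Build K V V *:%R (fd_act x) (actr x)).
split=> [x|p a x y|x y p].
- exact: Sym_der_linear.
- rewrite /Sym_act /Sym_der scaler_sumr -big_split; apply: eq_bigr => i _ /=.
  by rewrite actl linearP mulrDl -scalerAl.
- rewrite /Sym_act (Sym_der_comm (lact x) (lact y)).
  by apply: eq_bigr => i _; rewrite actB.
Qed.

Definition Sym_mod : lieModule L := LieModule Sym_actP.

End SymModule.

Inductive ideal_span (A : comNzRingType) (G : A -> Prop) : A -> Prop :=
| ideal_span_gen p : G p -> ideal_span G p
| ideal_span0 : ideal_span G 0
| ideal_spanD p q : ideal_span G p -> ideal_span G q -> ideal_span G (p + q)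
| ideal_spanM a p : ideal_span G p -> ideal_span G (a * p).

Section SymIdeal.
Variables (K : fieldType) (L : lieAlgebra K) (V : fdModule L).
Variables (G : Sym V -> Prop).
Hypothesis G_act : forall x p, G p -> G (Sym_act x p).

Fact ideal_span_scale (a : K) (p : Sym V) :
  ideal_span G p -> ideal_span G (a *: p).
Proof. by move=> Gp; rewrite -mul_mpolyC; apply: ideal_spanM. Qed.

Fact ideal_span_act x (p : Sym V) :
  ideal_span G p -> ideal_span G (Sym_act x p).
Proof.
elim=> [q Gq||q r _ IHq _ IHr|a q Gq IHq].
- exact/ideal_span_gen/G_act.
- rewrite /Sym_act /Sym_der big1 => [|i _]; first exact: ideal_span0.
  by rewrite linear0 mulr0.
- rewrite /Sym_act -[q]scale1r Sym_der_linear scale1r.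
  exact: ideal_spanD.
- rewrite /Sym_act Sym_derM; apply: ideal_spanD; exact: ideal_spanM.
Qed.

Definition ideal_submod : submodule (Sym_mod V) :=
  @Submodule K L (Sym_mod V) (ideal_span G) (ideal_span0 G)
    (@ideal_spanD _ G) ideal_span_scale ideal_span_act.

End SymIdeal.

Section Gl.
Variables (K : fieldType) (n : nat).

Definition mx_bracket (X Y : 'M[K]_n) : 'M[K]_n := X *m Y - Y *m X.

Fact mx_bracket_linear_r X : linear (mx_bracket X).
Proof.
move=> a Y Z; rewrite /mx_bracket mulmxDl mulmxDr -scalemxAl -scalemxAr.
by rewrite opprD addrACA scalerBr.
Qed.

Fact mx_bracket_linear_l Y : linear (mx_bracket^~ Y).
Proof.
move=> a X Z; rewrite /mx_bracket mulmxDl mulmxDr -scalemxAl -scalemxAr.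
by rewrite opprD addrACA scalerBr.
Qed.

Fact mx_bracketxx X : mx_bracket X X = 0.
Proof. exact: subrr. Qed.

Fact mx_jacobi X Y Z : mx_bracket (mx_bracket X Y) Z =
  mx_bracket X (mx_bracket Y Z) - mx_bracket Y (mx_bracket X Z).
Proof.
rewrite /mx_bracket !(mulmxBl, mulmxBr) !mulmxA !opprB.
rewrite !addrA [RHS](AC 8 ((1*8)*3*6*(2*5)*(4*7)))%AC /=.
by rewrite !addNr !addr0.
Qed.

Definition gl : lieAlgebra K :=
  @LieAlgebra K 'M[K]_n mx_bracket mx_bracket_linear_r mx_bracket_linear_l
    mx_bracketxx mx_jacobi.

End Gl.

Section So.
Variables (K : fieldType) (m : nat).

(* so_2m preserves the split form with Gram matrix so_form in the basis
   e_1, .., e_m, e_(-1), .., e_(-m) of K^2m. *)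
Definition so_form : 'M[K]_(m + m) := block_mx 0 1%:M 1%:M 0.

Definition so_defect (X : 'M[K]_(m + m)) : 'M[K]_(m + m) :=
  X^T *m so_form + so_form *m X.

Fact so_defect_linear : linear so_defect.
Proof.
move=> a X Y; rewrite /so_defect linearP /= mulmxDl mulmxDr -scalemxAl.
by rewrite -scalemxAr scalerDr addrACA.
Qed.

HB.instance Definition _ := @GRing.isLinear.Build K 'M[K]_(m + m)
  'M[K]_(m + m) *:%R so_defect so_defect_linear.

Definition so_space : {vspace 'M[K]_(m + m)} := lker (linfun so_defect).

Lemma so_spaceP X :
  reflect (X^T *m so_form + so_form *m X = 0) (X \in so_space).
Proof. by rewrite memv_ker lfunE; apply: eqP. Qed.

Lemma so_formK : so_form *m so_form = 1%:M.
Proof.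
rewrite /so_form mulmx_block !(mul0mx, mulmx0, mul1mx, add0r, addr0).
by rewrite -scalar_mx_block.
Qed.

Lemma so_form_tr : so_form^T = so_form.
Proof. by rewrite /so_form tr_block_mx !trmx0 !trmx1. Qed.

(* The form B(u, v) = u^T (so_form A) v attached to A in so_2m is alternating. *)
Lemma so_form_skew A : (A \in so_space) = ((so_form *m A)^T == - (so_form *m A)).
Proof. by rewrite memv_ker lfunE /= trmx_mul so_form_tr -addr_eq0. Qed.

Lemma so_bracket_closed X Y : X \in so_space -> Y \in so_space ->
  mx_bracket X Y \in so_space.
Proof.
move=> /so_spaceP/eqP; rewrite addr_eq0 => /eqP hX.
move=> /so_spaceP/eqP; rewrite addr_eq0 => /eqP hY.
apply/so_spaceP; rewrite /mx_bracket linearB /= !trmx_mul mulmxBl mulmxBr.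
rewrite -!mulmxA hX hY !mulmxN !mulmxA hX hY !mulNmx !opprK -!mulmxA.
by rewrite addrA subrK subrr.
Qed.

Notation soT := (subvs_of so_space).

Definition so_bracket (X Y : soT) : soT :=
  vsproj so_space (mx_bracket (vsval X) (vsval Y)).

Lemma so_bracketE X Y : vsval (so_bracket X Y) = mx_bracket (vsval X) (vsval Y).
Proof. by rewrite vsprojK // so_bracket_closed // subvsP. Qed.

Fact so_bracket_linear_r X : linear (so_bracket X).
Proof.
by move=> a Y Z; apply: subvs_inj; rewrite linearP /= !so_bracketE linearP /=
  mx_bracket_linear_r.
Qed.

Fact so_bracket_linear_l Y : linear (so_bracket^~ Y).
Proof.
by move=> a X Z; apply: subvs_inj; rewrite linearP /= !so_bracketE linearP /=
  mx_bracket_linear_l.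
Qed.

Fact so_bracketxx X : so_bracket X X = 0.
Proof. by apply: subvs_inj; rewrite so_bracketE mx_bracketxx linear0. Qed.

Fact so_jacobi X Y Z : so_bracket (so_bracket X Y) Z =
  so_bracket X (so_bracket Y Z) - so_bracket Y (so_bracket X Z).
Proof.
by apply: subvs_inj; rewrite linearB /= !so_bracketE mx_jacobi.
Qed.

Definition so : lieAlgebra K :=
  @LieAlgebra K soT so_bracket so_bracket_linear_r so_bracket_linear_l
    so_bracketxx so_jacobi.

(* Gram matrix of the bilinear form (u, v) |-> - B(X u, v) - B(u, X v). *)
Definition form_act (X B : 'M[K]_(m + m)) : 'M[K]_(m + m) :=
  - (X^T *m B + B *m X).

(* Transport of form_act along the isomorphism A |-> so_form *m A of so_2m
   with the space of alternating forms; recall so_form is an involution. *)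
Definition gl_so_act (X : gl K (m + m)) (A : so) : so :=
  vsproj so_space (so_form *m form_act X (so_form *m vsval A)).

Lemma gl_so_actE X A :
  so_form *m vsval (gl_so_act X A) = form_act X (so_form *m vsval A).
Proof.
rewrite vsprojK ?mulmxA ?so_formK ?mul1mx //.
rewrite so_form_skew mulmxA so_formK mul1mx /form_act.
have := subvsP A; rewrite so_form_skew => /eqP.
move: (so_form *m vsval A) => B hB.
rewrite linearN linearD /= !trmx_mul trmxK hB.
by rewrite mulNmx mulmxN -opprD addrC.
Qed.

Lemma so_form_inj (A B : so) :
  so_form *m vsval A = so_form *m vsval B -> A = B.
Proof.
move=> /(congr1 (mulmx so_form)); rewrite !mulmxA so_formK !mul1mx.
exact: subvs_inj.
Qed.

Fact gl_so_actP : lie_action gl_so_act.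
Proof.
split=> [X a A B|A a X Y|X Y A]; apply: so_form_inj.
- rewrite gl_so_actE !linearP /= !gl_so_actE /form_act.
  rewrite mulmxDr mulmxDl -scalemxAr -scalemxAl addrACA -scalerDr.
  by rewrite opprD scalerN.
- rewrite /= gl_so_actE !linearP /= !gl_so_actE /form_act linearP /=.
  rewrite mulmxDr mulmxDl -scalemxAr -scalemxAl addrACA -scalerDr.
  by rewrite opprD scalerN.
- rewrite gl_so_actE !linearB /= !gl_so_actE.
  move: (so_form *m _) => B; rewrite /form_act /bracket /= /mx_bracket.
  rewrite linearB /= !trmx_mul.
  rewrite !(mulmxDr, mulmxDl, mulmxN, mulNmx, opprK, mulmxA, opprD, addrA).
  rewrite [RHS](AC 8 (5*1*8*4*(2*7)*(3*6)))%AC /=.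
  by rewrite !subrr !addr0.
Qed.

Definition gl_so_mod : fdModule (gl K (m + m)) := FdModule gl_so_actP.

Lemma gl_so_act_so (X A : so) : gl_so_act (vsval X) A = bracket X A.
Proof.
apply: so_form_inj; rewrite gl_so_actE so_bracketE /form_act mulmxA.
have /so_spaceP/eqP := subvsP X; rewrite addr_eq0 => /eqP ->.
by rewrite /mx_bracket mulmxBr !mulmxA mulNmx opprD opprK.
Qed.

Definition cartan (t : 'rV[K]_m) : so :=
  vsproj so_space (block_mx (diag_mx t) 0 0 (- diag_mx t)).

Lemma cartanE t : vsval (cartan t) = block_mx (diag_mx t) 0 0 (- diag_mx t).
Proof.
rewrite vsprojK //; apply/so_spaceP; rewrite /so_form tr_block_mx !mulmx_block.
rewrite !(trmx0, mul0mx, mulmx0, mul1mx, mulmx1, add0r, addr0) linearN /=.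
rewrite tr_diag_mx add_block_mx !addr0 subrr addNr.
by rewrite -[RHS]block_mx_const.
Qed.

(* Weights are rows of coordinates in eps_1, .., eps_m, where eps_j maps
   cartan t to t_j. *)
Definition weight_vector (M : lieModule so) (lam : 'rV[K]_m) (v : M) : Prop :=
  forall t : 'rV[K]_m,
    mod_act (cartan t) v = (\sum_(j < m) lam 0 j * t 0 j) *: v.

Definition root_vector (alpha : 'rV[K]_m) (e : so) : Prop :=
  e != 0 /\ weight_vector (M := adjoint so) alpha e.

Definition eps (i : 'I_m) : 'rV[K]_m := delta_mx 0 i.

Definition positive_root (alpha : 'rV[K]_m) : Prop :=
  exists i j : 'I_m,
    (i < j)%N /\ (alpha = eps i - eps j \/ alpha = eps i + eps j).

Definition highest_root : 'rV[K]_m := \sum_(i < m | (i < 2)%N) eps i.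

Definition highest_weight_vector (M : lieModule so) (lam : 'rV[K]_m) (v : M) :
    Prop :=
  [/\ v != 0, weight_vector lam v
    & forall alpha e, positive_root alpha -> root_vector alpha e ->
        mod_act e v = 0].

Definition is_irr_of_highest_weight (lam : 'rV[K]_m) (V : fdModule so) : Prop :=
  irreducible V /\ exists v : V, highest_weight_vector (M := V) lam v.

(* omega_(i + 1) in Bourbaki numbering, as i counts from 0. *)
Definition fund_weight (i : 'I_m) : 'rV[K]_m :=
  if (i.+2 < m)%N then \sum_(j < m | (j <= i)%N) eps j
  else if (i.+1 < m)%N then
    2%:R^-1 *: \sum_(j < m) (if (j.+1 < m)%N then eps j else - eps j)
  else 2%:R^-1 *: \sum_(j < m) eps j.

Definition weight_of (a : 'I_m -> nat) : 'rV[K]_m :=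
  \sum_(i < m) (a i)%:R *: fund_weight i.

Section Quotients.
Variables (k : nat) (e : so).

Definition so_span : Sym so -> Prop :=
  U_span (M := Sym_mod (adjoint so)) (Sym_inj e ^+ k.+1).

Definition gl_span : Sym so -> Prop :=
  U_span (M := Sym_mod gl_so_mod) (Sym_inj e ^+ k.+1).

Fact so_span_act (x : so) (p : Sym so) :
  so_span p -> so_span (Sym_act (V := adjoint so) x p).
Proof. exact: U_span_act. Qed.

Fact gl_span_act (x : so) (p : Sym so) :
  gl_span p -> gl_span (Sym_act (V := adjoint so) x p).
Proof.
have -> : Sym_act (V := adjoint so) x p
        = Sym_act (V := gl_so_mod) (vsval x) p.
  by apply: eq_bigr => i _; rewrite /= gl_so_act_so.
exact: U_span_act.
Qed.

Definition so_ideal : submodule (Sym_mod (adjoint so)) :=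
  ideal_submod (V := adjoint so) so_span_act.

Definition gl_ideal : submodule (Sym_mod (adjoint so)) :=
  ideal_submod (V := adjoint so) gl_span_act.

Definition C2_algebra : lieModule so := quot_mod so_ideal.

Definition gl_quotient : lieModule so := quot_mod gl_ideal.

End Quotients.

End So.

Definition weight_bound (m k : nat) (a : 'I_m -> nat) : bool :=
  (\sum_(i < m | i.+2 < m) 2 * a i + \sum_(i < m | m <= i.+2) a i <= k)%N &&
  (k == \sum_(i < m | m <= i.+2) a i %[mod 2])%N.

Lemma weight_bound_le (m k : nat) (a : 'I_m -> nat) i :
  weight_bound k a -> (a i <= k)%N.
Proof.
case/andP=> le_k _; apply: leq_trans le_k.
case: (ltnP i.+2 m) => him.
  by rewrite (bigD1 i) //= mul2n -addnn -!addnA leq_addr.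
by rewrite [X in (_ <= _ + X)%N](bigD1 i) //= addnCA leq_addr.
Qed.

(* The bound a_i <= k is no restriction, by weight_bound_le. *)
Definition weight_index (m k : nat) : finType :=
  {a : {ffun 'I_m -> 'I_k.+1} | weight_bound k (fun i => a i : nat)}.

Definition index_weight (K : fieldType) (m k : nat) (a : weight_index m k) :
    'rV[K]_m :=
  weight_of K (fun i => val a i : nat).

Definition peter_weyl_sum (K : fieldType) (m k : nat)
    (V : weight_index m k -> fdModule (so K m)) : lieModule (so K m) :=
  dsum_mod (fun a => tensor_mod (V a) (dual_mod (V a)) : lieModule (so K m)).

(* Main.v *)
(* The operators leftS x p = x p + (ad x)(p) / 2 + lowerS x p on S(so_2m), where
   lowerS x lowers the degree by one and depends on k, satisfy the relations of
   so_2m. Hence S(so_2m) becomes a cyclic module over the enveloping algebra, and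
   every p in S(so_2m) acts on every so_2m-module, through env_act; the adjoint
   action is the difference of the left and right multiplications.
   The lowering operators map the gl_2m-submodule generated by e_theta^(k+1)
   to 0, since e_theta has rank 2. So the ideal J generated by this submodule is
   stable under left multiplication, and S(so_2m) / J is a quotient algebra of
   the enveloping algebra. The submodule contains h^(k+1) for each coordinate h
   of the Cartan subalgebra, and h^(k+1) acts as prod_(j <= k) (h - (k/2 - j)).
   Hence J annihilates a module when the coordinates of its weights are among
   k/2, k/2 - 1, .., -k/2; a simple module with highest weight lambda has this
   property when lambda_1 is one of these numbers, which is the condition on the
   a_i. Conversely S(so_2m) / J itself has this property, so the Casimir operator
   shows that it is spanned by highest weight submodules with such highest
   weights, and p lies in J as soon as it annihilates all V(lambda). Finally, a
   singular vector of S(so_2m) / J which does not annihilate V(lambda) acts on it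
   with rank one and annihilates the other modules; by irreducibility S(so_2m)
   maps onto the sum of the End V(lambda). *)

From HB Require Import structures.
From mathcomp Require Import all_boot all_order all_algebra ssrcomplements.
Require Import Defs.
From mathcomp Require Import ring zify.

Set Implicit Arguments.
Unset Strict Implicit.
Unset Printing Implicit Defensive.

Import Order.TTheory GRing.Theory Num.Theory.
Import VectorInternalTheory.
Local Open Scope ring_scope.

(** * Degrees in the symmetric algebra *)

(** The operators come from so_4m, graded as the alternating forms, gl_2m and the dual of the forms.
    S(so_2m) is a parabolic Verma module of scalar type for it: multiplications raise the degree,
    [glS] shifted by k/2 times the trace keeps it, and [lowerS] lowers it; k enters through the
    character of gl_2m on the vector 1. The operators [leftS] and [rightS], half the adjoint action
    plus or minus (multiplication plus lowering), form the symmetric subalgebra so_2m x so_2m, and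
    [Sym_inj e ^+ k.+1] is a singular vector. Of this picture only the commutation relations are
    proved. Finite dimension of S(so_2m) / J is not known beforehand, so complete reducibility
    cannot be quoted. Its place is taken by the finite set of possible weight coordinates: it makes
    root vectors nilpotent, gives weight decompositions by interpolation, and provides singular
    vectors through a height function. The Casimir eigenvalue distinguishes comparable dominant
    weights, which is what lets it split off the highest weight submodules. *)

Section EulerInv.
Variables (K : numFieldType) (N : nat).
Implicit Types (p q : {mpoly K[N]}).

(* On polynomials without constant term, [Euler_inv] of the i-th derivative is
   the i-th derivative divided by the degree. *)
Definition Euler_inv p : {mpoly K[N]} :=
  \sum_(m <- msupp p) (p@_m / (mdeg m).+1%:R) *: 'X_[m].

Lemma Euler_invE p n : (msize p <= n)%N ->
  Euler_inv p = \sum_(m : 'X_{1..N < n}) (p@_m / (mdeg m).+1%:R) *: 'X_[m].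
Proof.
move=> le; pose I : subFinType _ := 'X_{1..N < n}.
rewrite /Euler_inv (big_mksub I) /=; first last.
  by move=> x /msize_mdeg_lt /leq_trans; apply.
  exact: msupp_uniq.
by rewrite big_rmcond //= => i /memN_msupp_eq0 ->; rewrite mul0r scale0r.
Qed.

Lemma Euler_inv_linear : linear Euler_inv.
Proof.
move=> a p q; set n := maxn (msize p) (msize q).
have le : (msize (a *: p + q) <= n)%N.
  apply: leq_trans (msizeD_le _ _) _; rewrite geq_max leq_maxr andbT.
  exact: leq_trans (msizeZ_le _ _) (leq_maxl _ _).
rewrite !(@Euler_invE _ n) ?leq_maxl ?leq_maxr // scaler_sumr -big_split.
apply: eq_bigr => m _ /=; rewrite mcoeffD mcoeffZ mulrDl scalerDl scalerA.
by rewrite mulrA.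
Qed.

HB.instance Definition _ := @GRing.isLinear.Build K {mpoly K[N]} {mpoly K[N]}
  *:%R Euler_inv Euler_inv_linear.

End EulerInv.

Section SymOps.
Variables (K : numFieldType) (V : vectType K).
Implicit Types (p q : Sym V) (u v w : V).

HB.instance Definition _ (f : V -> V) :=
  @GRing.isLinear.Build K (Sym V) (Sym V) *:%R (@Sym_der K V f)
    (@Sym_der_linear K V f).

Definition coord_vec (i : 'I_(dim V)) : V := r2v (delta_mx 0 i).
Local Notation b := coord_vec.

Lemma Sym_inj_coord i : Sym_inj (b i) = 'X_i.
Proof.
rewrite /Sym_inj r2vK (bigD1 i) //= big1 ?addr0 => [|j ji].
  by rewrite !mxE !eqxx scale1r.
by rewrite !mxE (negPf ji) andbF scale0r.
Qed.

Lemma coord_vec_sum v : \sum_i v2r v 0 i *: b i = v.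
Proof.
by rewrite -{2}[v]v2rK [X in r2v X]row_sum_delta linear_sum;
  apply: eq_bigr => i _; rewrite linearZ.
Qed.

Lemma Sym_der1 (f : V -> V) : Sym_der f 1 = 0.
Proof.
by rewrite /Sym_der big1 // => i _; rewrite mderivC mulr0.
Qed.

Lemma Sym_ind (P : Sym V -> Prop) :
  P 1 -> (forall p q, P p -> P q -> P (p + q)) ->
  (forall a p, P p -> P (a *: p)) ->
  (forall v p, P p -> P (Sym_inj v * p)) -> forall p, P p.
Proof.
move=> P1 PD PZ PM; have P0 : P 0 by rewrite -(scale0r 1); apply: PZ.
move=> p; rewrite [p]mpolyE; elim/big_ind: _ => // m _; apply: PZ.
rewrite mpolyXE_id; elim/big_rec: _ => // i q _ Pq.
elim: (m i) => [|n IH]; first by rewrite expr0 mul1r.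
by rewrite exprS -mulrA -Sym_inj_coord; apply: PM; rewrite Sym_inj_coord.
Qed.

(** Homogeneity is generated by products with vectors because the operators below are known through
    their commutators with such products; inductions on [hdeg] follow these commutators. *)
Inductive hdeg : nat -> Sym V -> Prop :=
| hdeg1 : hdeg 0 1
| hdeg0 d : hdeg d 0
| hdegD d p q : hdeg d p -> hdeg d q -> hdeg d (p + q)
| hdegZ d a p : hdeg d p -> hdeg d (a *: p)
| hdegM d v p : hdeg d p -> hdeg d.+1 (Sym_inj v * p).

Lemma hdeg_sum d (I : Type) (r : seq I) (P : pred I) (F : I -> Sym V) :
  (forall i, P i -> hdeg d (F i)) -> hdeg d (\sum_(i <- r | P i) F i).
Proof.
by move=> h; elim/big_ind: _ => //; [exact: hdeg0 | exact: hdegD].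
Qed.

Inductive filt (n : nat) : Sym V -> Prop :=
| filt_hdeg d p : (d <= n)%N -> hdeg d p -> filt n p
| filtD p q : filt n p -> filt n q -> filt n (p + q).

Lemma filtW n n' p : (n <= n')%N -> filt n p -> filt n' p.
Proof.
move=> le; elim=> [d q led hq|q r _ fq _ fr].
  exact: filt_hdeg (leq_trans led le) hq.
exact: filtD.
Qed.

Lemma filtZ n a p : filt n p -> filt n (a *: p).
Proof.
elim=> [d q led hq|q r _ fq _ fr]; first exact: (filt_hdeg led (hdegZ a hq)).
by rewrite scalerDr; apply: filtD.
Qed.

Lemma filtM n v p : filt n p -> filt n.+1 (Sym_inj v * p).
Proof.
elim=> [d q led hq|q r _ fq _ fr].
  by apply: (@filt_hdeg _ d.+1) => //; apply: hdegM.
by rewrite mulrDr; apply: filtD.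
Qed.

Lemma filt_ex p : exists n, filt n p.
Proof.
elim/Sym_ind: p => [|p q [n fp] [n' fq]|a p [n fp]|v p [n fp]].
- by exists 0; apply: filt_hdeg hdeg1.
- exists (maxn n n'); apply: filtD; first exact: filtW (leq_maxl _ _) fp.
  exact: filtW (leq_maxr _ _) fq.
- by exists n; apply: filtZ.
- by exists n.+1; apply: filtM.
Qed.

Lemma filt_ind_lin n (P : Sym V -> Prop) :
  (forall p q, P p -> P q -> P (p + q)) ->
  (forall d p, (d <= n)%N -> hdeg d p -> P p) -> forall p, filt n p -> P p.
Proof.
move=> PD Ph p; elim=> [d q led hq|q r _ Pq _ Pr]; first exact: Ph led hq.
exact: PD.
Qed.

Lemma hdeg_ind_lin d (P : Sym V -> Prop) :
  (forall p q, P p -> P q -> P (p + q)) ->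
  (forall a p, P p -> P (a *: p)) -> P 0 ->
  (d = 0 -> P 1) ->
  (forall d' v p, d = d'.+1 -> hdeg d' p -> P (Sym_inj v * p)) ->
  forall p, hdeg d p -> P p.
Proof.
move=> PD PZ P0 P1 PM p hp.
elim: hp P1 PM => {d p} [|d|d p q _ IHp _ IHq|d a p _ IHp|d v p hp _] P1 PM //.
- exact: P1.
- by apply: PD; [apply: IHp | apply: IHq].
- by apply: PZ; apply: IHp.
- exact: PM.
Qed.

(* In particular, operators of the form multiplication by v plus lower order
   terms generate Sym V from 1. *)
Lemma Sym_filt_ind (P : Sym V -> Prop) :
  P 1 -> (forall p q, P p -> P q -> P (p + q)) ->
  (forall a p, P p -> P (a *: p)) ->
  (forall d, (forall q, filt d q -> P q) ->
     forall v q, hdeg d q -> P (Sym_inj v * q)) ->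
  forall p, P p.
Proof.
move=> P1 PD PZ PM p; have P0 : P 0 by rewrite -(scale0r 1); apply: PZ.
have [n] := filt_ex p; elim: n p => [|n IHn] p.
  apply: filt_ind_lin => // d {}p; rewrite leqn0 => /eqP ->.
  by apply: hdeg_ind_lin.
apply: filt_ind_lin => // d {}p; rewrite leq_eqVlt => /predU1P[->|]; last first.
  by rewrite ltnS => led hp; apply: IHn; apply: filt_hdeg led hp.
by apply: hdeg_ind_lin => // d' v q [<-] hq; apply: (PM n).
Qed.

Lemma hdeg_Sym_der (f : {linear V -> V}) d p :
  hdeg d p -> hdeg d (Sym_der f p).
Proof.
elim=> {d p} [|d|d p q _ hp _ hq|d a p _ hp|d v p hp0 hp].
- by rewrite Sym_der1; apply: hdeg0.
- by rewrite raddf0; apply: hdeg0.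
- by rewrite raddfD; apply: hdegD.
- by rewrite linearZ; apply: hdegZ.
- by rewrite Sym_derM Sym_der_inj; apply: hdegD; apply: hdegM.
Qed.

Lemma hdeg0_mderiv i p : hdeg 0 p -> p^`M(i) = 0.
Proof.
apply: (hdeg_ind_lin (P := fun p => p^`M(i) = 0)) => // [q r hq hr|a q hq||].
- by rewrite raddfD /= hq hr addr0.
- by rewrite linearZ /= hq scaler0.
- by rewrite raddf0.
- by rewrite mderivC.
Qed.

Lemma mderiv_hdeg i d p : hdeg d.+1 p -> hdeg d p^`M(i).
Proof.
move=> h; move: {-2}d.+1 h (erefl d.+1) => d' h; elim: h d => {d' p}
  [//|d' d _|d' p q _ IHp _ IHq d e|d' a p _ IHp d e|d' v p hp IHp d [e]].
- by rewrite raddf0; apply: hdeg0.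
- by rewrite raddfD; apply: hdegD; [apply: IHp|apply: IHq].
- by rewrite linearZ; apply: hdegZ; apply: IHp.
- rewrite mderivM Sym_inj_der mul_mpolyC; subst d.
  apply: hdegD; first exact: hdegZ.
  case: d' hp IHp => [|d'] hp IHp; last by apply: hdegM; apply: IHp.
  by rewrite hdeg0_mderiv // mulr0; apply: hdeg0.
Qed.

Lemma Sym_euler d p : hdeg d p -> \sum_i 'X_i * p^`M(i) = d%:R *: p.
Proof.
elim=> {d p} [|d|d p q _ hp _ hq|d a p _ hp|d v p hp0 hp].
- by rewrite scale0r big1 // => i _; rewrite mderivC mulr0.
- by rewrite scaler0 big1 // => i _; rewrite raddf0 mulr0.
- rewrite scalerDr -hp -hq -big_split; apply: eq_bigr => i _.
  by rewrite raddfD mulrDr.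
- rewrite scalerA mulrC -scalerA -hp scaler_sumr; apply: eq_bigr => i _.
  by rewrite linearZ /= scalerAr.
- rewrite (eq_bigr (fun i => ('X_i * (v2r v 0 i)%:MP) * p +
    Sym_inj v * ('X_i * p^`M(i)))) => [|i _]; last first.
    rewrite mderivM Sym_inj_der mulrDr.
    by congr (_ + _); [exact: mulrA | exact: mulrCA].
  rewrite big_split /= -mulr_suml -mulr_sumr hp -scalerAr -natr1 scalerDl.
  rewrite scale1r addrC; congr (_ + _ * _).
  by apply: eq_bigr => i _; rewrite mulrC mul_mpolyC.
Qed.

Lemma Euler_inv_hdeg d p : hdeg d p -> Euler_inv p = d.+1%:R^-1 *: p.
Proof.
move=> hp; have ph : p \is d.-homog.
  elim: hp => {d p} [|d|d p q _ hp _ hq|d a p _ hp|d v p _ hp].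
  - exact: dhomog1.
  - exact: dhomog0.
  - exact: rpredD.
  - exact: rpredZ.
  - rewrite -add1n; apply: dhomogM => //; apply: rpred_sum => i _.
    by apply: rpredZ; rewrite dhomogX; apply/eqP; exact: mdeg1.
rewrite [X in _ *: X]mpolyE scaler_sumr; apply: eq_big_seq => m hm.
rewrite ((elimT (dhomogP _ _ _) ph) m hm).
by rewrite scalerA mulrC.
Qed.

End SymOps.

(** * Left multiplication on the symmetric algebra *)

(* The transpose with respect to the quadratic form. *)
HB.lock Definition so_tr (K : numFieldType) (m : nat) (X : 'M[K]_(m + m)) :
  'M[K]_(m + m) := so_form K m *m X^T *m so_form K m.

HB.lock Definition glS (K : numFieldType) (m : nat) (X : 'M[K]_(m + m))
  (p : Sym (so K m)) : Sym (so K m) := Sym_der (gl_so_act X) p.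

(** Each basis vector is paired with its own partial derivative, so the sum does not depend on the
    basis. The factor 1/8 makes the commutator with multiplication by y equal to [glS (x y) / 4] up
    to a scalar; the trace term carries the dependence on [k]. *)
HB.lock Definition lowerS (K : numFieldType) (m : nat) (k : nat)
  (X : 'M[K]_(m + m)) (p : Sym (so K m)) : Sym (so K m) :=
  8%:R^-1 *: \sum_i (glS (X *m vsval (coord_vec i)) p^`M(i)
    + (k%:R * \tr (X *m vsval (coord_vec i))) *: p^`M(i)).

(* Left multiplication by x in the enveloping algebra, transported to the
   symmetric algebra. *)
HB.lock Definition leftS (K : numFieldType) (m : nat) (k : nat)
  (x : so K m) (p : Sym (so K m)) : Sym (so K m) :=
  Sym_inj x * p + 2%:R^-1 *: glS (vsval x) p + lowerS k (vsval x) p.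

Section Operators.
Variables (K : numFieldType) (m : nat).
Local Notation g := (so K m).
Local Notation M2 := 'M[K]_(m + m).
Local Notation mx x := (@vsval K _ (so_space K m) x).
Implicit Types (x y z : g) (X Y : M2) (p q : Sym g).

Local Notation so_tr := (@so_tr K m).

Lemma so_tr_linear : linear so_tr.
Proof.
move=> a X Y; rewrite so_tr.unlock linearP /= mulmxDr mulmxDl -scalemxAr.
by rewrite -scalemxAl.
Qed.
HB.instance Definition _ := @GRing.isLinear.Build K M2 M2 *:%R so_tr so_tr_linear.

Lemma so_trM X Y : so_tr (X *m Y) = so_tr Y *m so_tr X.
Proof.
rewrite so_tr.unlock trmx_mul !mulmxA; congr (_ *m _ *m _).
by rewrite -!mulmxA so_formK mulmx1.
Qed.

Lemma so_trK X : so_tr (so_tr X) = X.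
Proof.
rewrite so_tr.unlock !trmx_mul trmxK so_form_tr !mulmxA so_formK mul1mx -mulmxA.
by rewrite so_formK mulmx1.
Qed.

Lemma so_spaceE X : (X \in so_space K m) = (so_tr X == - X).
Proof.
rewrite so_tr.unlock; apply/so_spaceP/eqP => [/(congr1 (mulmx (so_form K m)))|h].
  rewrite mulmxDr !mulmxA so_formK mul1mx mulmx0 => /eqP.
  by rewrite addr_eq0 => /eqP.
have := congr1 (mulmx (so_form K m)) h.
by rewrite !mulmxA so_formK mul1mx => ->; rewrite mulmxN addNr.
Qed.

Lemma val_soP a x y : mx (a *: x + y) = a *: mx x + mx y.
Proof. exact: linearP. Qed.

Lemma so_tr_so x : so_tr (mx x) = - mx x.
Proof. by apply/eqP; rewrite -so_spaceE subvsP. Qed.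

Lemma val_gl_so_act X x :
  mx (gl_so_act X x) = - (so_tr X *m mx x + mx x *m X).
Proof.
have := congr1 (mulmx (so_form K m)) (gl_so_actE X x).
rewrite mulmxA so_formK mul1mx => ->; rewrite /form_act mulmxN mulmxDr.
by rewrite so_tr.unlock !mulmxA so_formK mul1mx.
Qed.

HB.instance Definition _ X := @GRing.isLinear.Build K g g *:%R
  (@gl_so_act K m X) (let: And3 h _ _ := gl_so_actP K m in h X).

Local Notation glS := (@glS K m).

Lemma glSE X : glS X =1 Sym_der (gl_so_act X).
Proof. by move=> p; rewrite glS.unlock. Qed.

Lemma glS_linear X : linear (glS X).
Proof. by move=> a p q; rewrite !glSE linearP. Qed.

HB.instance Definition _ X := @GRing.isLinear.Build K (Sym g) (Sym g) *:%R
  (glS X) (glS_linear X).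

Lemma glS1 X : glS X 1 = 0.
Proof. by rewrite glSE Sym_der1. Qed.

Lemma glSM X p q : glS X (p * q) = glS X p * q + p * glS X q.
Proof. by rewrite !glSE Sym_derM. Qed.

Lemma glS_inj X y : glS X (Sym_inj y) = Sym_inj (gl_so_act X y).
Proof. by rewrite glSE Sym_der_inj. Qed.

Lemma glSD X p q : glS X (p + q) = glS X p + glS X q.
Proof. exact: raddfD. Qed.
Lemma glSZ X a p : glS X (a *: p) = a *: glS X p.
Proof. exact: linearZ. Qed.

Lemma glS_linear_l p : linear (glS^~ p).
Proof.
move=> a X Y; rewrite !glSE.
by have [_ h _] := Sym_actP (gl_so_mod K m); apply: (h p a X Y).
Qed.

Lemma glSZDl a X Y p : glS (a *: X + Y) p = a *: glS X p + glS Y p.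
Proof. exact: glS_linear_l. Qed.
Lemma glS0l p : glS 0 p = 0.
Proof. by have := glSZDl (-1) 0 0 p; rewrite scaler0 addr0 scaleN1r addNr. Qed.
Lemma glSZl a X p : glS (a *: X) p = a *: glS X p.
Proof. by rewrite -[a *: X]addr0 glSZDl glS0l addr0. Qed.
Lemma glSDl X Y p : glS (X + Y) p = glS X p + glS Y p.
Proof. by rewrite -[X]scale1r glSZDl !scale1r. Qed.
Lemma glSBl X Y p : glS (X - Y) p = glS X p - glS Y p.
Proof. by rewrite addrC -scaleN1r glSZDl scaleN1r addrC. Qed.

Lemma glS_bracket X Y p :
  glS (X *m Y - Y *m X) p = glS X (glS Y p) - glS Y (glS X p).
Proof.
by rewrite !glSE; have [_ _ h] := Sym_actP (gl_so_mod K m); apply: (h X Y).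
Qed.

Lemma glS_so x p : Sym_act (V := adjoint g) x p = glS (mx x) p.
Proof.
rewrite glSE; apply: eq_bigr => i _; congr (Sym_inj _ * _); symmetry.
exact: gl_so_act_so.
Qed.

(** Reduces an identity between operators to its value at 1 and to commutators with multiplications;
    [glS_lowerS] and [lowerS_comm] are proved in this way. *)
Lemma operator_eq0 (O : {linear Sym g -> Sym g}) :
  O 1 = 0 -> (forall y p, O (Sym_inj y * p) = Sym_inj y * O p) ->
  forall p, O p = 0.
Proof.
move=> O1 OM; elim/Sym_ind => // [p q hp hq|a p hp|y p hp].
- by rewrite raddfD /= hp hq addr0.
- by rewrite linearZ /= hp scaler0.
- by rewrite OM hp mulr0.
Qed.

Variable k : nat.

Local Notation lowerS := (@lowerS K m k).

Lemma lowerS_linear X : linear (lowerS X).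
Proof.
move=> a p q; rewrite lowerS.unlock scalerA mulrC -scalerA -scalerDr; congr (_ *: _).
rewrite scaler_sumr -big_split; apply: eq_bigr => i _ /=.
rewrite mderivD mderivZ (linearP (glS _)) [_ *: (_ + _)]scalerDr.
rewrite [_ *: (a *: _)]scalerA [_ * a]mulrC -[(a * _) *: _]scalerA addrACA.
by rewrite [in RHS]scalerDr.
Qed.
HB.instance Definition _ X := @GRing.isLinear.Build K (Sym g) (Sym g) *:%R
  (lowerS X) (lowerS_linear X).

Lemma lowerSD X p q : lowerS X (p + q) = lowerS X p + lowerS X q.
Proof. exact: raddfD. Qed.
Lemma lowerSZ X a p : lowerS X (a *: p) = a *: lowerS X p.
Proof. exact: linearZ. Qed.

Lemma lowerS_linear_l p : linear (lowerS^~ p).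
Proof.
move=> a X Y; rewrite lowerS.unlock scalerA mulrC -scalerA -scalerDr; congr (_ *: _).
rewrite scaler_sumr -big_split; apply: eq_bigr => i _ /=.
rewrite mulmxDl -scalemxAl glSDl glSZl linearP /= mulrDr scalerDr.
by rewrite scalerDl scalerA mulrCA addrACA.
Qed.

Lemma lowerS1 X : lowerS X 1 = 0.
Proof.
rewrite lowerS.unlock big1 ?scaler0 // => i _.
by rewrite mderivC scaler0 addr0 raddf0.
Qed.

(** Since [so_tr (x y) = y x], both sides are [- (y x z + z x y)], the Jordan triple product, which
    is symmetric in y and z. *)
Lemma gl_so_act_sym x y z :
  gl_so_act (mx x *m mx y) z = gl_so_act (mx x *m mx z) y.
Proof.
apply: subvs_inj; rewrite !val_gl_so_act !so_trM !so_tr_so.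
by rewrite !(mulNmx, mulmxN, opprK) addrC !mulmxA.
Qed.

Lemma lowerSM x y p : lowerS (mx x) (Sym_inj y * p) =
  Sym_inj y * lowerS (mx x) p + 4%:R^-1 *: glS (mx x *m mx y) p
  + (k%:R / 8%:R * \tr (mx x *m mx y)) *: p.
Proof.
have -> : 4%:R^-1 = 8%:R^-1 * 2%:R :> K by field.
rewrite [k%:R / _]mulrC -mulrA -!scalerA lowerS.unlock -scalerAr -!scalerDr.
congr (_ *: _); rewrite mulr_sumr.
have lin (U : lmodType K) (h : g -> U) : linear h ->
    \sum_i v2r y 0 i *: h (coord_vec i) = h y.
  move=> hl; pose hL : {linear g -> U} :=
    HB.pack h (@GRing.isLinear.Build K g U *:%R h hl).
  rewrite -{2}[y]coord_vec_sum -[h]/(hL : _ -> _) linear_sum.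
  by apply: eq_bigr => i _; rewrite linearZ.
have <- := lin (Sym g) (fun z => glS (mx x *m mx z) p) _; last first.
  by move=> a z z'; rewrite val_soP mulmxDr -scalemxAr glSZDl.
have <- : \sum_i v2r y 0 i * \tr (mx x *m mx (coord_vec i)) = \tr (mx x *m mx y).
  apply: (lin K^o (fun z => \tr (mx x *m mx z))).
  by move=> a z z'; rewrite val_soP mulmxDr -scalemxAr linearP.
(* The term in which y is differentiated and the term in which [glS] hits y give the same sum by
   [gl_so_act_sym]; hence the factor 2, which turns 1/8 into 1/4. *)
have -> : 2%:R *: (\sum_i v2r y 0 i *: glS (mx x *m mx (coord_vec i)) p) =
  \sum_i (v2r y 0 i *: glS (mx x *m mx (coord_vec i)) p +
           Sym_inj (gl_so_act (mx x *m mx (coord_vec i)) y) * p^`M(i)).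
  rewrite big_split /= scaler_nat mulr2n; congr (_ + _).
  rewrite (lin (Sym g) (fun z => glS (mx x *m mx z) p)); last first.
    by move=> a z z'; rewrite val_soP mulmxDr -scalemxAr glSZDl.
  rewrite glSE /Sym_der; apply: eq_bigr => i _.
  by rewrite -gl_so_act_sym.
rewrite scaler_suml scaler_sumr -!big_split /=; apply: eq_bigr => i _.
set X := mx x *m _; rewrite mderivM Sym_inj_der mul_mpolyC raddfD /= linearZ /=.
rewrite glSM glS_inj mulrDr -scalerAr [_ *: (_ + _)]scalerDr !scalerA.
rewrite [k%:R * (_ * _)]mulrCA.
set A := Sym_inj y * _; set B := Sym_inj y * _; set C := Sym_inj _ * _.
by rewrite [v2r y 0 i * _]mulrC [RHS](AC (2*2*1) ((3*(4*1))*(5*2)))%AC.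
Qed.

(* The action of the matrix Y on the space of lowering operators. *)
Definition so_dual_act Y x : g := vsproj (so_space K m) (Y *m mx x + mx x *m so_tr Y).

Lemma val_so_dual_act Y x : mx (so_dual_act Y x) = Y *m mx x + mx x *m so_tr Y.
Proof.
rewrite vsprojK // so_spaceE (raddfD so_tr) /= so_trM (so_trM (mx x)) so_trK so_tr_so.
by rewrite mulmxN mulNmx -opprD addrC.
Qed.

Lemma glS_lowerS Y x p :
  glS Y (lowerS (mx x) p) - lowerS (mx x) (glS Y p) =
  lowerS (mx (so_dual_act Y x)) p.
Proof.
apply/eqP; rewrite -subr_eq0; apply/eqP.
pose O p := glS Y (lowerS (mx x) p) - lowerS (mx x) (glS Y p) -
  lowerS (mx (so_dual_act Y x)) p.
have Ol : linear O.
  move=> a q r; rewrite /O !(linearP (lowerS _)) !(linearP (glS _)) !(linearP (lowerS _)).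
  rewrite !opprD [in RHS]scalerBr [in RHS]scalerBr.
  by rewrite [LHS](AC (2*2*2) ((1*3*5)*(2*4*6)))%AC.
pose OL : {linear Sym g -> Sym g} :=
  HB.pack O (@GRing.isLinear.Build K (Sym g) (Sym g) *:%R O Ol).
apply: (operator_eq0 (O := OL)) => [|y q]; rewrite /= /O.
  by rewrite !lowerS1 glS1 !raddf0 !addr0.
rewrite !lowerSM glSM glS_inj !glSD !lowerSD !lowerSM !glSZ !glSM glS_inj.
have e1 : mx (so_dual_act Y x) *m mx y =
    (Y *m (mx x *m mx y) - (mx x *m mx y) *m Y) - mx x *m mx (gl_so_act Y y).
  rewrite val_so_dual_act val_gl_so_act mulmxN opprK mulmxDl mulmxDr !mulmxA.
  by rewrite [RHS](AC (2*2) ((1*3)*(2*4)))%AC /= addNr addr0.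
have e2 : \tr (mx (so_dual_act Y x) *m mx y) = - \tr (mx x *m mx (gl_so_act Y y)).
  by rewrite e1 !linearB /= [\tr (Y *m _)]mxtrace_mulC subrr sub0r.
rewrite e2 e1 glSBl glS_bracket.
rewrite mulrN scaleNr -!mul_mpolyC.
ring.
Qed.

Lemma linear_pack (U : lmodType K) (f : Sym g -> U) : linear f ->
  {h : {linear Sym g -> U} | f = h :> (Sym g -> U)}.
Proof.
move=> fl; pose h : {linear Sym g -> U} :=
  HB.pack f (@GRing.isLinear.Build K (Sym g) U *:%R f fl).
by exists h.
Qed.

Lemma lowerS_comm x y p :
  lowerS (mx x) (lowerS (mx y) p) = lowerS (mx y) (lowerS (mx x) p).
Proof.
apply/eqP; rewrite -subr_eq0; apply/eqP.
pose O p := lowerS (mx x) (lowerS (mx y) p) - lowerS (mx y) (lowerS (mx x) p).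
have [OL eO] : {h : {linear Sym g -> Sym g} | O = h :> (Sym g -> Sym g)}.
  apply: linear_pack => a q r; rewrite /O !lowerSD !lowerSZ scalerBr opprD.
  by rewrite addrACA.
rewrite -/(O p) eO; apply: operator_eq0 => [|z q]; rewrite -eO /O.
  by rewrite !lowerS1 !raddf0 addr0.
rewrite !lowerSM !lowerSD !lowerSM !lowerSZ.
have h u v w : glS (mx u *m mx v) (lowerS (mx w) q) =
    lowerS (mx w) (glS (mx u *m mx v) q) +
    lowerS (mx (so_dual_act (mx u *m mx v) w)) q.
  by rewrite -glS_lowerS addrC subrK.
have -> := h x z y; have -> := h y z x.
(* Both sides are [x z y + y z x], so the terms left over by the two orders coincide. *)
have -> : so_dual_act (mx x *m mx z) y = so_dual_act (mx y *m mx z) x.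
  apply: subvs_inj; rewrite !val_so_dual_act !so_trM !so_tr_so.
  by rewrite !(mulNmx, mulmxN, opprK) addrC !mulmxA.
rewrite -!mul_mpolyC.
ring.
Qed.

Local Notation leftS := (@leftS K m k).

Lemma gl_so_act_bracket x y : gl_so_act (mx x) y = bracket x y.
Proof. exact: gl_so_act_so. Qed.

Lemma val_bracket x y : mx (bracket x y) = mx x *m mx y - mx y *m mx x.
Proof. exact: so_bracketE. Qed.

Lemma so_dual_act_bracket x y : so_dual_act (mx x) y = bracket x y.
Proof.
by apply: subvs_inj; rewrite val_so_dual_act so_tr_so mulmxN val_bracket.
Qed.

Lemma leftSE x p : leftS x p =
  Sym_inj x * p + 2%:R^-1 *: glS (mx x) p + lowerS (mx x) p.
Proof. by rewrite leftS.unlock. Qed.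

Lemma leftS_linear x : linear (leftS x).
Proof.
move=> a p q; rewrite !leftSE mulrDr glSD glSZ lowerSD lowerSZ !scalerDr.
rewrite -scalerAr [2%:R^-1 *: (a *: _)]scalerA [2%:R^-1 * a]mulrC -scalerA.
by rewrite [LHS](AC (2*2*2) ((1*3*5)*(2*4*6)))%AC.
Qed.
HB.instance Definition _ x := @GRing.isLinear.Build K (Sym g) (Sym g) *:%R
  (leftS x) (leftS_linear x).

Lemma leftSD x p q : leftS x (p + q) = leftS x p + leftS x q.
Proof. exact: raddfD. Qed.
Lemma leftSZ x a p : leftS x (a *: p) = a *: leftS x p.
Proof. exact: linearZ. Qed.

Lemma leftS_linear_l p : linear (leftS^~ p).
Proof.
move=> a x y; rewrite !leftSE val_soP glSDl glSZl lowerS_linear_l linearP /=.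
rewrite mulrDl !scalerDr -scalerAl [2%:R^-1 *: (a *: _)]scalerA.
rewrite [2%:R^-1 * a]mulrC -scalerA.
by rewrite [LHS](AC (2*2*2) ((1*3*5)*(2*4*6)))%AC.
Qed.

Lemma glS_leftS x y p :
  glS (mx x) (leftS y p) = leftS y (glS (mx x) p) + leftS (bracket x y) p.
Proof.
have := glS_lowerS (mx x) y p; rewrite so_dual_act_bracket => h.
rewrite !leftSE !glSD glSM glSZ glS_inj gl_so_act_bracket -h.
rewrite val_bracket glS_bracket -!mul_mpolyC.
ring.
Qed.

Lemma mpolyC_half (N : nat) :
  (2%:R^-1)%:MP_[N] + (2%:R^-1)%:MP_[N] = 1 :> {mpoly K[N]}.
Proof. by rewrite -mpolyCD (_ : _ + _ = 1 :> K) //; field. Qed.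

(** Multiplications commute with each other, so do lowering operators, and the trace in [lowerSM] is
    symmetric. Hence the commutator of multiplication plus lowering by x and by y is a quarter of
    the adjoint action of [bracket x y]; another quarter comes from the two halves of the adjoint
    actions, and together they give the middle term of [leftS]. *)
Lemma leftS_bracket x y p :
  leftS (bracket x y) p = leftS x (leftS y p) - leftS y (leftS x p).
Proof.
rewrite !leftSE !glSD !lowerSD !lowerSM !glSM !glSZ !lowerSZ !glS_inj.
rewrite !gl_so_act_bracket.
have hxy := glS_lowerS (mx x) y p; rewrite so_dual_act_bracket in hxy.
have hyx := glS_lowerS (mx y) x p; rewrite so_dual_act_bracket in hyx.
have e : bracket y x = - bracket x y.
  by apply: subvs_inj; rewrite linearN /= !val_bracket opprB.
have -> : glS (mx x) (lowerS (mx y) p) =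
    lowerS (mx y) (glS (mx x) p) + lowerS (mx (bracket x y)) p.
  by rewrite -hxy addrC subrK.
have -> : glS (mx y) (lowerS (mx x) p) =
    lowerS (mx x) (glS (mx y) p) - lowerS (mx (bracket x y)) p.
  move: hyx; rewrite e linearN /= => /eqP; rewrite subr_eq => /eqP ->.
  have := lowerS_linear_l p (-1) (mx (bracket x y)) 0.
  have := lowerS_linear_l p (-1) 0 0; rewrite scaler0 addr0 scaleN1r addNr => ->.
  by rewrite addr0 scaleN1r addr0 scaleN1r => ->; rewrite addrC.
rewrite (lowerS_comm y x) e [\tr (mx y *m _)]mxtrace_mulC.
rewrite [Sym_inj (- _)]linearN /= !scalerDr.
rewrite val_bracket !glS_bracket.
have e3 : glS (mx x *m mx y) p = glS (mx y *m mx x) p +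
    (glS (mx x) (glS (mx y) p) - glS (mx y) (glS (mx x) p)).
  by rewrite -glS_bracket glSBl addrC subrK.
have -> : 4%:R^-1 = 2%:R^-1 * 2%:R^-1 :> K by field.
rewrite e3 -!mul_mpolyC mpolyCM.
(* Only [c + c = 1] matters about one half: the difference of the two sides is a multiple of
   [1 - (c + c)]. *)
move: ((2%:R^-1)%:MP_[_]) (mpolyC_half (dim g)) => c h2.
apply/eqP; rewrite -subr_eq0; apply/eqP.
transitivity ((1 - (c + c)) * (Sym_inj (so_bracket x y) * p +
  lowerS (mx x *m mx y - mx y *m mx x) p +
  c * (glS (mx x) (glS (mx y) p) - glS (mx y) (glS (mx x) p)))).
  ring.
by rewrite h2 subrr mul0r.
Qed.

End Operators.

(** * The action of the symmetric algebra on modules *)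

Section ModAct.
Variables (K : fieldType) (L : lieAlgebra K) (M : lieModule L).
Implicit Types (x y : L) (u v : M).

Lemma mod_act_linear x : linear (@mod_act K L M x).
Proof. by case: (mod_actP M). Qed.

HB.instance Definition _ x :=
  @GRing.isLinear.Build K M M *:%R (@mod_act K L M x) (mod_act_linear x).

Lemma mod_actD x u v : mod_act x (u + v) = mod_act x u + mod_act x v.
Proof. exact: raddfD. Qed.
Lemma mod_actB x u v : mod_act x (u - v) = mod_act x u - mod_act x v.
Proof. exact: raddfB. Qed.
Lemma mod_act0 x : mod_act x (0 : M) = 0.
Proof. exact: raddf0. Qed.
Lemma mod_actZ x a u : mod_act x (a *: u) = a *: mod_act x u.
Proof. exact: linearZ. Qed.
Lemma mod_act_lin_l u : linear (@mod_act K L M ^~ u).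
Proof. by case: (mod_actP M). Qed.
Lemma mod_act0l u : mod_act 0 u = 0.
Proof.
have := mod_act_lin_l u (-1) 0 0.
by rewrite scaler0 addr0 scaleN1r addNr.
Qed.
Lemma mod_actZl a x u : mod_act (a *: x) u = a *: mod_act x u.
Proof. by have := mod_act_lin_l u a x 0; rewrite !addr0 mod_act0l addr0. Qed.
Lemma mod_actDl x y u : mod_act (x + y) u = mod_act x u + mod_act y u.
Proof. by have := mod_act_lin_l u 1 x y; rewrite !scale1r. Qed.
Lemma mod_actNl x u : mod_act (- x) u = - mod_act x u.
Proof. by rewrite -[- x]scaleN1r mod_actZl scaleN1r. Qed.
Lemma mod_act_bracket x y u :
  mod_act (bracket x y) u = mod_act x (mod_act y u) - mod_act y (mod_act x u).
Proof. by case: (mod_actP M). Qed.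
Lemma mod_act_suml (I : Type) (r : seq I) (P : pred I) (F : I -> L) u :
  mod_act (\sum_(i <- r | P i) F i) u = \sum_(i <- r | P i) mod_act (F i) u.
Proof.
elim/big_rec2: _ => [|i x y _ <-]; first exact: mod_act0l.
exact: mod_actDl.
Qed.
End ModAct.

Section Generation.
Variables (K : numFieldType) (m : nat) (k : nat).
Local Notation g := (so K m).
Local Notation M2 := 'M[K]_(m + m).
Local Notation mx x := (@vsval K _ (so_space K m) x).
Local Notation leftS := (@leftS K m k).
Local Notation lowerS := (@lowerS K m k).
Implicit Types (x y z : g) (X Y : M2) (p q : Sym g).

Definition tailS x p : Sym g := 2%:R^-1 *: glS (mx x) p + lowerS (mx x) p.

Lemma leftS_tail x p : leftS x p = Sym_inj x * p + tailS x p.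
Proof. by rewrite leftSE addrA. Qed.

Lemma tailS_linear x : linear (tailS x).
Proof.
move=> a p q; have := leftS_linear k x a p q.
rewrite !leftS_tail mulrDr scalerDr -scalerAr [RHS]addrACA.
exact: addrI.
Qed.
HB.instance Definition _ x := @GRing.isLinear.Build K (Sym g) (Sym g) *:%R
  (tailS x) (tailS_linear x).

(** Minus right multiplication by x, as the adjoint action is the left minus the right
    multiplication. *)
Definition rightS x p : Sym g := glS (mx x) p - leftS x p.

Lemma rightS_leftS x y p : rightS x (leftS y p) = leftS y (rightS x p).
Proof.
rewrite /rightS glS_leftS leftS_bracket raddfB /=.
by rewrite -addrA; congr (_ + _); rewrite addrAC subrr sub0r.
Qed.

Lemma rightS_linear x : linear (rightS x).
Proof.
move=> a p q; rewrite /rightS glSD glSZ leftSD leftSZ opprD scalerBr.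
by rewrite addrACA.
Qed.
HB.instance Definition _ x := @GRing.isLinear.Build K (Sym g) (Sym g) *:%R
  (rightS x) (rightS_linear x).

Lemma hdeg_glS X d p : hdeg d p -> hdeg d (glS X p).
Proof. by move=> hp; rewrite glSE; apply: hdeg_Sym_der. Qed.

Lemma hdeg_lowerS X d p : hdeg d.+1 p -> hdeg d (lowerS X p).
Proof.
move=> hp; rewrite lowerS.unlock; apply: hdegZ; apply: hdeg_sum => i _.
by apply: hdegD; [apply: hdeg_glS | apply: hdegZ]; apply: mderiv_hdeg.
Qed.

Lemma hdeg0_lowerS X p : hdeg 0 p -> lowerS X p = 0.
Proof.
move=> hp; rewrite lowerS.unlock big1 ?scaler0 // => i _.
by rewrite hdeg0_mderiv // scaler0 addr0 raddf0.
Qed.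

Lemma hdeg_tailS x d p : hdeg d p -> filt d (tailS x p).
Proof.
move=> hp; apply: filtD; first by apply: filt_hdeg (hdegZ _ (hdeg_glS _ hp)).
case: d hp => [|d] hp; last exact: filt_hdeg (leqnSn d) (hdeg_lowerS _ hp).
by rewrite hdeg0_lowerS //; apply: filt_hdeg (hdeg0 _ 0).
Qed.

Lemma filt_tailS x d p : filt d p -> filt d (tailS x p).
Proof.
move: p; apply: filt_ind_lin => [p q hp hq|e p le hp].
  by rewrite raddfD; apply: filtD.
exact: filtW le (hdeg_tailS x hp).
Qed.

Lemma filt_leftS x d p : filt d p -> filt d.+1 (leftS x p).
Proof.
move=> fp; rewrite leftS_tail; apply: filtD; first exact: filtM.
exact: filtW (leqnSn d) (filt_tailS x fp).
Qed.

Lemma leftS_ind (P : Sym g -> Prop) :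
  P 1 -> (forall p q, P p -> P q -> P (p + q)) ->
  (forall a p, P p -> P (a *: p)) ->
  (forall x p, P p -> P (leftS x p)) -> forall p, P p.
Proof.
move=> P1 PD PZ PL; apply: Sym_filt_ind => // d IH x q hq.
have -> : Sym_inj x * q = leftS x q + (-1) *: tailS x q.
  by rewrite leftS_tail scaleN1r addrK.
apply: (PD); first by apply/PL/IH/(filt_hdeg (leqnn d)).
by apply/PZ/IH/hdeg_tailS.
Qed.

Lemma rightS_ind (P : Sym g -> Prop) :
  P 1 -> (forall p q, P p -> P q -> P (p + q)) ->
  (forall a p, P p -> P (a *: p)) ->
  (forall x p, P p -> P (rightS x p)) -> forall p, P p.
Proof.
move=> P1 PD PZ PR; apply: Sym_filt_ind => // d IH x q hq.
have -> : Sym_inj x * q =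
    (-1) *: rightS x q + (glS (mx x) q + (-1) *: tailS x q).
  by rewrite /rightS leftS_tail !scaleN1r opprB addrA subrK addrK.
apply: (PD); first by apply/PZ/PR/IH/(filt_hdeg (leqnn d)).
apply: (PD); first by apply/IH/(filt_hdeg (leqnn d))/hdeg_glS.
by apply/PZ/IH/hdeg_tailS.
Qed.

End Generation.

(** * The universal property of the left module *)

Section Universal.
Variables (K : numFieldType) (m : nat) (k : nat).
Local Notation g := (so K m).
Local Notation M2 := 'M[K]_(m + m).
Local Notation leftS := (@leftS K m k).
Local Notation tailS := (@tailS K m k).
Variable M : lieModule g.
Implicit Types (x y z : g) (X Y : M2) (p q : Sym g) (u v : M).

(** Recursion on the degree: by Euler's identity p is its constant term plus products of a variable
    with an element of lower degree, and such a product is [leftS] minus [tailS], where [tailS] does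
    not raise the degree. [n] bounds the depth of the recursion; the value is the intended one when
    the degree is at most [n]. *)
Fixpoint act_trunc v n p : M :=
  p@_0%MM *: v + if n is n'.+1 then
    \sum_i (mod_act (coord_vec i : g) (act_trunc v n' (Euler_inv p^`M(i)))
            - act_trunc v n' (tailS (coord_vec i) (Euler_inv p^`M(i))))
  else 0.

Lemma act_trunc_linear v n : linear (act_trunc v n).
Proof.
elim: n => [|n IHn] a p q /=.
  by rewrite !addr0 mcoeffD mcoeffZ scalerDl scalerA.
rewrite mcoeffD mcoeffZ scalerDl [in RHS]scalerDr scalerA [RHS]addrACA.
congr (_ + _); rewrite scaler_sumr -big_split /=; apply: eq_bigr => i _.
rewrite mderivD mderivZ !linearP /= !IHn linearP /=.
by rewrite scalerBr opprD addrACA.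
Qed.
HB.instance Definition _ v n := @GRing.isLinear.Build K (Sym g) M *:%R
  (act_trunc v n) (act_trunc_linear v n).

Lemma act_truncD v n p q :
  act_trunc v n (p + q) = act_trunc v n p + act_trunc v n q.
Proof. exact: raddfD. Qed.
Lemma act_truncZ v n a p : act_trunc v n (a *: p) = a *: act_trunc v n p.
Proof. exact: linearZ. Qed.

Lemma act_trunc_succ v n p : act_trunc v n.+1 p =
  p@_0%MM *: v +
    \sum_i (mod_act (coord_vec i : g) (act_trunc v n (Euler_inv p^`M(i)))
            - act_trunc v n (tailS (coord_vec i) (Euler_inv p^`M(i)))).
Proof. by []. Qed.

Lemma act_trunc1 v n : act_trunc v n 1 = v.
Proof.
case: n => [|n] /=; rewrite mcoeff1 eqxx scale1r ?addr0 // big1 ?addr0 // => i _.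
by rewrite mderivC !raddf0 addr0.
Qed.

(** The value that the action has to take at the ordinary product [Sym_inj x * p]. *)
Definition lincl v n x p : M := mod_act x (act_trunc v n p) - act_trunc v n (tailS x p).

Lemma mcoeff0_inj x p : (Sym_inj x * p)@_0%MM = 0.
Proof.
rewrite -[RHS](mul0r (p@_0%MM)); have -> : (0 : K) = (Sym_inj x)@_0%MM.
  rewrite /Sym_inj raddf_sum big1 // => i _ /=.
  by rewrite mcoeffZ mcoeffX mnm1_eq0 mulr0.
exact: (rmorphM (@mcoeff (dim g) K 0%MM)).
Qed.

Lemma hdegS_mcoeff0 d p : hdeg d.+1 p -> p@_0%MM = 0.
Proof.
apply: (hdeg_ind_lin (P := fun p => p@_0%MM = 0)) => //
  [q r hq hr|a q hq||d' x q _ _].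
- by rewrite mcoeffD hq hr addr0.
- by rewrite mcoeffZ hq mulr0.
- exact: mcoeff0.
- exact: mcoeff0_inj.
Qed.

Lemma tailS_linear_l a x y p :
  tailS (a *: x + y) p = a *: tailS x p + tailS y p.
Proof.
have := leftS_linear_l k p a x y; rewrite !leftS_tail linearP /=.
rewrite mulrDl scalerDr -scalerAl [RHS]addrACA; exact: addrI.
Qed.

Lemma lincl_linear_l v n p : linear (fun x => lincl v n x p).
Proof.
move=> a x y; rewrite /lincl mod_act_lin_l tailS_linear_l linearP /=.
by rewrite opprD scalerBr addrACA.
Qed.

Lemma lincl_linear v n x : linear (lincl v n x).
Proof.
move=> a p q; rewrite /lincl act_trunc_linear mod_act_linear tailS_linear act_trunc_linear.
by rewrite opprD scalerBr addrACA.
Qed.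

Lemma lincl_coord v n x p :
  lincl v n x p = \sum_i v2r x 0 i *: lincl v n (coord_vec i : g) p.
Proof.
have [f ef] : {f : {linear g -> M} | forall y, lincl v n y p = f y}.
  pose f : {linear g -> M} := HB.pack (fun y => lincl v n y p)
    (@GRing.isLinear.Build K g M *:%R _ (lincl_linear_l v n p)).
  by exists f.
rewrite -{1}[x]coord_vec_sum ef linear_sum; apply: eq_bigr => i _.
by rewrite linearZ ef.
Qed.

Definition trunc_ok v n := forall d x p, (d < n)%N -> filt d p ->
  act_trunc v n (leftS x p) = mod_act x (act_trunc v n p).

Lemma trunc_ok_lincl v n d x p : trunc_ok v n -> (d < n)%N -> filt d p ->
  lincl v n x p = act_trunc v n (Sym_inj x * p).
Proof.
move=> ok lt fp; rewrite /lincl -(ok d) // leftS_tail raddfD /=.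
exact: addrK.
Qed.

(** The consistency condition: x y q and y x q are the same product, so they must act alike. The
    difference of the two values contains the action of a bracket, which by [ok] is the image of
    [leftS (bracket x y) q], and [leftS_bracket] makes everything cancel. *)
Lemma lincl_sym v n d x y q : trunc_ok v n -> (d < n)%N -> filt d q ->
  lincl v n y (Sym_inj x * q) = lincl v n x (Sym_inj y * q).
Proof.
move=> ok lt fq; apply/eqP; rewrite -subr_eq0; apply/eqP; rewrite {1 2}/lincl.
rewrite -!(trunc_ok_lincl _ ok lt fq) /lincl !mod_actB.
rewrite -2!(ok d _ (tailS _ _) lt (filt_tailS k _ fq)).
rewrite [LHS](_ : _ = mod_act y (mod_act x (act_trunc v n q))
   - mod_act x (mod_act y (act_trunc v n q))
   - act_trunc v n ((leftS y (tailS x q) + tailS y (Sym_inj x * q))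
                  - (leftS x (tailS y q) + tailS x (Sym_inj y * q)))).
  rewrite -mod_act_bracket -(ok d) // leftS_bracket -raddfB /=.
  rewrite [X in act_trunc _ _ X](_ : _ = 0) ?raddf0 //.
  rewrite !leftS_tail raddfD /= [tailS x (_ + _)]raddfD /= !mulrDr.
  ring.
have act4 (a b c e : Sym g) : act_trunc v n ((a + b) - (c + e)) =
    act_trunc v n a + act_trunc v n b - (act_trunc v n c + act_trunc v n e).
  by rewrite raddfB /= !raddfD.
rewrite act4 !(opprD, opprK) !addrA.
by rewrite [LHS](AC 6 (1*4*2*3*5*6))%AC.
Qed.

Lemma act_trunc_hdeg v n d p : hdeg d.+1 p -> act_trunc v n.+1 p =
  d.+1%:R^-1 *: \sum_i lincl v n (coord_vec i : g) p^`M(i).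
Proof.
move=> hp; rewrite act_trunc_succ (hdegS_mcoeff0 hp) scale0r add0r.
rewrite scaler_sumr; apply: eq_bigr => i _.
rewrite (Euler_inv_hdeg (mderiv_hdeg i hp)) -/(lincl _ _ _ _).
have := lincl_linear v n (coord_vec i : g) d.+1%:R^-1 p^`M(i) 0.
by rewrite !addr0 => ->; rewrite /lincl !raddf0 ?mod_act0 ?oppr0 !addr0.
Qed.

Lemma lincl_sum v n x (F : 'I_(dim g) -> Sym g) :
  lincl v n x (\sum_i F i) = \sum_i lincl v n x (F i).
Proof.
pose f : {linear Sym g -> M} := HB.pack (lincl v n x)
    (@GRing.isLinear.Build K (Sym g) M *:%R _ (lincl_linear v n x)).
exact: (linear_sum f).
Qed.

Lemma trunc_ok_stable v n p : trunc_ok v n -> filt n p ->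
  act_trunc v n.+1 p = act_trunc v n p.
Proof.
move=> ok; move: p; apply: filt_ind_lin => [p q hp hq|d p le hp].
  by rewrite !act_truncD hp hq.
case: d le hp => [|d] le hp.
  have zero i : p^`M(i) = 0 by apply: hdeg0_mderiv.
  rewrite act_trunc_succ big1 => [|i _]; last first.
    by rewrite zero !raddf0 ?mod_act0 addr0.
  by case: n {ok le} => [|n] //=; rewrite big1 // => i _;
    rewrite zero !raddf0 ?mod_act0 addr0.
rewrite (act_trunc_hdeg _ _ hp).
have -> : \sum_i lincl v n (coord_vec i : g) p^`M(i) =
   act_trunc v n (\sum_i 'X_i * p^`M(i)).
  rewrite raddf_sum; apply: eq_bigr => i _ /=; rewrite -Sym_inj_coord.
  exact: (trunc_ok_lincl _ ok le (filt_hdeg (leqnn d) (mderiv_hdeg i hp))).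
by rewrite (Sym_euler hp) act_truncZ scalerA mulVf ?scale1r // pnatr_eq0.
Qed.

Lemma trunc_ok_lincl_top v n d x p : trunc_ok v n -> (d <= n)%N -> hdeg d p ->
  act_trunc v n.+1 (Sym_inj x * p) = lincl v n x p.
Proof.
move=> ok le hp; rewrite (act_trunc_hdeg _ _ (hdegM x hp)).
have lin := lincl_linear v n.
have -> : \sum_i lincl v n (coord_vec i : g) (Sym_inj x * p)^`M(i) =
   lincl v n x p + \sum_i lincl v n (coord_vec i : g) (Sym_inj x * p^`M(i)).
  rewrite (lincl_coord v n x) -big_split; apply: eq_bigr => i _ /=.
  by rewrite mderivM Sym_inj_der mul_mpolyC lin.
(* By [lincl_sym] every summand can be rewritten with x outermost. Euler's identity then counts [d]
   copies; together with the copy in which x itself is differentiated they cancel [d.+1]. *)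
suff -> : \sum_i lincl v n (coord_vec i : g) (Sym_inj x * p^`M(i)) =
   d%:R *: lincl v n x p.
  rewrite -{1}[lincl v n x p]scale1r -scalerDl addrC natr1 scalerA.
  by rewrite mulVf ?scale1r // pnatr_eq0.
have -> : d%:R *: lincl v n x p = lincl v n x (\sum_i 'X_i * p^`M(i)).
  rewrite (Sym_euler hp); have := lin x d%:R p 0; rewrite !addr0 => ->.
  by rewrite /lincl !raddf0 ?mod_act0 ?oppr0 !addr0.
rewrite lincl_sum; apply: eq_bigr => i _; rewrite -Sym_inj_coord.
case: d le hp => [|d] le hp.
  by rewrite (hdeg0_mderiv i hp) !mulr0 /lincl !raddf0 ?mod_act0 addr0.
exact: (lincl_sym _ _ ok le (filt_hdeg (leqnn d) (mderiv_hdeg i hp))).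
Qed.

Lemma act_trunc_ok v n : trunc_ok v n.
Proof.
elim: n => [//|n ok] d x p; rewrite ltnS leq_eqVlt => /predU1P[->|lt fp].
  move: p; apply: filt_ind_lin => [p q hp hq|{}d p le hp].
    by rewrite leftSD !act_truncD hp hq mod_actD.
  rewrite leftS_tail act_truncD.
  rewrite (trunc_ok_lincl_top x ok le hp).
  have st q : filt d q -> act_trunc v n.+1 q = act_trunc v n q.
    by move=> fq; apply: trunc_ok_stable (filtW le fq).
  by rewrite !st ?subrK //; [apply: filt_hdeg hp|apply: hdeg_tailS].
rewrite trunc_ok_stable //; last by apply: filtW (filt_leftS k x fp).
by rewrite (ok d) // trunc_ok_stable //; apply: filtW (ltnW lt) fp.
Qed.

Lemma act_trunc_stable v n n' p : (n <= n')%N -> filt n p ->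
  act_trunc v n' p = act_trunc v n p.
Proof.
move=> /subnK <- fp; elim: (n' - n)%N => [//|d IHd].
rewrite addSn trunc_ok_stable //; first exact: act_trunc_ok.
by apply: filtW fp; rewrite leq_addl.
Qed.

End Universal.

(* The action on v of the element of the enveloping algebra that corresponds
   to p when multiplication by x is replaced by leftS x. *)
HB.lock Definition env_act (K : numFieldType) (m k : nat)
  (M : lieModule (so K m)) (v : M) (p : Sym (so K m)) : M :=
  act_trunc k v (proj1_sig (boolp.cid (filt_ex p))) p.

Section EnvAct.
Variables (K : numFieldType) (m : nat) (k : nat).
Local Notation g := (so K m).
Local Notation mx x := (@vsval K _ (so_space K m) x).
Local Notation leftS := (@leftS K m k).
Local Notation rightS := (@rightS K m k).
Implicit Types (x y z : g) (p q : Sym g).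

Section OneModule.
Variable M : lieModule g.
Implicit Types (u v : M).
Local Notation env_act := (@env_act K m k M).

Lemma env_actE v p n : filt n p -> env_act v p = act_trunc k v n p.
Proof.
move=> fp; rewrite env_act.unlock; case: boolp.cid => n' /= fp'.
rewrite -(act_trunc_stable k v (leq_maxl n n') fp).
by rewrite (act_trunc_stable k v (leq_maxr n n') fp').
Qed.

Lemma env_act_linear v : linear (env_act v).
Proof.
move=> a p q; have [n fp] := filt_ex p; have [n' fq] := filt_ex q.
have {}fp := filtW (leq_maxl n n') fp; have {}fq := filtW (leq_maxr n n') fq.
rewrite (env_actE v fp) (env_actE v fq) -act_trunc_linear.
by apply: env_actE; apply: filtD => //; apply: filtZ.
Qed.
HB.instance Definition _ v := @GRing.isLinear.Build K (Sym g) M *:%R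
  (env_act v) (env_act_linear v).

Lemma env_actD v p q : env_act v (p + q) = env_act v p + env_act v q.
Proof. exact: raddfD. Qed.
Lemma env_actB v p q : env_act v (p - q) = env_act v p - env_act v q.
Proof. exact: raddfB. Qed.
Lemma env_act0 v : env_act v 0 = 0.
Proof. exact: raddf0. Qed.
Lemma env_actZ v a p : env_act v (a *: p) = a *: env_act v p.
Proof. exact: linearZ. Qed.

Lemma env_act1 v : env_act v 1 = v.
Proof. by rewrite (env_actE v (filt_hdeg (leqnn 0) (hdeg1 _))) act_trunc1. Qed.

Lemma env_act_left v x p : env_act v (leftS x p) = mod_act x (env_act v p).
Proof.
have [n fp] := filt_ex p; rewrite (env_actE v (filtW (leqnSn n) fp)).
rewrite (env_actE v (filtW (leqnSn n.+1) (filt_leftS k x fp))).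
rewrite -(act_trunc_ok k v x (ltnSn n) fp).
by rewrite (act_trunc_stable k v (leqnSn n.+1)) //; apply: filt_leftS.
Qed.

Lemma env_act_linear_l a u v p :
  env_act (a *: u + v) p = a *: env_act u p + env_act v p.
Proof.
move: p; apply: (leftS_ind (k := k)) => [|p q hp hq|b p hp|x p hp].
- by rewrite !env_act1.
- by rewrite !env_actD hp hq scalerDr addrACA.
- by rewrite !env_actZ hp scalerDr !scalerA mulrC.
- by rewrite !env_act_left hp mod_actD mod_actZ.
Qed.

Lemma env_act0l p : env_act 0 p = 0.
Proof.
have := env_act_linear_l (-1) 0 0 p.
by rewrite scaler0 addr0 scaleN1r addNr.
Qed.

Lemma env_actDl u v p : env_act (u + v) p = env_act u p + env_act v p.
Proof. by rewrite -[u]scale1r env_act_linear_l !scale1r. Qed.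

Lemma env_actZl a v p : env_act (a *: v) p = a *: env_act v p.
Proof. by rewrite -[a *: v]addr0 env_act_linear_l env_act0l addr0. Qed.

Lemma env_act_gl v x p :
  env_act v (glS (mx x) p) = mod_act x (env_act v p) - env_act (mod_act x v) p.
Proof.
move: p; apply: (leftS_ind (k := k)) => [|p q hp hq|b p hp|y p hp].
- by rewrite glS1 env_act0 !env_act1 subrr.
- by rewrite glSD !env_actD hp hq mod_actD opprD addrACA.
- by rewrite glSZ !env_actZ hp mod_actZ scalerBr.
- rewrite glS_leftS env_actD !env_act_left hp mod_actB mod_act_bracket.
  by rewrite addrC addrA subrK.
Qed.

Lemma env_act_right v x p : env_act v (rightS x p) = - env_act (mod_act x v) p.
Proof.
by rewrite env_actB env_act_gl env_act_left addrAC subrr sub0r.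
Qed.

End OneModule.

Lemma env_act_hom (M N : lieModule g) (h : M -> N) : lie_hom h ->
  forall v p, h (env_act k v p) = env_act k (h v) p.
Proof.
case=> hl hx v; apply: (leftS_ind (k := k)) => [|p q hp hq|b p hp|x p hp].
- by rewrite !env_act1.
- by rewrite !env_actD -hp -hq; have := hl 1 (env_act k v p) (env_act k v q);
    rewrite !scale1r.
- rewrite !env_actZ -hp; have := hl b (env_act k v p) 0; rewrite !addr0 => ->.
  have := hl (-1) 0 0; rewrite scaler0 addr0 scaleN1r addNr => ->.
  by rewrite addr0.
- by rewrite !env_act_left hx hp.
Qed.

End EnvAct.

(** * Root vectors *)

(** The index of [e_(-a)]; [so_form] is the permutation matrix of [bar]. *)
Definition bar (m : nat) (a : 'I_(m + m)) : 'I_(m + m) :=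
  match split a with inl i => rshift m i | inr i => lshift m i end.

Section Bar.
Variable m : nat.
Implicit Types (a b : 'I_(m + m)) (i j : 'I_m).

Lemma bar_lshift i : bar (lshift m i) = rshift m i.
Proof. by rewrite /bar -/(unsplit (inl _ i)) unsplitK. Qed.
Lemma bar_rshift i : bar (rshift m i) = lshift m i.
Proof. by rewrite /bar -/(unsplit (inr _ i)) unsplitK. Qed.

Variant lrshift_spec : 'I_(m + m) -> Type :=
| LShift i : lrshift_spec (lshift m i)
| RShift i : lrshift_spec (rshift m i).

Lemma lrshiftP a : lrshift_spec a.
Proof. by rewrite -(splitK a); case: (split a) => i /=; constructor. Qed.

Lemma barK : involutive (@bar m).
Proof. by move=> a; case: (lrshiftP a) => i; rewrite ?(bar_lshift, bar_rshift). Qed.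

Lemma bar_inj : injective (@bar m).
Proof. exact: (can_inj barK). Qed.

Lemma bar_neq a : bar a != a.
Proof.
by case: (lrshiftP a) => i; rewrite ?(bar_lshift, bar_rshift) ?eq_rlshift
  ?eq_lrshift.
Qed.

Lemma eq_bar a b : (a == bar b) = (bar a == b).
Proof. by rewrite -(inj_eq bar_inj) barK. Qed.
End Bar.

Section RootElements.
Variables (K : numFieldType) (m : nat).
Local Notation g := (so K m).
Local Notation M2 := 'M[K]_(m + m).
Local Notation mx x := (@vsval K _ (so_space K m) x).
Local Notation so_tr := (@so_tr K m).
Implicit Types (x y z : g) (X Y : M2) (a b c d : 'I_(m + m)).

Lemma val_soD x y : mx (x + y) = mx x + mx y. Proof. exact: raddfD. Qed.
Lemma val_soN x : mx (- x) = - mx x. Proof. exact: raddfN. Qed.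
Lemma val_soZ (r : K) x : mx (r *: x) = r *: mx x. Proof. exact: linearZ. Qed.

Lemma so_formE a b : so_form K m a b = (b == bar a)%:R.
Proof.
rewrite /so_form; case: (lrshiftP a) => i; case: (lrshiftP b) => j;
  rewrite ?(block_mxEul, block_mxEur, block_mxEdl, block_mxEdr)
    ?(bar_lshift, bar_rshift) !mxE.
- by rewrite eq_lrshift.
- by rewrite eq_rshift eq_sym.
- by rewrite eq_lshift eq_sym.
- by rewrite eq_rlshift.
Qed.

Lemma so_trE X a b : so_tr X a b = X (bar b) (bar a).
Proof.
rewrite so_tr.unlock mxE (bigD1 (bar b)) //= big1 ?addr0; last first.
  by move=> c; rewrite so_formE eq_bar eq_sym => /negPf ->; rewrite mulr0.
rewrite so_formE barK eqxx mulr1 mxE (bigD1 (bar a)) //= big1 ?addr0.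
  by rewrite so_formE eqxx mul1r mxE.
by move=> c; rewrite so_formE => /negPf ->; rewrite mul0r.
Qed.

Lemma so_trEP x a b : mx x (bar b) (bar a) = - mx x a b.
Proof. by rewrite -so_trE so_tr_so mxE. Qed.

Lemma so_tr_delta a b : so_tr (delta_mx a b) = delta_mx (bar b) (bar a).
Proof. by apply/matrixP => c d; rewrite so_trE !mxE -!eq_bar andbC. Qed.

Definition so_proj X : g := vsproj (so_space K m) (X - so_tr X).

Lemma val_so_proj X : mx (so_proj X) = X - so_tr X.
Proof.
by rewrite vsprojK // so_spaceE raddfB /= so_trK opprB.
Qed.

(** With all pairs of indices, Cartan elements ([b = a]) and root vectors of every type have one
    formula; the price is that [soE a b] and [soE (bar b) (bar a)] agree up to sign. *)
Definition soE a b : g := so_proj (delta_mx a b).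

Lemma val_soE a b : mx (soE a b) = delta_mx a b - delta_mx (bar b) (bar a).
Proof. by rewrite val_so_proj so_tr_delta. Qed.

Lemma soE_bar a b : soE (bar b) (bar a) = - soE a b.
Proof. by apply: subvs_inj; rewrite linearN /= !val_soE !barK opprB. Qed.

Lemma soE_bar0 a : soE a (bar a) = 0.
Proof. by apply: subvs_inj; rewrite linear0 /= val_soE barK subrr. Qed.

Lemma gl_so_act_soE c d a b : gl_so_act (delta_mx c d) (soE a b) =
  - ((b == c)%:R *: soE a d + (c == bar a)%:R *: soE (bar d) b).
Proof.
apply: subvs_inj; rewrite val_gl_so_act val_soN val_soD !val_soZ !val_soE.
rewrite so_tr_delta mulmxBr mulmxBl !mul_delta_mx_cond !barK.
rewrite (inj_eq (@bar_inj m)) !scalerBr -!scaler_nat -(inj_eq (@bar_inj m) (bar a)) barK.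
rewrite [bar c == a]eq_sym eq_bar [bar a == c]eq_sym [c == b]eq_sym.
by congr (- _); rewrite [LHS](AC (2*2) ((3*2)*(1*4)))%AC.
Qed.

Lemma gl_so_act_lin_l (r : K) X Y x :
  gl_so_act (r *: X + Y) x = r *: gl_so_act X x + gl_so_act Y x.
Proof. by have [_ h _] := gl_so_actP K m; apply: (h x r X Y). Qed.

Lemma bracket_soE a b c d : bracket (soE a b) (soE c d) =
  (b == c)%:R *: soE a d - (d == a)%:R *: soE c b
  - (a == bar c)%:R *: soE (bar b) d + (d == bar b)%:R *: soE c (bar a).
Proof.
rewrite -gl_so_act_bracket val_soE.
rewrite addrC -scaleN1r gl_so_act_lin_l scaleN1r !gl_so_act_soE opprK barK.
by rewrite ?(inj_eq (@bar_inj m)) opprD [LHS](AC (2*2) (2*3*4*1))%AC.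
Qed.

Lemma scaler_eqR (U : lmodType K) (T : eqType) (s t : T) (u v : U) :
  (s = t -> u = v) -> (s == t)%:R *: u = (s == t)%:R *: v.
Proof. by case: eqP => [st ->|_ _]; rewrite ?scale0r. Qed.

Lemma soE_weight a c d : bracket (soE a a) (soE c d) =
  ((a == c)%:R - (a == d)%:R - (a == bar c)%:R + (a == bar d)%:R) *: soE c d.
Proof.
have H (U : lmodType K) (w u1 u2 u3 u4 : U) (r1 r2 r3 r4 : K) :
  r1 *: u1 = r1 *: w -> r2 *: u2 = r2 *: w -> r3 *: u3 = r3 *: w ->
  r4 *: u4 = r4 *: w -> r1 *: u1 - r2 *: u2 - r3 *: u3 + r4 *: u4 =
  (r1 - r2 - r3 + r4) *: w.
  by move=> -> -> -> ->; rewrite scalerDl !scalerBl.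
rewrite bracket_soE. rewrite [d == a]eq_sym. rewrite [d == bar a]eq_bar [bar d == a]eq_sym.
apply: H. all: apply: scaler_eqR => -> //.
  by rewrite barK.
by rewrite barK.
Qed.

End RootElements.

(** * The ideal generated by the power of a root vector *)

Section Ideals.
Variables (K : numFieldType) (m : nat) (k : nat).
Local Notation g := (so K m).
Local Notation M2 := 'M[K]_(m + m).
Local Notation mx x := (@vsval K _ (so_space K m) x).
Local Notation soE := (@soE K m).
Local Notation leftS := (@leftS K m k).
Local Notation rightS := (@rightS K m k).
Local Notation lowerS := (@lowerS K m k).
Implicit Types (x y z u w : g) (X Y : M2) (p q : Sym g) (a b c d : 'I_(m + m)).

Lemma Sym_injZ (r : K) u : Sym_inj (r *: u) = r *: Sym_inj u.
Proof. exact: linearZ. Qed.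
Lemma Sym_injD u w : Sym_inj (u + w) = Sym_inj u + Sym_inj w.
Proof. exact: raddfD. Qed.

Lemma glS_exp X u n :
  glS X (Sym_inj u ^+ n) = n%:R *: (Sym_inj (gl_so_act X u) * Sym_inj u ^+ n.-1).
Proof.
elim: n => [|n IHn]; first by rewrite expr0 glS1 scale0r.
rewrite exprS glSM glS_inj IHn /=; case: n {IHn} => [|n].
  by rewrite scale0r mulr0 addr0 scale1r.
rewrite -scalerAr mulrCA -exprS -[X in X + _]scale1r -scalerDl.
by rewrite -[1 in LHS]/(1%:R) -natrD.
Qed.

(** The rank two condition makes [gl_so_act (x u) u] a multiple of u, so powers of u are lowered to
    powers of u. The trace term supplies [k] and the action on the remaining powers supplies [- n];
    thus the power [k.+1] is killed. *)
Lemma lowerS_exp x u n :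
  mx u *m mx x *m mx u = (2%:R^-1 * \tr (mx x *m mx u)) *: mx u ->
  lowerS (mx x) (Sym_inj u ^+ n.+1) =
  (8%:R^-1 * \tr (mx x *m mx u) * n.+1%:R * (k%:R - n%:R)) *: Sym_inj u ^+ n.
Proof.
move=> rk2; have act : gl_so_act (mx x *m mx u) u = - \tr (mx x *m mx u) *: u.
  apply: subvs_inj; rewrite val_gl_so_act so_trM !so_tr_so mulNmx mulmxN opprK.
  rewrite !mulmxA rk2 -scalerDl -mulrDl val_soZ -scaleNr; congr (_ *: _).
  rewrite -mulr2n -mulr_natr. 
  by field.
elim: n => [|n IHn].
  rewrite expr1 -[Sym_inj u]mulr1 lowerSM lowerS1 glS1 mulr0 scaler0 !add0r.
  rewrite expr0 subr0 mulr1; congr (_ *: _).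
  by field.
rewrite exprS lowerSM IHn glS_exp act -scalerAr -exprS Sym_injZ.
rewrite -scalerAl /= -exprS !scalerA -!scalerDl; congr (_ *: _).
rewrite -!natr1 /=.
by field.
Qed.

Lemma mxtrace_soE a b x : \tr (mx x *m mx (soE a b)) = 2%:R * mx x b a.
Proof.
have trE i j : \tr (mx x *m delta_mx i j) = mx x j i.
  rewrite /mxtrace (bigD1 j) //= big1 ?addr0 => [|l lj].
    rewrite mxE (bigD1 i) //= big1 ?addr0 => [|l li]; rewrite mxE ?eqxx ?mulr1 //.
    by rewrite (negPf li) mulr0.
  by rewrite mxE big1 // => l' _; rewrite mxE (negPf lj) andbF mulr0.
rewrite val_soE mulmxBr raddfB /= !trE so_trEP opprK mulr_natl.
by rewrite mulr2n.
Qed.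

Lemma soE_rank2 a b x : mx (soE a b) *m mx x *m mx (soE a b) =
  (2%:R^-1 * \tr (mx x *m mx (soE a b))) *: mx (soE a b).
Proof.
rewrite mxtrace_soE mulKf ?pnatr_eq0 //.
have dE i j i' j' : delta_mx i j *m mx x *m delta_mx i' j' =
    mx x j i' *: (delta_mx i j' : M2).
  apply/matrixP => s t; rewrite mxE (bigD1 i') //= big1 ?addr0 => [|l li]; last first.
    by rewrite [delta_mx i' j' l t]mxE (negPf li) mulr0.
  rewrite mxE (bigD1 j) //= big1 ?addr0 => [|l lj]; last first.
    by rewrite mxE (negPf lj) andbF mul0r.
  by rewrite !mxE !eqxx /= andbT [_%:R * mx x j i']mulrC -mulrA -natrM mulnb.
(* The form attached to x is alternating, so its diagonal vanishes. *)
have z i : mx x i (bar i) = 0.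
  have := so_trEP x i (bar i); rewrite barK => /eqP.
  by rewrite -addr_eq0 -mulr2n mulrn_eq0 /= => /eqP.
rewrite val_soE !mulmxBl !mulmxBr !dE z.
have -> : mx x (bar a) a = 0 by rewrite -[X in mx x _ X]barK z.
by rewrite so_trEP !scale0r !subr0 sub0r scaleNr !opprK -scalerBr.
Qed.

Section Moves.
Variable N : Sym g -> Prop.
Hypothesis NZ : forall r p, N p -> N (r *: p).
Hypothesis Ngl : forall X p, N p -> N (glS X p).

(** [X] acts as a derivation that trades one factor u for [- w] and kills w; the scalars that appear
    are invertible in characteristic zero. *)
Lemma gl_move X u w n : gl_so_act X u = - w -> gl_so_act X w = 0 ->
  N (Sym_inj u ^+ n) -> N (Sym_inj w ^+ n).
Proof.
move=> Xu Xw Nu.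
suff h j : (j <= n)%N -> N (Sym_inj u ^+ (n - j) * Sym_inj w ^+ j).
  by have := h n (leqnn n); rewrite subnn mul1r.
elim: j => [|j IHj] lej; first by rewrite subn0 mulr1.
have := Ngl X (IHj (ltnW lej)).
rewrite glSM !glS_exp Xu Xw raddfN raddf0 /= mul0r scaler0 mulr0 addr0.
rewrite -scalerAl !mulNr scalerN -scaleNr => /(NZ (- (n - j)%:R^-1)).
rewrite scalerA mulrNN mulVf ?scale1r; last by rewrite pnatr_eq0 subn_eq0 -ltnNge.
by rewrite subnS -mulrA mulrCA -exprS.
Qed.

Lemma gl_move_r a b d n : b != bar a -> b != d -> 
  N (Sym_inj (soE a b) ^+ n) -> N (Sym_inj (soE a d) ^+ n).
Proof.
move=> ba bd; apply: (@gl_move (delta_mx b d)).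
  by rewrite gl_so_act_soE eqxx (negPf ba) scale1r scale0r addr0.
rewrite gl_so_act_soE (negPf ba) [d == b]eq_sym (negPf bd) !scale0r addr0.
by rewrite oppr0.
Qed.

Lemma gl_move_bar a b n : N (Sym_inj (soE a b) ^+ n) ->
  N (Sym_inj (soE (bar b) (bar a)) ^+ n).
Proof.
rewrite soE_bar raddfN /= exprNn -signr_odd => h; case: odd.
  by rewrite mulN1r -scaleN1r; apply: NZ.
by rewrite mul1r.
Qed.
End Moves.

Section GlIdeal.
Variable e : g.
Local Notation N := (@gl_span K m k e).
Local Notation I := (ideal_span N).

Lemma gl_span_glS X p : N p -> N (glS X p).
Proof. by rewrite glSE; apply: U_span_act. Qed.

Lemma gl_spanZ r p : N p -> N (r *: p).
Proof. exact: U_spanZ. Qed.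

Lemma gl_ideal_glS X p : I p -> I (glS X p).
Proof.
elim=> [q Nq||q r _ IHq _ IHr|q r Ir IHr].
- by apply: ideal_span_gen; apply: gl_span_glS.
- by rewrite raddf0; apply: ideal_span0.
- by rewrite glSD; apply: ideal_spanD.
- by rewrite glSM; apply: ideal_spanD; apply: ideal_spanM.
Qed.

Lemma gl_idealZ r p : I p -> I (r *: p).
Proof. by move=> Ip; rewrite -mul_mpolyC; apply: ideal_spanM. Qed.

Lemma gl_idealB p q : I p -> I q -> I (p - q).
Proof. by move=> Ip Iq; rewrite -scaleN1r; apply: ideal_spanD => //; apply: gl_idealZ. Qed.

Hypothesis e_rank2 : forall x, mx e *m mx x *m mx e =
  (2%:R^-1 * \tr (mx x *m mx e)) *: mx e.

Lemma lowerS_gl_span x p : N p -> lowerS (mx x) p = 0.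
Proof.
move=> Np; elim: Np x => [|| q r _ IHq _ IHr| a q _ IHq |X q _ IHq] x.
- by rewrite lowerS_exp // subrr mulr0 scale0r.
- by rewrite raddf0.
- by rewrite lowerSD IHq IHr addr0.
- by rewrite lowerSZ IHq scaler0.
- have -> : mod_act X q = glS X q by rewrite glSE.
  have /eqP := glS_lowerS k X x q; rewrite !IHq raddf0 sub0r oppr_eq0.
  by move/eqP.
Qed.

Lemma gl_ideal_lowerS x p : I p -> I (lowerS (mx x) p).
Proof.
(* [lowerS] is of second order, so commuting it with a cofactor also produces [glS] terms. With the
   cofactor generalised, its factors are treated one at a time by [lowerSM]. *)
move=> Ip; suff h : forall r x, I (lowerS (mx x) (r * p)).
  by have := h 1 x; rewrite mul1r.
elim: Ip {x} => [q Nq r||q q' _ IHq _ IHq' r x|q r _ IHr s x].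
- elim/Sym_ind: r => [|s s' hs hs' |a s hs|y s hs] x.
  + by rewrite mul1r lowerS_gl_span //; apply: ideal_span0.
  + by rewrite mulrDl lowerSD; apply: ideal_spanD.
  + by rewrite -scalerAl lowerSZ; apply: gl_idealZ.
  + have Is : I (s * q) by apply/ideal_spanM/ideal_span_gen.
    rewrite -mulrA lowerSM; apply: ideal_spanD; last exact: gl_idealZ.
    apply: ideal_spanD; first exact: ideal_spanM.
    by apply/gl_idealZ/gl_ideal_glS.
- by move=> r x; rewrite mulr0 raddf0; apply: ideal_span0.
- by rewrite mulrDr lowerSD; apply: ideal_spanD.
- by rewrite mulrA; apply: IHr.
Qed.

Lemma gl_ideal_tailS x p : I p -> I (tailS k x p).
Proof.
move=> Ip; apply: ideal_spanD; last exact: gl_ideal_lowerS.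
by apply/gl_idealZ/gl_ideal_glS.
Qed.

Lemma gl_ideal_leftS x p : I p -> I (leftS x p).
Proof.
move=> Ip; rewrite leftS_tail; apply: ideal_spanD; first exact: ideal_spanM.
exact: gl_ideal_tailS.
Qed.

Lemma gl_ideal_rightS x p : I p -> I (rightS x p).
Proof.
by move=> Ip; apply: gl_idealB; [apply: gl_ideal_glS | apply: gl_ideal_leftS].
Qed.

End GlIdeal.

End Ideals.

(** * Bounded modules *)

Section Krawtchouk.
Variables (K : numFieldType) (k : nat).

Definition spin_vals : seq K := [seq k%:R / 2%:R - j%:R | j <- iota 0 k.+1].

Lemma spin_vals_uniq : uniq spin_vals.
Proof.
rewrite map_inj_uniq ?iota_uniq // => i j /addrI /oppr_inj /eqP.
by rewrite eqr_nat => /eqP.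
Qed.

Lemma size_spin_vals : size spin_vals = k.+1.
Proof. by rewrite size_map size_iota. Qed.

Lemma spin_valsP c : reflect (exists2 j, (j <= k)%N & c = k%:R / 2%:R - j%:R)
  (c \in spin_vals).
Proof.
apply: (iffP mapP) => [[j]|[j jk ->]]; last by exists j; rewrite // mem_iota.
by rewrite mem_iota ltnS => jk ->; exists j.
Qed.

(* The recursion solves that of [leftS_exp] for the powers of h, so that
   h ^ n = kraw n (left multiplication by h) applied to 1. *)
Fixpoint kraw_pair n : {poly K} * {poly K} :=
  if n is n'.+1 then
    let p := kraw_pair n' in
    (p.2, 'X * p.2 - (4%:R^-1 * n'.+1%:R * (k%:R - n'%:R)) *: p.1)
  else (1, 'X).
Definition kraw n := (kraw_pair n).1.

Lemma kraw0 : kraw 0 = 1. Proof. by []. Qed.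
Lemma kraw1 : kraw 1 = 'X. Proof. by []. Qed.
Lemma krawS n : kraw n.+2 =
  'X * kraw n.+1 - (4%:R^-1 * n.+1%:R * (k%:R - n%:R)) *: kraw n.
Proof. by []. Qed.

Lemma size_kraw n : size (kraw n) = n.+1 /\ size (kraw n.+1) = n.+2.
Proof.
elim: n => [|n [IH1 IH2]]; first by rewrite kraw0 kraw1 size_poly1 size_polyX.
split=> //; rewrite krawS mulrC.
have sX : size (kraw n.+1 * 'X) = n.+3.
  by rewrite size_mulX -?size_poly_gt0 ?IH2.
rewrite size_polyDl sX // size_polyN.
by apply: leq_ltn_trans (size_scale_leq _ _) _; rewrite IH1.
Qed.

Lemma lead_coef_kraw n : lead_coef (kraw n) = 1 /\ lead_coef (kraw n.+1) = 1.
Proof.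
elim: n => [|n [IH1 IH2]]; first by rewrite kraw0 kraw1 lead_coef1 lead_coefX.
split=> //; rewrite krawS mulrC lead_coefDl ?lead_coefMX //.
rewrite size_polyN size_mulX -?size_poly_gt0 ?(size_kraw n).2 //.
by apply: leq_ltn_trans (size_scale_leq _ _) _; rewrite (size_kraw n).1.
Qed.

(* The generating function of the kraw n / n! at k / 2 - j. *)
Section Generating.
Variable j : nat.
Hypothesis jk : (j <= k)%N.
Let h : K := 2%:R^-1.
Let U : {poly K} := 1 + h *: 'X.
Let W : {poly K} := 1 - h *: 'X.
Let G := U ^+ (k - j) * W ^+ j.
Let c : K := k%:R / 2%:R - j%:R.

Lemma deriv_exp_mul (p : {poly K}) n : p * (p ^+ n)^`() = n%:R *: (p^`() * p ^+ n).
Proof.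
rewrite deriv_exp -scaler_nat -scalerAr; case: n => [|n]; first by rewrite !scale0r.
by rewrite /= mulrCA -exprS.
Qed.

(** In coefficients, and after multiplication by factorials, this is the three-term recursion that
    defines [kraw]. *)
Lemma gen_ode : (1 - 4%:R^-1 *: 'X^2) * G^`() = c *: G - (k%:R / 4%:R) *: ('X * G).
Proof.
have dU : U^`() = h%:P.
  by rewrite derivD derivC derivZ derivX add0r alg_polyC.
have dW : W^`() = - h%:P.
  by rewrite derivB derivC derivZ derivX sub0r alg_polyC.
have UW : 1 - 4%:R^-1 *: 'X^2 = U * W.
  rewrite (_ : 4%:R^-1 = h * h); last by rewrite /h; field.
  by rewrite /U /W -!mul_polyC polyCM; ring.
have -> : c = (k - j)%:R * h - j%:R * h by rewrite /c /h natrB //; field.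
have -> : k%:R / 4%:R = (k - j)%:R * (h * h) + j%:R * (h * h) :> K.
  by rewrite natrB // /h; field.
rewrite UW derivM.
transitivity (W * (U * (U ^+ (k - j))^`()) * W ^+ j +
    U * U ^+ (k - j) * (W * (W ^+ j)^`())); first by ring.
rewrite !deriv_exp_mul dU dW -!mul_polyC !rmorphD /= !rmorphM /= ?rmorphN.
rewrite /G /W /U -!mul_polyC.
move: (_ ^+ (k - j)) (_ ^+ j) => P Q.
ring.
Qed.

(** [f] will be the factorial; it is kept abstract so that its values are plain unknowns for
    [field]. *)
Lemma gen_coef (f : nat -> K) n :
  f 0 = 1 -> (forall i, f i.+1 = i.+1%:R * f i) ->
  G`_n * f n = (kraw n).[c] /\ G`_n.+1 * f n.+1 = (kraw n.+1).[c].
Proof.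
move=> f0 fS.
have ode i : G`_i.+1 *+ i.+1 - 4%:R^-1 * (if i is i'.+1 then G`_i' *+ i' else 0)
   = c * G`_i - k%:R / 4%:R * (if i is i'.+1 then G`_i' else 0).
  have := congr1 (fun p : {poly K} => p`_i) gen_ode.
  rewrite mulrBl mul1r -scalerAl !coefB !coefZ !coef_deriv coefXM coefXnM coef_deriv.
  by case: i => [|[|i]] //=; rewrite ?mulr0n ?subn2 ?subn0.
elim: n => [|n [IH1 IH2]].
  have G0 : G`_0 = 1.
    rewrite -horner_coef0 /G hornerM !horner_exp /U /W !hornerE.
    by rewrite ?(mulr0, oppr0, addr0, subr0, expr1n, mulr1).
  have := ode 0; rewrite mulr1n !mulr0 !subr0 G0 mulr1 => ->.
  by rewrite kraw0 kraw1 hornerX hornerC fS f0 !mulr1.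
split; first exact: IH2.
rewrite krawS hornerD hornerN hornerZ hornerM hornerX -IH1 -IH2 (fS n.+1).
have /eqP := ode n.+1; rewrite subr_eq => /eqP e.
rewrite -[_ *+ n.+2]mulr_natr -[_ *+ n]mulr_natr in e.
rewrite [LHS]mulrA e !fS -natr1.
move: (G`_n.+1) (G`_n) (f n) (n%:R : K) (k%:R : K) => x y z s t.
by field.
Qed.

(** [G] has degree at most [k], so its coefficient of index [k.+1] vanishes. *)
Lemma root_kraw : root (kraw k.+1) c.
Proof.
have [|i|_ e] := @gen_coef (fun i => i`!%:R) k; first by rewrite fact0.
  by rewrite factS natrM.
rewrite /root -e nth_default ?mul0r // /G.
have sUW (s : K) n : (size ((1 + s *: 'X : {poly K}) ^+ n) <= n.+1)%N.
  apply: leq_trans (size_poly_exp_leq _ _) _; rewrite ltnS.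
  rewrite -[X in (_ <= X)%N]mul1n leq_mul2r; apply/orP; right.
  rewrite -subn1 leq_subLR (leq_trans (size_polyD _ _)) //.
  by rewrite geq_max size_poly1 (leq_trans (size_scale_leq _ _)) ?size_polyX.
apply: leq_trans (size_polyMleq _ _) _.
have := leq_add (sUW h (k - j)%N) (sUW (- h) j); rewrite /W -scaleNr.
rewrite addSn addnS subnK // => le.
by rewrite -subn1 leq_subLR.
Qed.

End Generating.

Lemma krawE : kraw k.+1 = \prod_(c <- spin_vals) ('X - c%:P).
Proof.
rewrite (all_roots_prod_XsubC (p := kraw k.+1) (rs := spin_vals)).
- by rewrite (lead_coef_kraw k).2 scale1r.
- by rewrite (size_kraw k).2 size_spin_vals.
- by apply/allP => c /spin_valsP[j jk ->]; apply: root_kraw.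
- by rewrite uniq_rootsE spin_vals_uniq.
Qed.

End Krawtchouk.

(** * Polynomials in one operator *)

Section PolyEval.
Variables (K : fieldType) (M : lmodType K) (f : {linear M -> M}).
Implicit Types (v : M) (p q : {poly K}).

Definition peval v p : M := \sum_(i < size p) p`_i *: iter i f v.

Lemma peval_widen v p n : (size p <= n)%N ->
  peval v p = \sum_(i < n) p`_i *: iter i f v.
Proof.
move=> le; rewrite /peval (big_ord_widen n (fun i => p`_i *: iter i f v) le).
rewrite big_mkcond; apply: eq_bigr => i _; case: ltnP => // le'.
by rewrite nth_default ?scale0r.
Qed.

Lemma peval_linear v : linear (peval v).
Proof.
move=> a p q; set n := maxn (size p) (size q).
have le : (size (a *: p + q)%R <= n)%N.
  apply: leq_trans (size_polyD _ _) _; rewrite geq_max leq_maxr andbT.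
  exact: leq_trans (size_scale_leq _ _) (leq_maxl _ _).
rewrite !(@peval_widen _ _ n) ?leq_maxl ?leq_maxr // scaler_sumr -big_split.
by apply: eq_bigr => i _ /=; rewrite coefD coefZ scalerDl scalerA.
Qed.
HB.instance Definition _ v :=
  @GRing.isLinear.Build K {poly K} M *:%R (peval v) (peval_linear v).

Lemma pevalZ v a p : peval v (a *: p) = a *: peval v p.
Proof. exact: linearZ. Qed.
Lemma pevalB v p q : peval v (p - q) = peval v p - peval v q.
Proof. exact: raddfB. Qed.

Lemma peval1 v : peval v 1 = v.
Proof. by rewrite /peval size_poly1 big_ord1 coef1 scale1r. Qed.

Lemma pevalXM v p : peval v ('X * p) = f (peval v p).
Proof.
rewrite (@peval_widen _ _ (size p).+1); last first.
  by rewrite mulrC; apply: leq_trans (size_polyMleq _ _) _; rewrite size_polyX addn2.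
rewrite big_ord_recl coefXM scale0r add0r raddf_sum /=; apply: eq_bigr => i _.
by rewrite coefXM /= linearZ.
Qed.

Definition shift_ops (cs : seq K) v : M := foldr (fun c u => f u - c *: u) v cs.

Lemma shift_opsE cs v : shift_ops cs v = peval v (\prod_(c <- cs) ('X - c%:P)).
Proof.
elim: cs => [|c cs IH]; first by rewrite big_nil peval1.
by rewrite big_cons mulrBl pevalB pevalXM mul_polyC pevalZ -IH.
Qed.

Lemma shift_ops_linear cs : linear (shift_ops cs).
Proof.
elim: cs => [//|c cs IH] a u v /=; rewrite IH linearP /= [c *: (_ + _)]scalerDr opprD.
by rewrite scalerBr [c *: (a *: _)]scalerA mulrC -scalerA addrACA.
Qed.
HB.instance Definition _ cs :=
  @GRing.isLinear.Build K M M *:%R (shift_ops cs) (shift_ops_linear cs).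

End PolyEval.

Lemma shift_ops_morph (K : fieldType) (M N : lmodType K) (f : {linear M -> M})
    (f' : {linear N -> N}) (h : {linear M -> N}) cs v :
  (forall u, h (f u) = f' (h u)) -> h (shift_ops f cs v) = shift_ops f' cs (h v).
Proof.
move=> hf; elim: cs => [//|c cs IH] /=.
by rewrite raddfB /= [h (_ *: _)]linearZ /= hf IH.
Qed.

Section Bounded.
Variables (K : numFieldType) (m : nat) (k : nat).
Local Notation g := (so K m).
Local Notation M2 := 'M[K]_(m + m).
Local Notation mx x := (@vsval K _ (so_space K m) x).
Local Notation soE := (@soE K m).
Local Notation leftS := (@leftS K m k).
Local Notation lowerS := (@lowerS K m k).
Implicit Types (x y z u w : g) (X Y : M2) (p q : Sym g) (a b c d : 'I_(m + m)).

(** The adjoint action of h kills the powers of h, and 1/4 is 1/8 times the trace 2 of the square of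
    h. *)
Lemma leftS_exp a n : let h := Sym_inj (soE a a) in
  leftS (soE a a) (h ^+ n.+1) =
  h ^+ n.+2 + (4%:R^-1 * n.+1%:R * (k%:R - n%:R)) *: h ^+ n.
Proof.
move=> h; rewrite leftSE -exprS glS_exp gl_so_act_bracket bracketxx raddf0.
rewrite mul0r !scaler0 addr0 lowerS_exp; last exact: soE_rank2.
rewrite mxtrace_soE val_soE !mxE !eqxx [a == bar a]eq_sym (negPf (bar_neq a)).
rewrite subr0 mulr1; congr (_ + _ * _ * _ *: _).
by field.
Qed.

Lemma leftS_kraw a n : peval (leftS (soE a a)) 1 (kraw K k n) =
  Sym_inj (soE a a) ^+ n.
Proof.
suff [] : peval (leftS (soE a a)) 1 (kraw K k n) = Sym_inj (soE a a) ^+ n /\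
   peval (leftS (soE a a)) 1 (kraw K k n.+1) = Sym_inj (soE a a) ^+ n.+1 by [].
elim: n => [|n [IH1 IH2]].
  rewrite kraw0 kraw1 peval1 -['X]mulr1 pevalXM peval1 /= leftSE.
  by rewrite mulr1 glS1 lowerS1 scaler0 !addr0 expr0 expr1.
by split=> //; rewrite krawS pevalB pevalXM IH2 pevalZ IH1 /= leftS_exp addrK.
Qed.

Lemma shift_leftS1 a :
  shift_ops (leftS (soE a a)) (spin_vals K k) 1 = Sym_inj (soE a a) ^+ k.+1.
Proof. by rewrite shift_opsE -krawE leftS_kraw. Qed.

(* In a module satisfying this condition all weights have their coordinates
   among k/2, k/2 - 1, .., - k/2. *)
Definition bounded (M : lieModule g) : Prop := forall a (v : M),
  shift_ops (mod_act (soE a a)) (spin_vals K k) v = 0.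

Lemma env_act_exp (M : lieModule g) (v : M) a :
  env_act k v (Sym_inj (soE a a) ^+ k.+1) =
  shift_ops (mod_act (soE a a)) (spin_vals K k) v.
Proof.
rewrite -shift_leftS1 (shift_ops_morph (f' := mod_act (soE a a))).
  by rewrite /= env_act1.
by move=> p; rewrite /= env_act_left.
Qed.

Section SoSpan.
Variable a : 'I_(m + m).
Local Notation h := (soE a a).
Local Notation N := (@so_span K m k h).

(* gl is the sum of so and of the stabiliser of the line spanned by h. *)
Lemma gl_so_act_decomp Y : exists x (r : K), gl_so_act Y h = bracket x h + r *: h.
Proof.
pose T w := exists x (r : K), w = bracket x h + r *: h.
have TZD (s : K) w w' : T w -> T w' -> T (s *: w + w').
  move=> [x [r ->]] [x' [r' ->]]; exists (s *: x + x'), (s * r + r').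
  by rewrite bracket_linear_l scalerDr scalerDl scalerA addrACA.
have Tx x : T (bracket x h) by exists x, 0; rewrite scale0r addr0.
have Th : T h by exists h, 1; rewrite bracketxx scale1r add0r.
have T0 : T 0 by rewrite -(bracketxx h); apply: Tx.
have TZ (s : K) w : T w -> T (s *: w) by move=> Tw; rewrite -[s *: w]addr0; apply: TZD.
have Ta d : T (soE a d).
  have [->|da] := eqVneq d a; first exact: Th.
  have [->|dba] := eqVneq d (bar a); first by rewrite soE_bar0.
  have -> : soE a d = (-1) *: bracket (soE a d) h.
    rewrite bracket_soE (negPf da) eqxx [a == bar a]eq_sym (negPf (bar_neq a)).
    rewrite soE_bar0 scaler0 !scale0r sub0r subr0 addr0 scale1r scaleN1r.
    by rewrite opprK.
  exact/TZ/Tx.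
have Tba d : T (soE (bar a) d).
  have [->|da] := eqVneq d a; first by rewrite -{2}[a]barK soE_bar0.
  have [->|dba] := eqVneq d (bar a).
    by rewrite soE_bar -scaleN1r; apply: TZ.
  have -> : soE (bar a) d = bracket (soE (bar a) d) h.
    rewrite bracket_soE (negPf da) [a == bar a]eq_sym (negPf (bar_neq a)) eqxx.
    rewrite [a == bar d]eq_bar eq_sym (negPf dba).
    rewrite !scale0r scale1r subrr add0r addr0 -[X in _ = - soE (bar d) X]barK.
    by rewrite soE_bar opprK.
  exact: Tx.
suff : T (gl_so_act Y h) by [].
rewrite [Y]matrix_sum_delta; elim/big_rec: _ => [|i Z _ TZ'].
  have -> : gl_so_act (0 : M2) h = 0.
    have := gl_so_act_lin_l (-1) 0 0 h.
    by rewrite scaler0 addr0 scaleN1r addNr.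
  exact: T0.
elim/big_rec: _ => [|j Z' _ TZ'']; first by rewrite add0r.
rewrite -addrA gl_so_act_lin_l; apply: (TZD) => //.
rewrite gl_so_act_soE -scaleN1r; apply/TZ/TZD; first exact: Ta.
apply: (TZ); rewrite -[a in soE _ a]barK soE_bar -scaleN1r.
exact/TZ/Tba.
Qed.

(** Commuting Y past an element of so_2m leaves another matrix of gl_2m, so only the generator
    matters; there [gl_so_act_decomp] replaces Y by an element of so_2m and a scalar. *)
Lemma so_span_glS Y p : N p -> N (glS Y p).
Proof.
have ND q q' : N q -> N q' -> N (q + q') by exact: U_spanD.
have NZ (r : K) q : N q -> N (r *: q) by exact: U_spanZ.
have Nact x q : N q -> N (glS (mx x) q).
  by move=> Nq; rewrite -glS_so; apply: U_span_act.
move=> Np; elim: Np Y => [Y|Y|w1 w2 _ IH1 _ IH2 Y|r w _ IH Y|x w Nw IH Y].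
- have [x [r E]] := gl_so_act_decomp Y.
  rewrite glS_exp E Sym_injD Sym_injZ mulrDl scalerDr -gl_so_act_bracket -glS_exp.
  apply: (ND); first by apply: Nact; apply: U_span_gen.
  by rewrite -scalerAl -exprS !scalerA; apply/NZ/U_span_gen.
- by rewrite (raddf0 (glS Y)); apply: U_span0.
- by rewrite glSD; apply: ND.
- by rewrite glSZ; apply: NZ.
- have -> : mod_act x w = glS (mx x) w by apply: glS_so.
  have -> : glS Y (glS (mx x) w) =
      glS (mx x) (glS Y w) + glS (Y *m mx x - mx x *m Y) w.
    by rewrite glS_bracket addrC subrK.
  by apply: ND => //; apply: Nact.
Qed.

End SoSpan.

Section RootIdeal.
Variables (e : g) (a0 b0 : 'I_(m + m)) (r0 : K).
Hypothesis eE : e = r0 *: soE a0 b0.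
Hypotheses (r0_neq0 : r0 != 0) (b0_bar : b0 != bar a0) (b0_neq : b0 != a0).
Local Notation N := (@gl_span K m k e).
Local Notation I := (ideal_span N).

Lemma root_rank2 x : mx e *m mx x *m mx e =
  (2%:R^-1 * \tr (mx x *m mx e)) *: mx e.
Proof.
rewrite eE val_soZ -!scalemxAl -!scalemxAr soE_rank2 mxtraceZ !scalerA.
by congr (_ *: _); ring.
Qed.

Lemma gl_span_soE d : N (Sym_inj (soE d d) ^+ k.+1).
Proof.
have NZ := @gl_spanZ _ _ k e; have Ngl := @gl_span_glS _ _ k e.
have N1 : N (Sym_inj (soE a0 b0) ^+ k.+1).
  have E1 : Sym_inj e ^+ k.+1 = r0 ^+ k.+1 *: Sym_inj (soE a0 b0) ^+ k.+1.
    by rewrite eE Sym_injZ exprZn.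
  have h : N (Sym_inj e ^+ k.+1) by apply: U_span_gen.
  have := NZ (r0 ^+ k.+1)^-1 _ h; rewrite E1.
  by rewrite scalerA mulVf ?scale1r // expf_neq0.
have N2 : N (Sym_inj (soE a0 a0) ^+ k.+1) by apply: gl_move_r b0_neq N1.
have [->//|da] := eqVneq d a0.
have [->|dba] := eqVneq d (bar a0); first exact: gl_move_bar.
(* The route is (a0, b0), (a0, bar d), by symmetry (d, bar a0), and finally (d, d): one index
   changes at a time, and the pairs (a, bar a), where [soE] vanishes, are avoided. *)
have {}N1 : N (Sym_inj (soE a0 (bar d)) ^+ k.+1).
  have [<-//|bd] := eqVneq b0 (bar d); exact: gl_move_r bd N1.
have := gl_move_bar NZ N1; rewrite barK => {}N1.
apply: gl_move_r N1 => //; last by rewrite eq_sym.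
by rewrite (inj_eq (@bar_inj m)) eq_sym.
Qed.

(** [env_act] is equivariant under so_2m only, so to show that it vanishes on the gl_2m-submodule
    one needs a generator over so_2m; a power of a Cartan element provides it. *)
Lemma gl_span_so_span p : N p -> @so_span K m k (soE a0 a0) p.
Proof.
have NZ (r : K) q : so_span k (soE a0 a0) q -> so_span k (soE a0 a0) (r *: q).
  exact: U_spanZ.
have Ngl := @so_span_glS a0.
elim=> [|| q r _ IHq _ IHr| a q _ IHq |X q _ IHq].
- rewrite eE Sym_injZ exprZn; apply: (NZ).
  apply: (gl_move_r NZ Ngl (b := a0)).
  + by rewrite eq_sym bar_neq.
  + by rewrite eq_sym.
  + exact: U_span_gen.
- exact: U_span0.
- exact: U_spanD.
- exact: NZ.
- by have := Ngl X _ IHq; rewrite glSE.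
Qed.

(** Bounds the degree of the cofactor, not of the product: the induction in [gl_ideal_env_act] runs
    over the cofactor, and [lowerS] must stay within the range of its hypothesis. *)
Inductive filt_gl_span (d : nat) : Sym g -> Prop :=
| filt_gl_spanM s q : filt d s -> N q -> filt_gl_span d (s * q)
| filt_gl_span0 : filt_gl_span d 0
| filt_gl_spanD p q :
    filt_gl_span d p -> filt_gl_span d q -> filt_gl_span d (p + q)
| filt_gl_spanZ r p : filt_gl_span d p -> filt_gl_span d (r *: p).

Lemma filt_gl_span_inj (d : nat) y p :
  filt_gl_span d p -> filt_gl_span d.+1 (Sym_inj y * p).
Proof.
elim=> [s q fs Nq||p1 p2 _ h1 _ h2|r p' _ h'].
- by rewrite mulrA; apply: filt_gl_spanM Nq; apply: filtM.
- by rewrite mulr0; apply: filt_gl_span0.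
- by rewrite mulrDr; apply: filt_gl_spanD.
- by rewrite -scalerAr; apply: filt_gl_spanZ.
Qed.

Lemma lowerS_filt_gl_span (d : nat) s q : hdeg d s -> N q ->
  forall x, filt_gl_span d (lowerS (mx x) (s * q)).
Proof.
move=> hs Nq; elim: hs => {d s} [|d|d p p' _ h _ h'|d r p _ h|d y s hs h] x.
- rewrite mul1r (lowerS_gl_span root_rank2) //; exact: filt_gl_span0.
- by rewrite mul0r raddf0; apply: filt_gl_span0.
- by rewrite mulrDl lowerSD; apply: filt_gl_spanD.
- by rewrite -scalerAl lowerSZ; apply: filt_gl_spanZ.
- have fs : filt d.+1 s := filt_hdeg (leqnSn d) hs.
  rewrite -mulrA lowerSM; apply: filt_gl_spanD.
    apply: filt_gl_spanD; first exact: filt_gl_span_inj (h x).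
    apply: filt_gl_spanZ; rewrite glSM.
    apply: filt_gl_spanD; apply: filt_gl_spanM => //; last exact: gl_span_glS.
    by apply: filt_hdeg (leqnSn d) (hdeg_glS _ hs).
  by apply: filt_gl_spanZ; apply: filt_gl_spanM.
Qed.

Lemma gl_ideal_env_act (M : lieModule g) : bounded M ->
  forall p, I p -> forall v : M, env_act k v p = 0.
Proof.
move=> bM.
have NE p : N p -> forall v : M, env_act k v p = 0.
  move/gl_span_so_span; elim=> [v|v|w1 w2 _ IH1 _ IH2 v|r w _ IH v|x w Nw IH v].
  - by rewrite env_act_exp bM.
  - exact: env_act0.
  - by rewrite env_actD IH1 IH2 addr0.
  - by rewrite env_actZ IH scaler0.
  - have -> : mod_act x w = glS (mx x) w by apply: glS_so.
    by rewrite env_act_gl !IH mod_act0 subr0.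
move=> p Ip; suff h : forall q (v : M), env_act k v (q * p) = 0.
  by move=> v; have := h 1 v; rewrite mul1r.
elim: Ip => [q Nq s v|s v|q q' _ IHq _ IHq' s v|q r _ IHr s v]; last first.
- by rewrite mulrA IHr.
- by rewrite mulrDr env_actD IHq IHq' addr0.
- by rewrite mulr0 env_act0.
elim/Sym_filt_ind: s q Nq v => [q|s s' IH IH' q Nq v|r s IH q Nq v|].
- by rewrite mul1r; apply: NE.
- by rewrite mulrDl env_actD IH // IH' // addr0.
- by rewrite -scalerAl env_actZ IH // scaler0.
move=> d IH x s hs q Nq v.
(* The definition of [leftS], solved for the ordinary product; each term on the right leads back to
   cofactors of degree at most [d]. *)
have -> : Sym_inj x * s * q = leftS x (s * q) - 2%:R^-1 *: glS (mx x) (s * q)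
    - lowerS (mx x) (s * q).
  by rewrite leftSE mulrA addrAC addrK addrK.
have Isq (w : M) : env_act k w (s * q) = 0 by apply: IH => //; apply: filt_hdeg hs.
rewrite !env_actB env_act_left Isq mod_act0 env_actZ env_act_gl !Isq mod_act0.
rewrite subrr scaler0 !sub0r oppr0 add0r.
elim: (lowerS_filt_gl_span hs Nq x) => [s' q' fs' Nq'||p1 p2 _ h1 _ h2|r p' _ h'].
- by rewrite IH // oppr0.
- by rewrite env_act0 oppr0.
- by rewrite env_actD opprD h1 h2 addr0.
- by rewrite env_actZ -scalerN h' scaler0.
Qed.

End RootIdeal.

End Bounded.

(** * Weights and the Casimir operator *)

Section Weights.
Variables (K : numFieldType) (m : nat).
Local Notation I := 'I_(m + m).
Implicit Types (a b c d : I) (i j : 'I_m) (w : I -> K).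

(** The half sum of the positive roots, extended to all indices. It also orders the indices: its
    only tie is between the last coordinate and its negative. *)
Definition rho a : int :=
  match split a with inl i => (m.-1 - i)%N%:Z | inr i => - (m.-1 - i)%N%:Z end.

Lemma rho_lshift i : rho (lshift m i) = (m.-1 - i)%N%:Z.
Proof. by rewrite /rho -/(unsplit (inl _ i)) unsplitK. Qed.
Lemma rho_rshift i : rho (rshift m i) = - (m.-1 - i)%N%:Z.
Proof. by rewrite /rho -/(unsplit (inr _ i)) unsplitK. Qed.

Lemma rho_bar a : rho (bar a) = - rho a.
Proof.
by case: (lrshiftP a) => i;
  rewrite ?(bar_lshift, bar_rshift) ?(rho_lshift, rho_rshift) ?opprK.
Qed.

Lemma rho_eq a b : rho a = rho b -> a = b \/ b = bar a.
Proof.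
case: (lrshiftP a) => i; case: (lrshiftP b) => j;
  rewrite ?(bar_lshift, bar_rshift) ?(rho_lshift, rho_rshift) => e;
  have hi := ltn_ord i; have hj := ltn_ord j.
- by left; congr lshift; apply: val_inj => /=; lia.
- by right; congr rshift; apply: val_inj => /=; lia.
- by right; congr lshift; apply: val_inj => /=; lia.
- by left; congr rshift; apply: val_inj => /=; lia.
Qed.

(* The positive roots are the weights of the soE a b with [posr a b]. *)
Definition posr a b : bool := (rho b < rho a) && (b != bar a).

Lemma posr_neq a b : posr a b -> b != a.
Proof. by case/andP=> + _; apply: contraTneq => ->; rewrite ltxx. Qed.

Lemma posr_bar a b : posr a b -> b != bar a.
Proof. by case/andP. Qed.

Lemma posr_total a b : a != b -> b != bar a -> posr a b || posr b a.
Proof.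
move=> ab bb; have e1 : (a != bar b) = (b != bar a) by rewrite eq_bar eq_sym.
rewrite /posr e1 bb !andbT -neq_lt; apply: contra_neq ab => e.
by case: (rho_eq (esym e)) => // e'; rewrite e' eqxx in bb.
Qed.

Definition wt a b c : K :=
  (c == a)%:R - (c == b)%:R - (c == bar a)%:R + (c == bar b)%:R.

Definition anti w := forall a, w (bar a) = - w a.

Lemma sum_wt a b (f : I -> K) :
  \sum_c wt a b c * f c = f a - f b - f (bar a) + f (bar b).
Proof.
have h d : \sum_c (c == d)%:R * f c = f d.
  rewrite (bigD1 d) //= eqxx mul1r big1 ?addr0 // => c /negPf ->.
  by rewrite mul0r.
rewrite -!h -!sumrB -big_split; apply: eq_bigr => c _ /=.
by rewrite /wt !mulrDl !mulNr.
Qed.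

Inductive qplus : (I -> K) -> Prop :=
| qplus0 : qplus (fun _ => 0)
| qplusS w a b : qplus w -> posr a b -> qplus (fun c => w c + wt a b c).

Definition dominant w := forall a b, posr a b -> exists n : nat, w a - w b = n%:R.

(* The eigenvalue of the Casimir operator on a vector of weight w killed by
   the positive root vectors. *)
Definition cas_term w a b : K :=
  if a == b then w a ^+ 2 else if posr a b then w a - w b else 0.
Definition cas w : K := \sum_a \sum_b cas_term w a b.

Definition rsum w : K := \sum_a \sum_(b | posr a b) (w a - w b).

Lemma casE w : cas w = \sum_a w a ^+ 2 + rsum w.
Proof.
rewrite /cas /rsum -big_split; apply: eq_bigr => a _ /=.
rewrite (bigD1 a) //= {1}/cas_term eqxx; congr (_ + _).
rewrite [LHS]big_mkcond [RHS]big_mkcond; apply: eq_bigr => b _ /=.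
rewrite /cas_term; have [<-|ab] := eqVneq a b; last by [].
by case: ifP => // /posr_neq; rewrite eqxx.
Qed.

Lemma sum_ltn_ord i : (\sum_(j < m) (j < i) = i)%N.
Proof.
rewrite -[RHS]subn0 -[RHS]muln1 -sum_nat_const_nat.
rewrite (big_nat_widen 0 i m) ?(ltnW (ltn_ord i)) // big_mkord [RHS]big_mkcond /=.
by apply: eq_bigr => j _; case: ltnP.
Qed.

Lemma sum_gtn_ord i : (\sum_(j < m) (i < j) = m.-1 - i)%N.
Proof.
have : (\sum_(j < m) ((j < i) + (j == i) + (i < j)) = m)%N.
  rewrite -[RHS]card_ord -sum1_card; apply: eq_bigr => j _.
  by rewrite -val_eqE; case: ltngtP.
rewrite !big_split /= sum_ltn_ord (bigD1 i) //= eqxx big1 => [|j /negPf ->//].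
by have := ltn_ord i; lia.
Qed.

Lemma posr_ll i j : posr (lshift m i) (lshift m j) = (i < j)%N.
Proof.
rewrite /posr bar_lshift eq_lrshift andbT !rho_lshift ltz_nat.
by have := ltn_ord i; have := ltn_ord j; lia.
Qed.

Lemma posr_lr i j : posr (lshift m i) (rshift m j) = (i != j).
Proof.
rewrite /posr bar_lshift eq_rshift rho_lshift rho_rshift eq_sym.
have [//|] := eqVneq i j; first by rewrite andbF.
rewrite -val_eqE andbT; have := ltn_ord i; have := ltn_ord j => /= hi hj ij.
lia.
Qed.

Lemma posr_rl i j : posr (rshift m i) (lshift m j) = false.
Proof.
rewrite /posr rho_lshift rho_rshift; apply/negP => /andP[+ _].
by rewrite ltNge => /negP; apply; lia.
Qed.

Lemma posr_rr i j : posr (rshift m i) (rshift m j) = (j < i)%N.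
Proof.
rewrite /posr bar_rshift eq_rlshift andbT !rho_rshift ltrN2 ltz_nat.
by have := ltn_ord i; have := ltn_ord j; lia.
Qed.

(** Counting the indices above and below a turns [rsum], a sum over positive roots, into the pairing
    with [2 rho]. *)
Lemma sum_posr (a : I) :
  (\sum_b posr a b)%N%:Z - (\sum_b posr b a)%N%:Z = 2 * rho a.
Proof.
have neq i : (\sum_(j < m) (i != j) = m.-1)%N.
  have : (\sum_(j < m) ((j == i) + (i != j)) = m)%N.
    rewrite -[RHS]card_ord -sum1_card; apply: eq_bigr => j _.
    by rewrite eq_sym; case: eqP.
  rewrite big_split /= (bigD1 i) //= eqxx big1 => [|j /negPf ->//].
  by have := ltn_ord i; lia.
have neq' i : (\sum_(j < m) (j != i) = m.-1)%N.
  by rewrite -(neq i); apply: eq_bigr => j _; rewrite eq_sym.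
rewrite !big_split_ord /=; case: (lrshiftP a) => i.
  under eq_bigr do rewrite posr_ll; under [X in (_ + X)%N]eq_bigr do rewrite posr_lr.
  under [in X in _ - X]eq_bigr do rewrite posr_ll.
  under [X in _ - (_ + X)%N%:Z]eq_bigr do rewrite posr_rl.
  rewrite sum_gtn_ord sum_ltn_ord neq rho_lshift big1 //.
  by have := ltn_ord i; lia.
under eq_bigr do rewrite posr_rl; under [X in (_ + X)%N]eq_bigr do rewrite posr_rr.
under [in X in _ - X]eq_bigr do rewrite posr_lr.
under [X in _ - (_ + X)%N%:Z]eq_bigr do rewrite posr_rr.
rewrite sum_gtn_ord sum_ltn_ord neq' rho_rshift big1 //.
by have := ltn_ord i; lia.
Qed.

Lemma rsumE w : rsum w = \sum_a (2 * rho a)%:~R * w a.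
Proof.
have -> : rsum w = \sum_a (\sum_b (posr a b)%:R) * w a -
   \sum_b (\sum_a (posr a b)%:R) * w b.
  rewrite (eq_bigr (fun a => \sum_b (posr a b)%:R * w a)) => [|a _]; last first.
    exact: mulr_suml.
  rewrite [in X in _ = _ - X](eq_bigr (fun b => \sum_a (posr a b)%:R * w b));
    last by move=> b _; exact: mulr_suml.
  rewrite [in X in _ = _ - X]exchange_big -sumrB; apply: eq_bigr => a _ /=.
  rewrite -sumrB big_mkcond; apply: eq_bigr => b _ /=.
  by case: posr; rewrite ?mul1r ?mul0r ?subrr.
rewrite -sumrB; apply: eq_bigr => a _.
by rewrite -mulrBl -sum_posr rmorphB /= -!natr_sum.
Qed.

Lemma qplus_pairing w nu : qplus w -> dominant nu -> anti nu ->
  0 <= \sum_a w a * nu a.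
Proof.
move=> qw dnu anu; elim: qw => [|{}w a b _ IH ab].
  by rewrite big1 // => a _; rewrite mul0r.
under eq_bigr do rewrite mulrDl; rewrite big_split /= addr_ge0 //.
rewrite sum_wt !anu; have [n e] := dnu a b ab.
have -> : nu a - nu b - - nu a + - nu b = (nu a - nu b) *+ 2 by ring.
by rewrite e mulrn_wge0 // ler0n.
Qed.

Lemma rsumD w w' : rsum (fun c => w c + w' c) = rsum w + rsum w'.
Proof.
by rewrite !rsumE -big_split; apply: eq_bigr => a _; rewrite mulrDr.
Qed.

Lemma rsum_wt_gt0 a b : posr a b -> 0 < rsum (wt a b).
Proof.
move=> ab; rewrite rsumE; under eq_bigr do rewrite mulrC.
rewrite sum_wt !rho_bar !mulrN !rmorphN /= opprK.
have -> : (2 * rho a)%:~R - (2 * rho b)%:~R + (2 * rho a)%:~R -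
   (2 * rho b)%:~R = (4 * (rho a - rho b))%:~R :> K.
  by rewrite -rmorphB -rmorphD -rmorphB /=; congr (_%:~R); ring.
by rewrite ltr0z; case/andP: ab => ab _; lia.
Qed.

Lemma qplus_rsum_ge0 w : qplus w -> 0 <= rsum w.
Proof.
elim=> [|{}w a b qw IH ab]; last by rewrite rsumD addr_ge0 // ltW ?rsum_wt_gt0.
by rewrite rsumE big1 // => a _; rewrite mulr0.
Qed.

Lemma qplusS_rsum_gt0 w a b : qplus w -> posr a b ->
  0 < rsum (fun c => w c + wt a b c).
Proof.
by move=> qw ab; rewrite rsumD ltr_wpDl ?qplus_rsum_ge0 ?rsum_wt_gt0.
Qed.

Lemma qplus_rsum_eq0 w : qplus w -> rsum w = 0 -> w = fun _ => 0.
Proof.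
case=> [//|{}w a b qw ab e].
by have := qplusS_rsum_gt0 qw ab; rewrite e ltxx.
Qed.

(** [cas w - cas w'] is the pairing of [w - w'] with [w + w'], plus [rsum] of [w - w']. Both terms
    are nonnegative, and the second vanishes only if the weights agree. *)
Lemma cas_strict w w' : anti w -> anti w' -> dominant w -> dominant w' ->
  qplus (fun c => w c - w' c) -> cas w = cas w' -> w = w'.
Proof.
move=> aw aw' dw dw' qp; rewrite !casE => e.
have dom2 : dominant (fun c => w c + w' c).
  move=> a b ab; have [n1 e1] := dw a b ab; have [n2 e2] := dw' a b ab.
  by exists (n1 + n2)%N; rewrite natrD -e1 -e2; ring.
have anti2 : anti (fun c => w c + w' c) by move=> a; rewrite aw aw' opprD.
have h1 := qplus_pairing qp dom2 anti2.
have h2 := qplus_rsum_ge0 qp; have h3 := qplus_rsum_eq0 qp.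
have e2 : rsum (fun c => w c - w' c) = rsum w - rsum w'.
  by rewrite !rsumE -sumrB; apply: eq_bigr => a _; rewrite mulrBr.
have e1 : \sum_a (w a - w' a) * (w a + w' a) = \sum_a w a ^+ 2 - \sum_a w' a ^+ 2.
  by rewrite -sumrB; apply: eq_bigr => a _; rewrite -subr_sqr.
have e0 : \sum_a (w a - w' a) * (w a + w' a) + rsum (fun c => w c - w' c) = 0.
  by rewrite e1 e2 addrACA -opprD e subrr.
have /eqP := e0; rewrite paddr_eq0 // => /andP[_ /eqP /h3 e4].
by apply: boolp.funext => a; have := congr1 (fun f => f a) e4 => /eqP;
  rewrite subr_eq0 => /eqP.
Qed.

End Weights.

(** * Spans and eigenvectors *)

Section LinearSpan.
Variables (K : fieldType) (M : lmodType K).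
Implicit Types (u v : M) (P N : M -> Prop).

Inductive lspan P : M -> Prop :=
| lspan_in u : P u -> lspan P u
| lspan0 : lspan P 0
| lspanD u v : lspan P u -> lspan P v -> lspan P (u + v)
| lspanZ r u : lspan P u -> lspan P (r *: u).

Lemma lspan_sub P N : (forall u, P u -> lspan N u) ->
  forall u, lspan P u -> lspan N u.
Proof.
move=> sub u; elim=> [v /sub //||v v' _ h _ h'|r v _ h].
- exact: lspan0.
- exact: lspanD.
- exact: lspanZ.
Qed.

Record subspace N : Prop := Subspace {
  subspace0 : N 0;
  subspaceD : forall u v, N u -> N v -> N (u + v);
  subspaceZ : forall r u, N u -> N (r *: u) }.

Lemma subspaceB N u v : subspace N -> N u -> N v -> N (u - v).
Proof.
by move=> sN Nu Nv; rewrite -scaleN1r; apply: subspaceD => //; apply: subspaceZ.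
Qed.

Lemma subspace_sum N (I : Type) (r : seq I) (Q : pred I) (F : I -> M) :
  subspace N -> (forall i, Q i -> N (F i)) -> N (\sum_(i <- r | Q i) F i).
Proof.
by move=> sN h; elim/big_ind: _ => //; [exact: subspace0 | exact: subspaceD].
Qed.

Lemma lspan_subspace P : subspace (lspan P).
Proof. by split; [exact: lspan0 | exact: lspanD | exact: lspanZ]. Qed.

Lemma lspan_min P N : subspace N -> (forall u, P u -> N u) ->
  forall u, lspan P u -> N u.
Proof.
move=> sN sub u; elim=> [v /sub //||v v' _ h _ h'|r v _ h].
- exact: subspace0.
- exact: subspaceD.
- exact: subspaceZ.
Qed.

Variable f : {linear M -> M}.

Lemma shift_ops_stable N cs v : subspace N -> (forall u, N u -> N (f u)) ->
  N v -> N (shift_ops f cs v).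
Proof.
move=> sN Nf Nv; elim: cs => [//|c cs IH] /=.
by apply: subspaceB => //; [apply: Nf | apply: subspaceZ].
Qed.

Lemma shift_ops_eigen cs r v : f v = r *: v ->
  shift_ops f cs v = (\prod_(c <- cs) (r - c)) *: v.
Proof.
move=> fv; elim: cs => [|c cs IH]; first by rewrite big_nil scale1r.
rewrite big_cons /= -/(shift_ops f cs v) IH linearZ /= fv !scalerA -scalerBl.
by congr (_ *: _); ring.
Qed.

Lemma shift_ops_cat cs cs' v :
  shift_ops f (cs ++ cs') v = shift_ops f cs (shift_ops f cs' v).
Proof. by rewrite /shift_ops foldr_cat. Qed.

Lemma shift_ops_catC cs cs' v :
  shift_ops f (cs ++ cs') v = shift_ops f (cs' ++ cs) v.
Proof. by rewrite !shift_opsE; congr peval; apply: perm_big; rewrite perm_catC. Qed.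

Lemma diagonalizable N cs v : subspace N -> (forall u, N u -> N (f u)) ->
  uniq cs -> N v -> shift_ops f cs v = 0 ->
  lspan (fun u => N u /\ exists c, f u = c *: u) v.
Proof.
move=> sN Nf; elim: cs v => [|c cs IH] v /=; first by move=> _ _ ->; apply: lspan0.
move=> /andP[c_cs ucs] Nv /eqP; rewrite -/(shift_ops f cs v) subr_eq0.
set w := shift_ops f cs v => /eqP fw.
(* [w] is an eigenvector for [c]. Divided by the product of the [c - c'] it is the component of v at
   [c], and the rest of v is killed by the other factors. *)
have Nw : N w by apply: shift_ops_stable.
have d0 : \prod_(c' <- cs) (c - c') != 0.
  rewrite prodf_seq_neq0; apply/allP => c' c'cs /=.
  by rewrite subr_eq0; apply: contraNneq c_cs => ->.
rewrite -(subrK ((\prod_(c' <- cs) (c - c'))^-1 *: w) v).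
apply: lspanD; last by apply/lspanZ/lspan_in; split=> //; exists c.
apply: IH => //; first by apply: subspaceB => //; apply: subspaceZ.
rewrite raddfB /= -/w linearZ /= (shift_ops_eigen _ fw) scalerA mulVf //.
by rewrite scale1r subrr.
Qed.

End LinearSpan.

Section HighestWeight.
Variables (K : numFieldType) (m : nat) (k : nat).
Local Notation g := (so K m).
Local Notation I := 'I_(m + m).
Local Notation mx x := (@vsval K _ (so_space K m) x).
Local Notation soE := (@soE K m).
Local Notation wt := (@wt K m).
Variable M : lieModule g.
Implicit Types (x y : g) (a b c d : I) (u v : M) (w : I -> K) (N P : M -> Prop).

Lemma wt_fst a b : b != a -> b != bar a -> wt a b a = 1.
Proof.
move=> ba bba; rewrite /wt eqxx [a == b]eq_sym (negPf ba) [a == bar a]eq_sym.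
by rewrite (negPf (bar_neq a)) eq_bar eq_sym (negPf bba) !subr0 addr0.
Qed.

Lemma wt_snd a b : b != a -> b != bar a -> wt a b b = -1.
Proof.
move=> ba bba; rewrite /wt eqxx (negPf ba) (negPf bba) [b == bar b]eq_sym.
by rewrite (negPf (bar_neq b)) subr0 addr0 sub0r.
Qed.

Definition wv w v := forall a, mod_act (soE a a) v = w a *: v.

Lemma wv_shift w v c d : wv w v ->
  wv (fun a => w a + wt c d a) (mod_act (soE c d) v).
Proof.
move=> wvv a; have := mod_act_bracket (soE a a) (soE c d) v.
rewrite soE_weight mod_actZl wvv mod_actZ => /eqP; rewrite eq_sym subr_eq.
by move/eqP => ->; rewrite addrC -scalerDl.
Qed.

Lemma wv0 w : wv w 0.
Proof. by move=> a; rewrite mod_act0 scaler0. Qed.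

Lemma wv_anti w v : wv w v -> v != 0 -> anti w.
Proof.
move=> wvv v0 a; have := wvv (bar a); rewrite soE_bar mod_actNl wvv -scaleNr.
move/eqP; rewrite -subr_eq0 -scalerBl scaler_eq0 (negPf v0) orbF subr_eq0.
by move/eqP.
Qed.

Definition stable N := forall x u, N u -> N (mod_act x u).

Lemma stable_soE N : subspace N -> (forall a b u, N u -> N (mod_act (soE a b) u)) ->
  stable N.
Proof.
move=> sN h x u Nu.
(* One half, because [soE a b] and [soE (bar b) (bar a)] both occur in the sum. *)
have -> : x = \sum_a \sum_b (2%:R^-1 * mx x a b) *: soE a b.
  have lin (F : I -> g) : mx (\sum_a F a) = \sum_a mx (F a) by apply: raddf_sum.
  apply: subvs_inj; rewrite /= lin; under eq_bigr do rewrite lin.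
  under eq_bigr do under eq_bigr do rewrite val_soZ val_soE.
  apply/matrixP => i j; rewrite summxE (eq_bigr (fun a =>
    2%:R^-1 * mx x a j *+ (a == i) - 2%:R^-1 * mx x a (bar i) *+ (bar j == a))).
    rewrite sumrB.
    have e c (F : I -> K) : \sum_a F a *+ (a == c) = F c.
      by rewrite (bigD1 c) //= eqxx big1 ?addr0 // => a /negPf ->.
    under [X in _ - X]eq_bigr do rewrite eq_sym.
    rewrite !e so_trEP.
    by field.
  move=> a _; rewrite summxE.
  under eq_bigr do rewrite !mxE mulrBr.
  rewrite sumrB; congr (_ - _).
    rewrite (bigD1 j) //= !eqxx andbT big1 ?addr0 => [|b bj].
      by rewrite eq_sym; case: eqP; rewrite ?mulr1 ?mulr0.
    by rewrite eq_sym [j == b]eq_sym (negPf bj) andbF mulr0.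
  rewrite (bigD1 (bar i)) //= barK eqxx big1 ?addr0 => [|b bi] /=.
    by rewrite eq_bar; case: eqP; rewrite ?mulr1 ?mulr0.
  by rewrite eq_bar eq_sym (negPf bi) mulr0.
rewrite mod_act_suml; apply: subspace_sum => // a _.
rewrite mod_act_suml; apply: subspace_sum => // b _.
by rewrite mod_actZl; apply: subspaceZ => //; apply: h.
Qed.

(* sl2-theory modulo a submodule P. *)
Lemma sl2_dominant P w v a b : subspace P -> stable P -> wv w v -> ~ P v ->
  b != a -> b != bar a -> P (mod_act (soE a b) v) ->
  (exists n, P (iter n (mod_act (soE b a)) v)) ->
  exists n : nat, w a - w b = n%:R /\
    forall j, (j <= n)%N -> ~ P (iter j (mod_act (soE b a)) v).
Proof.
move=> sP stP wvv nPv ba bba Pe [n0 Pn0].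
have exn : exists n, `[< P (iter n (mod_act (soE b a)) v) >] by exists n0; apply/asboolP.
case: (ex_minnP exn) => n /asboolP Pn minn {n0 Pn0 exn}.
(* The least power of the lowering operator that sends v into P is positive, as v is not in P; the
   witness is its predecessor. *)
case: n Pn minn => [//|n] Pn minn; exists n.
set f := mod_act (soE b a) in Pn minn *; pose e : M -> M := mod_act (soE a b).
have ab : a != bar b by rewrite eq_bar eq_sym.
have ab' : a != b by rewrite eq_sym.
have ef u : e (f u) = f (e u) + (mod_act (soE a a) u - mod_act (soE b b) u).
  have := mod_act_bracket (soE a b) (soE b a) u; rewrite -/(f _) -/(e _) -/(e u) -/(f (e u)).
  rewrite bracket_soE !eqxx (negPf ab) !scale0r subr0 addr0 !scale1r.
  rewrite mod_actDl mod_actNl => /eqP; rewrite eq_sym subr_eq.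
  by move=> /eqP ->; rewrite addrC.
have wf t : mod_act (soE a a) (iter t f v) - mod_act (soE b b) (iter t f v) =
    (w a - w b - t%:R *+ 2) *: iter t f v.
  have [w' [wv' ea eb]] : exists w', [/\ wv w' (iter t f v),
      w' a = w a - t%:R & w' b = w b + t%:R].
    elim: t => [|t [w' [wv' ea eb]]]; first by exists w; split; rewrite ?subr0 ?addr0.
    exists (fun c => w' c + wt b a c); split; first exact: wv_shift.
      by rewrite ea (wt_snd ab' ab) -natr1; ring.
    by rewrite eb (wt_fst ab' ab) -natr1; ring.
  by rewrite !wv' ea eb -scalerBl; congr (_ *: _); ring.
have key t : P (e (iter t.+1 f v) - (t.+1%:R * (w a - w b - t%:R)) *: iter t f v).
  elim: t => [|t IHt].
    rewrite /= ef (wf 0) mul1r subr0 mul0rn subr0 addrK.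
    exact: stP.
  rewrite [iter t.+2 f v]iterS ef wf.
  have := stP (soE b a) _ IHt; rewrite mod_actB mod_actZ => h.
  have {}h : P (f (e (iter t.+1 f v)) - (t.+1%:R * (w a - w b - t%:R)) *: iter t.+1 f v).
    exact: h.
  rewrite -addrA -scalerBl.
  suff -> : w a - w b - t.+1%:R *+ 2 - t.+2%:R * (w a - w b - t.+1%:R) =
    - (t.+1%:R * (w a - w b - t%:R)) by rewrite scaleNr.
  by rewrite -!natr1; ring.
split; last first.
  move=> j jn Pj; have := minn j; rewrite ltnNge jn => h.
  by have := h (asboolT Pj).
have := subspaceB sP (stP (soE a b) _ Pn) (key n).
rewrite -/e opprB addrC subrK => /(subspaceZ sP) h.
have [//|neq] := eqVneq (w a - w b) n%:R.
have Pn' : P (iter n f v).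
  have := h (n.+1%:R * (w a - w b - n%:R))^-1; rewrite scalerA mulVf ?scale1r //.
  by rewrite mulf_neq0 ?pnatr_eq0 // subr_eq0.
by have := minn n (asboolT Pn'); rewrite ltnn.
Qed.

End HighestWeight.

Section Casimir.
Variables (K : numFieldType) (m : nat).
Local Notation g := (so K m).
Local Notation I := 'I_(m + m).
Local Notation mx x := (@vsval K _ (so_space K m) x).
Local Notation soE := (@soE K m).
Variable M : lieModule g.
Implicit Types (x y : g) (a b c d : I) (u v : M) (w : I -> K) (N P : M -> Prop).

Definition casimir v : M :=
  \sum_a \sum_b mod_act (soE a b) (mod_act (soE b a) v).

Lemma casimir_linear : linear casimir.
Proof.
move=> r u v; rewrite /casimir scaler_sumr -big_split; apply: eq_bigr => a _ /=.
rewrite scaler_sumr -big_split; apply: eq_bigr => b _ /=.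
by rewrite !mod_actD !mod_actZ.
Qed.
HB.instance Definition _ := @GRing.isLinear.Build K M M *:%R casimir casimir_linear.

Lemma bracket_soEr x a b : bracket x (soE a b) =
  \sum_c mx x c a *: soE c b - \sum_c mx x b c *: soE a c.
Proof.
have lin (F : I -> g) : mx (\sum_a F a) = \sum_a mx (F a) by apply: raddf_sum.
have xd (X : 'M[K]_(m + m)) i j : X *m delta_mx i j = \sum_c X c i *: delta_mx c j.
  apply/matrixP => s t; rewrite summxE mxE (bigD1 i) //= big1 ?addr0; last first.
    by move=> c /negPf h; rewrite mxE h mulr0.
  rewrite (bigD1 s) //= big1 ?addr0; last first.
    by move=> c /negPf h; rewrite !mxE eq_sym h mulr0.
  by rewrite !mxE !eqxx.
have dx (X : 'M[K]_(m + m)) i j : delta_mx i j *m X = \sum_c X j c *: delta_mx i c.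
  apply/matrixP => s t; rewrite summxE mxE (bigD1 j) //= big1 ?addr0; last first.
    by move=> c /negPf h; rewrite mxE h andbF mul0r.
  rewrite (bigD1 t) //= big1 ?addr0; last first.
    by move=> c /negPf h; rewrite !mxE [t == c]eq_sym h andbF mulr0.
  by rewrite !mxE !eqxx andbT mulrC.
apply: subvs_inj; rewrite val_bracket val_soD val_soN !lin val_soE.
under [X in _ = X - _]eq_bigr do rewrite val_soZ val_soE scalerBr.
under [X in _ = _ - X]eq_bigr do rewrite val_soZ val_soE scalerBr.
rewrite !sumrB -xd -dx mulmxBr mulmxBl.
have -> : \sum_c mx x c a *: delta_mx (bar b) (bar c) =
    - (delta_mx (bar b) (bar a) *m mx x).
  rewrite dx (reindex_inj (@bar_inj m)) -sumrN; apply: eq_bigr => c _ /=.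
  by rewrite barK -scaleNr -so_trEP barK.
have -> : \sum_c mx x b c *: delta_mx (bar c) (bar a) =
    - (mx x *m delta_mx (bar b) (bar a)).
  rewrite xd (reindex_inj (@bar_inj m)) -sumrN; apply: eq_bigr => c _ /=.
  by rewrite barK -scaleNr -so_trEP barK.
rewrite !opprK !opprD !opprK.
by rewrite [LHS](AC (2*2) (1*4*3*2))%AC /= [RHS](AC (2*2) (1*2*3*4))%AC.
Qed.

Lemma casimir_comm x v : casimir (mod_act x v) = mod_act x (casimir v).
Proof.
pose S1 := \sum_a \sum_b mod_act (bracket x (soE a b)) (mod_act (soE b a) v).
pose S2 := \sum_a \sum_b mod_act (soE a b) (mod_act (bracket x (soE b a)) v).
have e1 : mod_act x (casimir v) = casimir (mod_act x v) + (S1 + S2).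
  rewrite /casimir /S1 /S2 raddf_sum -!big_split; apply: eq_bigr => a _ /=.
  rewrite raddf_sum -!big_split; apply: eq_bigr => b _ /=.
  by rewrite !mod_act_bracket mod_actB [X in _ + X]addrA subrK addrC subrK.
suff e2 : S1 + S2 = 0 by rewrite e1 e2 addr0.
pose T c a b u := mx x c a *: mod_act (soE c b) (mod_act (soE b a) u).
pose T' a b c u := mx x b c *: mod_act (soE a c) (mod_act (soE b a) u).
have -> : S1 = \sum_a \sum_b \sum_c T c a b v - \sum_a \sum_b \sum_c T' a b c v.
  rewrite /S1 -sumrB; apply: eq_bigr => a _; rewrite -sumrB; apply: eq_bigr => b _.
  rewrite bracket_soEr mod_actDl mod_actNl !mod_act_suml.
  by congr (_ - _); apply: eq_bigr => c _; rewrite mod_actZl.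
have -> : S2 = \sum_a \sum_b \sum_c T' a c b v - \sum_a \sum_b \sum_c T a c b v.
  rewrite /S2 -sumrB; apply: eq_bigr => a _; rewrite -sumrB; apply: eq_bigr => b _.
  rewrite bracket_soEr mod_actDl mod_actNl !mod_act_suml mod_actB.
  rewrite !(raddf_sum (mod_act (soE a b))) /=.
  by congr (_ - _); apply: eq_bigr => c _; rewrite mod_actZl mod_actZ.
have -> : \sum_a \sum_b \sum_c T' a c b v = \sum_a \sum_b \sum_c T' a b c v.
  by apply: eq_bigr => a _; rewrite exchange_big.
have -> : \sum_a \sum_b \sum_c T a c b v = \sum_a \sum_b \sum_c T c a b v.
  rewrite exchange_big [RHS]exchange_big /=; apply: eq_bigr => b _.
  by rewrite exchange_big.
by rewrite [X in X + _]addrC addrACA subrr addNr addr0.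
Qed.

(* Normal ordering of the Casimir operator. *)
Lemma casimir_singular P w v : subspace P -> stable P -> wv w v ->
  (forall a b, posr a b -> P (mod_act (soE a b) v)) ->
  P (casimir v - cas w *: v).
Proof.
move=> sP stP wvv Pv.
have -> : casimir v - cas w *: v = \sum_a \sum_b
   (mod_act (soE a b) (mod_act (soE b a) v) - cas_term w a b *: v).
  rewrite /casimir /cas scaler_suml -sumrB; apply: eq_bigr => a _.
  by rewrite scaler_suml -sumrB.
have P0 := subspace0 sP.
apply: subspace_sum => // a _; apply: subspace_sum => // b _; rewrite /cas_term.
have [<-|ab] := eqVneq a b.
  by rewrite wvv mod_actZ wvv scalerA expr2 subrr.
have [->|bb] := eqVneq b (bar a).
  have -> : posr a (bar a) = false by rewrite /posr eqxx andbF.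
  by rewrite soE_bar0 mod_act0l scale0r subrr.
have := posr_total ab bb; case pab: (posr a b) => /=; last first.
  by move=> pba; rewrite scale0r subr0; apply/stP/Pv.
move=> _.
have := mod_act_bracket (soE a b) (soE b a) v.
have abb : a != bar b by rewrite eq_bar eq_sym.
rewrite bracket_soE !eqxx (negPf abb) !scale0r subr0 addr0 !scale1r.
rewrite mod_actDl mod_actNl !wvv -scalerBl => ->.
by rewrite opprB addrC subrK; apply/stP/Pv.
Qed.

End Casimir.

(** * Complete reducibility of bounded modules *)

Section Words.
Variables (K : numFieldType) (m : nat).
Local Notation g := (so K m).
Local Notation I := 'I_(m + m).
Local Notation soE := (@soE K m).
Local Notation wt := (@wt K m).
Variable M : lieModule g.
Implicit Types (x y : g) (a b c d : I) (u v s : M) (w l : I -> K) (N P : M -> Prop).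

Record singular w s : Prop := Singular {
  sing_neq0 : s != 0;
  sing_wv : wv w s;
  sing_pos : forall a b, posr a b -> mod_act (soE a b) s = 0 }.

Inductive word s l : (I -> K) -> M -> Prop :=
| word0 : word s l l s
| wordS w u a b : word s l w u -> posr a b ->
    word s l (fun c => w c - wt a b c) (mod_act (soE b a) u).

Lemma wtC a b c : wt b a c = - wt a b c.
Proof. by rewrite /wt; ring. Qed.

Lemma word_wv s l w u : wv l s -> word s l w u -> wv w u.
Proof.
move=> ws; elim=> [//|{}w {}u a b _ IH _].
have -> : (fun c => w c - wt a b c) = (fun c => w c + wt b a c).
  by apply: boolp.funext => c; rewrite -wtC.
exact: (wv_shift _ _ IH).
Qed.

Lemma word_qplus s l w u : word s l w u -> qplus (fun c => l c - w c).
Proof.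
elim=> [|{}w {}u a b _ IH ab].
  rewrite (_ : (fun c => _) = fun _ => 0); first exact: qplus0.
  by apply: boolp.funext => c; rewrite subrr.
have := qplusS IH ab; congr qplus; apply: boolp.funext => c.
by rewrite /= opprB [in RHS]addrA [in RHS]addrAC.
Qed.

(** Each letter strictly lowers [rsum] of the weight, so only the empty word has weight [l]. *)
Lemma word_top s l w u : word s l w u -> w = l -> u = s.
Proof.
case=> [//|{}w {}u a b h ab e]; exfalso.
have := qplusS_rsum_gt0 (word_qplus h) ab; rewrite rsumE big1 ?ltxx // => c _.
have ec : w c - wt a b c = l c := congr1 (fun f => f c) e.
by rewrite -ec (_ : _ + _ = 0) ?mulr0 //; ring.
Qed.

Definition hwspan (C : (I -> K) -> Prop) : M -> Prop := lspan (fun u =>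
  exists s l w, [/\ singular l s, C l & word s l w u]).

Lemma hwspan_subspace C : subspace (hwspan C).
Proof. exact: lspan_subspace. Qed.

Definition wspan s l : M -> Prop := lspan (fun u => exists w, word s l w u).

Lemma wspan_stable s l : singular l s -> stable (wspan s l).
Proof.
move=> hs; have ss : subspace (wspan s l) by apply: lspan_subspace.
have neg a b u : posr a b -> wspan s l u -> wspan s l (mod_act (soE b a) u).
  move=> ab; elim=> [v [w wu]||v v' _ h _ h'|r v _ h].
  - by apply: lspan_in; exists (fun c => w c - wt a b c); apply: wordS.
  - by rewrite mod_act0; apply: lspan0.
  - by rewrite mod_actD; apply: lspanD.
  - by rewrite mod_actZ; apply: lspanZ.
(* The bracket with the outermost letter is again a combination of elements [soE], and the induction
   hypothesis covers all of these at once. *)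
have wd w u : word s l w u -> forall a b, wspan s l (mod_act (soE a b) u).
  elim=> [|{}w {}u c d wu IH cd] a b.
    have [<-|ab] := eqVneq a b.
      by rewrite (sing_wv hs); apply/lspanZ/lspan_in; exists l; apply: word0.
    have [->|bb] := eqVneq b (bar a); first by rewrite soE_bar0 mod_act0l; apply: lspan0.
    case/orP: (posr_total ab bb) => h; first by rewrite (sing_pos hs) //; apply: lspan0.
    by apply: neg => //; apply: lspan_in; exists l; apply: word0.
  have e := mod_act_bracket (soE a b) (soE d c) u.
  have {e} -> : mod_act (soE a b) (mod_act (soE d c) u) =
    mod_act (bracket (soE a b) (soE d c)) u +
    mod_act (soE d c) (mod_act (soE a b) u) by rewrite e subrK.
  apply: lspanD; last by apply: neg => //; apply: IH.
  rewrite bracket_soE !mod_actDl !mod_actNl !mod_actZl.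
  by apply: (subspaceD ss); [apply: (subspaceB ss); [apply: (subspaceB ss)|]|];
    apply: lspanZ; apply: IH.
apply: stable_soE => // a b u; elim=> [v [w wu]||v v' _ h _ h'|r v _ h].
- exact: wd wu a b.
- by rewrite mod_act0; apply: lspan0.
- by rewrite mod_actD; apply: lspanD.
- by rewrite mod_actZ; apply: lspanZ.
Qed.

Lemma wspan_hwspan C s l : singular l s -> C l ->
  forall u, wspan s l u -> hwspan C u.
Proof.
move=> hs Cl; apply: lspan_sub => u [w wu]; apply: lspan_in.
by exists s, l, w.
Qed.

Lemma hwspan_stable C : stable (hwspan C).
Proof.
move=> x u; elim=> [v [s [l [w [hs Cl wu]]]]||v v' _ h _ h'|r v _ h].
- apply: (wspan_hwspan hs Cl); apply: wspan_stable => //.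
  by apply: lspan_in; exists w.
- by rewrite mod_act0; apply: lspan0.
- by rewrite mod_actD; apply: lspanD.
- by rewrite mod_actZ; apply: lspanZ.
Qed.

Lemma stable_casimir N u : subspace N -> stable N -> N u -> N (casimir u).
Proof.
by move=> sN stN Nu; apply: subspace_sum => // a _; apply: subspace_sum => // b _; do 2!apply: (stN).
Qed.

Lemma casimir_sing l s : singular l s -> casimir s = cas l *: s.
Proof.
move=> hs; apply/eqP; rewrite -subr_eq0; apply/eqP.
apply: (@casimir_singular _ _ _ (fun u => u = 0)).
- by split=> [//|u v -> ->|r u ->]; rewrite ?addr0 ?scaler0.
- by move=> x u ->; rewrite mod_act0.
- exact: sing_wv hs.
- exact: sing_pos hs.
Qed.

Lemma casimir_word s l w u : singular l s -> word s l w u ->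
  casimir u = cas l *: u.
Proof.
move=> hs; elim=> [|{}w {}u a b _ IH _]; first exact: casimir_sing.
by rewrite casimir_comm IH mod_actZ.
Qed.

Lemma hwspan_shift_casimir C cs v : hwspan C v ->
  hwspan C (shift_ops (@casimir K m M) cs v).
Proof.
move=> h; apply: shift_ops_stable => //; first exact: hwspan_subspace.
by move=> z; apply: stable_casimir; [exact: hwspan_subspace | exact: hwspan_stable].
Qed.

(** Words are Casimir eigenvectors; the factors for the eigenvalues other than [c0] remove all other
    components. *)
Lemma hwspan_casimir (c0 : K) u : hwspan (fun _ => True) u ->
  exists cs, c0 \notin cs /\
    hwspan (fun l => cas l = c0) (shift_ops (@casimir K m M) cs u).
Proof.
elim=> [v [s [l [w [hs _ wu]]]]||v v' _ [cs [h1 h2]] _ [cs' [h1' h2']]|r v _ [cs [h1 h2]]].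
- have [e|ne] := eqVneq (cas l) c0.
    by exists [::]; split=> //; apply: lspan_in; exists s, l, w.
  exists [:: cas l]; split; first by rewrite inE eq_sym.
  by rewrite /= (casimir_word hs wu) subrr; apply: lspan0.
- by exists [::]; split=> //; apply: lspan0.
- exists (cs ++ cs'); split; first by rewrite mem_cat negb_or h1.
  rewrite raddfD /=; apply: lspanD.
    by rewrite shift_ops_catC shift_ops_cat; apply: hwspan_shift_casimir.
  by rewrite shift_ops_cat; apply: hwspan_shift_casimir.
- by exists cs; split=> //; rewrite linearZ /=; apply: lspanZ.
Qed.

End Words.

(** * Height of weights *)

Section Height.
Variables (K : numFieldType) (m k : nat).
Local Notation I := 'I_(m + m).
Implicit Types (a b c d : I) (w : I -> K).

Definition height w : K := \sum_(i < m) (m.-1 - i)%N%:R * w (lshift m i).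

Lemma height_wt w a b :
  height (fun c => w c + wt K a b c) = height w + (rho a - rho b)%:~R.
Proof.
pose h d := \sum_(i < m) (m.-1 - i)%N%:R * (lshift m i == d)%:R : K.
have hrho d : h d - h (bar d) = (rho d)%:~R.
  case: (lrshiftP d) => j; rewrite /h ?bar_lshift ?bar_rshift ?rho_lshift ?rho_rshift.
    rewrite (bigD1 j) //= eqxx mulr1 big1 => [|i ij].
      by rewrite big1 ?addr0 ?subr0 // => i _; rewrite eq_lrshift mulr0.
    by rewrite eq_lshift (negPf ij) mulr0.
  rewrite big1 => [|i _]; last by rewrite eq_lrshift mulr0.
  rewrite (bigD1 j) //= eqxx mulr1 big1 => [|i ij].
    by rewrite addr0 sub0r rmorphN.
  by rewrite eq_lshift (negPf ij) mulr0.
rewrite rmorphB /= -!hrho /height /h.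
have -> (x y z t s : K) : s + (x - y - (z - t)) = s + (x - z - y + t) by ring.
rewrite -!sumrB -!big_split; apply: eq_bigr => i _ /=.
by rewrite /wt; ring.
Qed.

Definition in_range w := forall a, w a \in spin_vals K k.

(** The distance from the largest height that the range allows. Raising operators decrease it, so it
    serves as an induction measure even where finite dimension is unknown. *)
Definition depth w (n : nat) : Prop :=
  height w = \sum_(i < m) (m.-1 - i)%N%:R * (k%:R / 2%:R) - n%:R.

Lemma depth_ex w : in_range w -> exists n, depth w n.
Proof.
move=> hw; have h (i : 'I_m) : exists j : nat, w (lshift m i) = k%:R / 2%:R - j%:R.
  by have /spin_valsP[j _ ->] := hw (lshift m i); exists j.
have [j hj] := fin_all_exists h.
exists (\sum_(i < m) (m.-1 - i) * j i)%N; rewrite /depth /height natr_sum -sumrB.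
by apply: eq_bigr => i _; rewrite hj mulrBr natrM.
Qed.

Lemma depth_lt w a b n n' : posr a b -> depth w n ->
  depth (fun c => w c + wt K a b c) n' -> (n' < n)%N.
Proof.
move=> ab; rewrite /depth height_wt => ->; set C := \sum_(i < m) _ => e.
have /eqP : (rho a - rho b)%:~R = (n%:Z - n'%:Z)%:~R :> K.
  apply: (addrI (C - n%:R)); rewrite e rmorphB /= -!pmulrn; ring.
by rewrite eqr_int => /eqP; case/andP: ab; lia.
Qed.

End Height.

Section BoundedModule.
Variables (K : numFieldType) (m k : nat).
Local Notation g := (so K m).
Local Notation I := 'I_(m + m).
Local Notation soE := (@soE K m).
Local Notation wt := (@wt K m).
Local Notation vals := (spin_vals K k).
Variable M : lieModule g.
Hypothesis bM : bounded k M.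
Implicit Types (x y : g) (a b c d : I) (u v s : M) (w l : I -> K) (N P : M -> Prop).

Lemma wv_range w v : wv w v -> v != 0 -> in_range k w.
Proof.
move=> wvv v0 a; have := bM a v; rewrite (shift_ops_eigen _ (wvv a)) => /eqP.
rewrite scaler_eq0 (negPf v0) orbF prodf_seq_eq0 => /hasP[c cv] /=.
by rewrite subr_eq0 => /eqP ->.
Qed.

Lemma wv_decomp N u : subspace N -> stable N -> N u ->
  lspan (fun v => N v /\ exists w, wv w v) u.
Proof.
move=> sN stN Nu.
have h (r : seq I) : lspan (fun v => N v /\ exists w, forall a, a \in r ->
    mod_act (soE a a) v = w a *: v) u.
  elim: r => [|a r IH]; first by apply: lspan_in; split=> //; exists (fun _ => 0).
  apply: lspan_min IH => [|v [Nv [w hw]]]; first exact: lspan_subspace.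
  pose N' v := N v /\ forall b, b \in r -> mod_act (soE b b) v = w b *: v.
  have sN' : subspace N'.
    split=> [|v1 v2 [h1 h1'] [h2 h2']|r0 v1 [h1 h1']].
    - by split=> [|b _]; [exact: subspace0 | rewrite mod_act0 scaler0].
    - split=> [|b br]; first exact: subspaceD.
      by rewrite mod_actD scalerDr h1' // h2'.
    - split=> [|b br]; first exact: subspaceZ.
      by rewrite mod_actZ h1' // !scalerA mulrC.
  have N'a v1 : N' v1 -> N' (mod_act (soE a a) v1).
    move=> [h1 h1']; split=> [|b br]; first exact: stN.
    have := mod_act_bracket (soE b b) (soE a a) v1; rewrite soE_weight.
    rewrite (_ : _ + _ = 0) ?scale0r ?mod_act0l; last by ring.
    by move=> /esym/eqP; rewrite subr_eq0 => /eqP ->; rewrite h1' // mod_actZ.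
  have := diagonalizable (f := mod_act (soE a a)) sN' N'a (spin_vals_uniq K k)
    (conj Nv hw) (bM a v).
  apply: lspan_sub => v1 [[h1 h1'] [c hc]]; apply: lspan_in; split=> //.
  exists (fun b => if b == a then c else w b) => b; rewrite inE.
  by case: eqP => [->|_] //= br; apply: h1'.
apply: lspan_sub (h (enum I)) => v [Nv [w hw]]; apply: lspan_in; split=> //.
by exists w => a; apply: hw; rewrite mem_enum.
Qed.

(** A weight vector of least depth in N is killed by all raising operators. *)
Lemma ex_singular N u : subspace N -> stable N -> N u -> u != 0 ->
  exists w s, N s /\ singular w s.
Proof.
move=> sN stN Nu u0.
have [n0 [w0 [s0 [Ns0 s0n0 ws0 d0]]]] : exists n w s,
    [/\ N s, s != 0, wv w s & depth k w n].
  apply/not_existsP => h; case/negP: u0; apply/eqP.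
  apply: (lspan_min (N := fun v => v = 0) _ _ (wv_decomp sN stN Nu)) =>
    [|v [Nv [w hw]]].
    by split=> [//|u1 v1 -> ->|r u1 ->]; rewrite ?addr0 ?scaler0.
  apply/eqP/negPn/negP => v0; have [n hn] := depth_ex (wv_range hw v0).
  by apply: (h n); exists w, v.
have exn : exists n, `[< exists w s, [/\ N s, s != 0, wv w s & depth k w n] >].
  by exists n0; apply/asboolP; exists w0, s0.
case: (ex_minnP exn) => n /asboolP[w [s [Ns sn0 ws dn]]] minn.
exists w, s; split=> //; split=> // a b ab.
apply/eqP/negPn/negP => ne; have wv' := wv_shift a b ws.
have [n' hn'] := depth_ex (wv_range wv' ne).
have := minn n'; rewrite leqNgt (depth_lt ab dn hn') => h.
suff : false by []. apply: h; apply/asboolP.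
exists (fun c => w c + wt a b c), (mod_act (soE a b) s); split=> //.
exact: stN.
Qed.

Lemma iter_wv w v a b n : wv w v ->
  wv (fun c => w c + n%:R * wt a b c) (iter n (mod_act (soE a b)) v).
Proof.
move=> wvv; elim: n => [|n IH] /=.
  by rewrite (_ : (fun c => _) = w) //; apply: boolp.funext => c; ring.
rewrite (_ : (fun c => _) = (fun c => (w c + n%:R * wt a b c) + wt a b c)).
  exact: (wv_shift _ _ IH).
by apply: boolp.funext => c; rewrite -natr1; ring.
Qed.

(** Each application raises the coordinate at [a] by 1, while [spin_vals] has only [k.+1]
    elements. *)
Lemma nilpotent w v a b : wv w v -> b != a -> b != bar a ->
  iter k.+1 (mod_act (soE a b)) v = 0.
Proof.
move=> wvv ba bba; apply/eqP/negPn/negP => ne.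
have v0 : v != 0.
  apply: contraNneq ne => ->; apply/eqP.
  by elim: k.+1 => [//|n IH] /=; rewrite IH mod_act0.
have /spin_valsP[j jk ej] := wv_range wvv v0 a.
have /spin_valsP[j' _] := wv_range (iter_wv a b k.+1 wvv) ne a.
rewrite wt_fst // mulr1 ej => e.
have : (j' + k.+1)%N%:R = j%:R :> K.
  have e1 : k.+1%:R = k%:R / 2%:R - j'%:R - (k%:R / 2%:R - j%:R) :> K.
    by rewrite -e addrAC subrr add0r.
  by rewrite natrD e1; ring.
by move/eqP; rewrite eqr_nat => /eqP; lia.
Qed.

Lemma dominant_mod P w v : subspace P -> stable P -> wv w v -> ~ P v ->
  (forall a b, posr a b -> P (mod_act (soE a b) v)) -> dominant w.
Proof.
move=> sP stP wvv nPv h a b ab.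
have [|n [-> _]] := sl2_dominant sP stP wvv nPv (posr_neq ab) (posr_bar ab) (h a b ab).
  have ab1 : a != b by rewrite eq_sym (posr_neq ab).
  have ab2 : a != bar b by rewrite eq_bar eq_sym (posr_bar ab).
  by exists k.+1; rewrite (nilpotent wvv ab1 ab2); apply: subspace0.
by exists n.
Qed.

Lemma dominant_singular w s : singular w s -> dominant w.
Proof.
move=> hs; apply: (@dominant_mod (fun u => u = 0)).
- by split=> [//|u v -> ->|r u ->]; rewrite ?addr0 ?scaler0.
- by move=> x u ->; rewrite mod_act0.
- exact: sing_wv hs.
- by apply/eqP; apply: sing_neq0 hs.
- exact: sing_pos hs.
Qed.

Lemma singular_anti w s : singular w s -> anti w.
Proof. by move=> hs; apply: wv_anti (sing_wv hs) (sing_neq0 hs). Qed.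

Section Projection.
Variable w0 : I -> K.

(** Lagrange interpolation at [spin_vals]: the projector to the eigenvalue [w0 a] of [soE a a]. *)
Definition wproj1 a v : M :=
  (\prod_(c <- rem (w0 a) vals) (w0 a - c))^-1 *:
  shift_ops (mod_act (soE a a)) (rem (w0 a) vals) v.

Lemma wproj1_linear a : linear (wproj1 a).
Proof. by move=> r u v; rewrite /wproj1 linearP /= scalerDr !scalerA mulrC. Qed.

Lemma wproj1_wv w a v : wv w v -> in_range k w ->
  wproj1 a v = (w a == w0 a)%:R *: v.
Proof.
move=> wvv wr; rewrite /wproj1 (shift_ops_eigen _ (wvv a)).
have [->|ne] := eqVneq (w a) (w0 a); last first.
  rewrite scale0r (_ : \prod_(c <- _) (w a - c) = 0) ?scale0r ?scaler0 //.
  apply/eqP; rewrite prodf_seq_eq0; apply/hasP; exists (w a); last by rewrite /= subrr.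
  by rewrite mem_rem_uniq ?spin_vals_uniq // inE ne wr.
rewrite scalerA mulVf ?scale1r // prodf_seq_neq0; apply/allP => c.
rewrite mem_rem_uniq ?spin_vals_uniq // inE => /andP[ne _] /=.
by rewrite subr_eq0 eq_sym.
Qed.

Definition wproj v : M := foldr wproj1 v (enum I).

Lemma wproj_linear : linear wproj.
Proof.
rewrite /wproj; elim: (enum I) => [//|a r IH] b u v /=.
by rewrite IH wproj1_linear.
Qed.

Lemma wproj_wv w v : wv w v -> in_range k w ->
  wproj v = (\prod_(a <- enum I) (w a == w0 a)%:R) *: v.
Proof.
move=> wvv wr; rewrite /wproj; elim: (enum I) => [|a r IH]; first by rewrite big_nil scale1r.
rewrite big_cons /= IH.
have := wproj1_linear a (\prod_(j <- r) (w j == w0 j)%:R) v 0.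
have z : wproj1 a 0 = 0 by rewrite /wproj1 raddf0 scaler0.
by rewrite z !addr0 => ->; rewrite (wproj1_wv a wvv) // scalerA mulrC.
Qed.

End Projection.

(** The projector to weight [w0] fixes y and removes the vectors of other weights from a
    combination. *)
Lemma lspan_weight (R : (I -> K) -> M -> Prop) w0 (y : M) : wv w0 y ->
  lspan (fun u => exists w, wv w u /\ R w u) y -> lspan (R w0) y.
Proof.
move=> wy hy; have [->|y0] := eqVneq y 0; first exact: lspan0.
have w0r := wv_range wy y0.
have -> : y = wproj w0 y.
  by rewrite (wproj_wv w0 wy w0r) big1 ?scale1r // => a _; rewrite eqxx.
pose N u := lspan (R w0) (wproj w0 u).
have pl := wproj_linear w0.
have p0 : wproj w0 0 = 0.
  by have := pl (-1) 0 0; rewrite scaler0 addr0 scaleN1r addNr.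
have sN : subspace N.
  split=> [|u v hu hv|r u hu]; rewrite /N; first by rewrite p0; apply: lspan0.
    by have := pl 1 u v; rewrite !scale1r => ->; apply: lspanD.
  by have := pl r u 0; rewrite p0 !addr0 => ->; apply: lspanZ.
apply: (lspan_min sN) hy => u [w [wu Ru]]; rewrite /N.
have [->|u0] := eqVneq u 0; first by rewrite p0; apply: lspan0.
have wr := wv_range wu u0; rewrite (wproj_wv w0 wu wr).
case: (boolp.pselect (w = w0)) => [e|ne].
  by apply/lspanZ/lspan_in; rewrite -e.
have /eqP -> : \prod_(a <- enum I) (w a == w0 a)%:R == 0 :> K.
  rewrite prodf_seq_eq0; apply/negPn/negP => /hasPn h; apply: ne.
  apply: boolp.funext => a; have := h a (mem_enum _ _).
  by rewrite /= pnatr_eq0 eqb0 negbK => /eqP.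
by rewrite scale0r; apply: lspan0.
Qed.

(** The Casimir operator acts on all of [wspan s l] by [cas l], so [cas w = cas l]. As [l - w] is a
    sum of positive roots and both weights are dominant, [cas_strict] applies. With [ex_singular]
    this makes [wspan s l] simple. *)
Lemma HW_unique l s w (y : M) : singular l s -> wspan s l y -> singular w y ->
  w = l /\ exists r, y = r *: s.
Proof.
move=> hs ys hy.
have y1 : lspan (fun u => exists w', wv w' u /\ word s l w' u) y.
  apply: lspan_sub ys => u [w' wu]; apply: lspan_in; exists w'; split=> //.
  exact: word_wv (sing_wv hs) wu.
have {}y1 := lspan_weight (sing_wv hy) y1.
have qp : qplus (fun c => l c - w c).
  apply: boolp.contrapT => nq; have := sing_neq0 hy; case/eqP.
  apply: (lspan_min (N := fun v => v = 0) _ _ y1) => [|u wu].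
    by split=> [//|u v -> ->|r u ->]; rewrite ?addr0 ?scaler0.
  by case: nq; apply: word_qplus wu.
have e : cas l = cas w.
  have : casimir y = cas l *: y.
    apply: (lspan_min (N := fun v => casimir v = cas l *: v) _ _ ys) => [|u [w' wu]].
      split=> [|u v hu hv|r u hu]; first by rewrite raddf0 scaler0.
        by rewrite raddfD /= hu hv scalerDr.
      by rewrite linearZ /= hu !scalerA mulrC.
    exact: casimir_word hs wu.
  rewrite (casimir_sing hy) => /eqP; rewrite -subr_eq0 -scalerBl scaler_eq0.
  by rewrite (negPf (sing_neq0 hy)) orbF subr_eq0 => /eqP.
have el : l = w.
  by apply: cas_strict e => //; [apply: singular_anti hs | apply: singular_anti hy
    | apply: dominant_singular hs | apply: dominant_singular hy].
split=> //; apply: (lspan_min (N := fun v => exists r, v = r *: s) _ _ y1).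
  split=> [|u v [r ->] [r' ->]|r u [r' ->]]; first by exists 0; rewrite scale0r.
    by exists (r + r'); rewrite scalerDl.
  by exists (r * r'); rewrite scalerA.
by move=> u wu; exists 1; rewrite scale1r; apply: (word_top wu).
Qed.

(* A weight vector v of maximal weight outside the span P of the highest weight
   submodules would be singular modulo P; correcting it by a polynomial in the
   Casimir operator makes it singular, because the Casimir eigenvalue strictly
   increases along the dominance order. *)
Lemma hwspan_all u : hwspan (fun _ => True) u.
Proof.
pose P := @hwspan K m M (fun _ => True).
have sP : subspace P by apply: hwspan_subspace.
have stP : stable P by apply: hwspan_stable.
suff h n w v : wv w v -> depth k w n -> P v.
  have sT : subspace (fun _ : M => True) by split.
  have := wv_decomp sT (fun _ _ _ => Logic.I) (Logic.I : (fun _ : M => True) u).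
  apply: (lspan_min sP) => v [_ [w wvv]].
  have [->|v0] := eqVneq v 0; first exact: subspace0.
  have [n dn] := depth_ex (wv_range wvv v0); exact: h wvv dn.
elim/ltn_ind: n w v => n IH w v wvv dn.
have Pe a b : posr a b -> P (mod_act (soE a b) v).
  move=> ab; have [->|ne] := eqVneq (mod_act (soE a b) v) 0; first exact: subspace0.
  have wv' := wv_shift a b wvv; have [n' dn'] := depth_ex (wv_range wv' ne).
  exact: (IH n' (depth_lt ab dn dn') _ _ wv' dn').
apply: boolp.contrapT => nPv.
have dw : dominant w by apply: dominant_mod nPv Pe.
have v0 : v != 0 by apply/eqP => v0; apply: nPv; rewrite v0; apply: subspace0.
have aw : anti w by apply: wv_anti wvv v0.
pose c0 := cas w; pose Om : {linear M -> M} := @casimir K m M.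
pose P0 := @hwspan K m M (fun l => cas l = c0).
have [cs [c0cs hcs]] : exists cs, c0 \notin cs /\ forall a b, posr a b ->
    P0 (shift_ops Om cs (mod_act (soE a b) v)).
  (* One list of eigenvalues serves all positive roots: the lists are concatenated, and further
     factors preserve [P0]. *)
  have [cs [h1 h2]] : exists cs, c0 \notin cs /\ forall p, p \in enum {: I * I} ->
      posr p.1 p.2 -> P0 (shift_ops Om cs (mod_act (soE p.1 p.2) v)).
    elim: (enum {: I * I}) => [|p r [cs [h1 h2]]]; first by exists [::].
    case pp: (posr p.1 p.2); last first.
      exists cs; split=> // q; rewrite inE => /predU1P[->|]; last exact: h2.
      by rewrite pp.
    have [cs' [h1' h2']] := hwspan_casimir c0 (Pe _ _ pp).
    exists (cs ++ cs'); split; first by rewrite mem_cat negb_or h1.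
    move=> q; rewrite inE => /predU1P[-> _|qr qq].
      by rewrite shift_ops_cat; apply: hwspan_shift_casimir.
    by rewrite shift_ops_catC shift_ops_cat; apply/hwspan_shift_casimir/h2.
  by exists cs; split=> // a b; apply: (h2 (a, b)); rewrite mem_enum.
pose v' := shift_ops Om cs v.
have wv' : wv w v'.
  have sw : subspace (wv w : M -> Prop).
    split=> [a|u1 u2 h1 h2 a|r u1 h1 a]; first by rewrite mod_act0 scaler0.
      by rewrite mod_actD scalerDr h1 h2.
    by rewrite mod_actZ h1 !scalerA mulrC.
  apply: (shift_ops_stable cs sw) wvv => u1 h1 a.
  by rewrite -casimir_comm h1 linearZ.
have ev' a b : posr a b -> mod_act (soE a b) v' = 0.
  move=> ab; have e1 : mod_act (soE a b) v' = shift_ops Om cs (mod_act (soE a b) v).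
    apply: (shift_ops_morph (f := Om) (f' := Om) (h := mod_act (soE a b))).
    by move=> u1; rewrite /= casimir_comm.
  have wz := wv_shift a b wv'; have := hcs a b ab; rewrite -e1 => hz.
  pose R w1 u1 := exists s l, [/\ singular l s, cas l = c0 & @word K m M s l w1 u1].
  have {}hz : lspan (fun u1 => exists w1, wv w1 u1 /\ R w1 u1) (mod_act (soE a b) v').
    apply: lspan_sub hz => u1 [s [l [w1 [hs hl wu]]]]; apply: lspan_in.
    exists w1; split; first by apply: word_wv (sing_wv hs) wu.
    by exists s, l.
  apply: (lspan_min (N := fun u1 => u1 = 0) _ _ (lspan_weight wz hz)) => [|u1].
    by split=> [//|u2 v2 -> ->|r u2 ->]; rewrite ?addr0 ?scaler0.
  move=> [s [l [hs hl wu]]]; exfalso.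
  (* A nonzero vector would come from a highest weight [l] with the same Casimir eigenvalue as [w],
     yet above [w] by at least the root of [soE a b]; this contradicts [cas_strict]. *)
  have qp := word_qplus wu; have := qplusS qp ab; have := qplusS_rsum_gt0 qp ab.
  have -> : (fun c => l c - (w c + wt a b c) + wt a b c) = (fun c => l c - w c).
    by apply: boolp.funext => c; ring.
  move=> gt0 qlw; have elw : l = w.
    by apply: cas_strict hl => //; [apply: singular_anti hs | apply: dominant_singular hs].
  move: gt0; rewrite elw rsumE big1 ?ltxx // => c _.
  by rewrite subrr mulr0.
have Pv' : P v'.
  have [->|ne] := eqVneq v' 0; first exact: subspace0.
  by apply: lspan_in; exists v', w, w; split=> //; apply: word0.
have Om_v : P (Om v - c0 *: v) by apply: casimir_singular.
(* Modulo P the Casimir operator acts on v by [c0], so [v'] is a multiple of v there; the factor is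
   nonzero because [c0] is not in [cs]. *)
have {}Om_v : P (v' - (\prod_(c <- cs) (c0 - c)) *: v).
  rewrite /v'; elim: (cs) => [|c r IHr].
    by rewrite big_nil scale1r subrr; apply: subspace0.
  rewrite big_cons /= -/(shift_ops Om r v); set q := \prod_(j <- r) _ in IHr *.
  set z := shift_ops Om r v in IHr *.
  have -> : Om z - c *: z - ((c0 - c) * q) *: v =
      Om (z - q *: v) - c *: (z - q *: v) + q *: (Om v - c0 *: v).
    rewrite [Om (_ - _)]raddfB /= [Om (_ *: _)]linearZ /= !scalerBr mulrBl scalerBl.
    rewrite !scalerA [q * c0]mulrC !opprD !opprK.
    by rewrite [RHS](AC ((2*2)*2) (((1*3)*(6*4))*(5*2)))%AC /= subrr addr0.
  apply: (subspaceD sP); last exact: (subspaceZ sP).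
  apply: (subspaceB sP); last exact: (subspaceZ sP).
  exact: stable_casimir.
have : P ((\prod_(c <- cs) (c0 - c)) *: v).
  by have := subspaceB sP Pv' Om_v; rewrite opprB addrC subrK.
move/(subspaceZ sP (\prod_(c <- cs) (c0 - c))^-1); rewrite scalerA mulVf.
  by rewrite scale1r.
rewrite prodf_seq_neq0; apply/allP => c ccs /=; rewrite subr_eq0.
by apply: contraNneq c0cs => ->.
Qed.

End BoundedModule.

(** * The quotient as a left module *)

Section LeftModule.
Variables (K : numFieldType) (m k : nat).
Local Notation g := (so K m).
Local Notation I := 'I_(m + m).
Local Notation soE := (@soE K m).
Local Notation leftS := (@leftS K m k).
Local Notation rightS := (@rightS K m k).
Implicit Types (x y : g) (p q : Sym g) (a b c d : I).

Fact leftS_actP : @lie_action K g (Sym g) leftS.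
Proof.
split=> [x|p|x y p]; first exact: leftS_linear.
  exact: leftS_linear_l.
exact: leftS_bracket.
Qed.

Definition left_mod : lieModule g := LieModule leftS_actP.

Variable e : g.
Variables (a0 b0 : I) (r0 : K).
Hypothesis eE : e = r0 *: soE a0 b0.
Hypotheses (r0_neq0 : r0 != 0) (b0_bar : b0 != bar a0) (b0_neq : b0 != a0).
Local Notation J := (ideal_span (@gl_span K m k e)).

Let rk2 := root_rank2 eE.

Definition left_ideal : submodule left_mod :=
  @Submodule K g left_mod J (ideal_span0 _) (@ideal_spanD _ _)
    (@gl_idealZ _ _ k e) (fun x p => @gl_ideal_leftS K m k e rk2 x p).

Definition left_quot : lieModule g := quot_mod left_ideal.
Definition left_proj (p : Sym g) : left_quot := @quot_proj K g left_mod left_ideal p.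

Lemma left_proj_hom : @lie_hom K g left_mod left_quot left_proj.
Proof.
split; first exact: mquot_proj_linear.
by move=> x v; rewrite /left_proj /quot_proj /= mquot_actE.
Qed.

Lemma left_proj_leftS x p : left_proj (leftS x p) = mod_act x (left_proj p).
Proof. by have [_ h] := left_proj_hom; apply: h. Qed.

Lemma left_proj_eq0 p : left_proj p = 0 <-> J p.
Proof.
have -> : (0 : left_quot) = left_proj 0.
  have [h _] := left_proj_hom; have := h (-1) 0 0.
  by rewrite scaler0 addr0 scaleN1r addNr => ->.
have := @mquot_projP K g left_mod left_ideal p 0; rewrite subr0; exact.
Qed.

Lemma left_proj_surj (q : left_quot) : exists p, q = left_proj p.
Proof. by exists (mquot_repr q); rewrite /left_proj /quot_proj mquot_reprK. Qed.

Lemma env_act_left_proj p : env_act k (left_proj 1) p = left_proj p.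
Proof.
have [hl hx] := left_proj_hom.
move: p; apply: (leftS_ind (k := k)) => [|p q hp hq|r p hp|x p hp].
- exact: env_act1.
- by rewrite env_actD hp hq; have := hl 1 p q; rewrite !scale1r => ->.
- rewrite env_actZ hp; have := hl r p 0; rewrite addr0 => ->.
  by rewrite (_ : left_proj 0 = 0) ?addr0 //; apply/left_proj_eq0/ideal_span0.
- by rewrite env_act_left hp left_proj_leftS.
Qed.

Lemma left_quot_bounded : bounded k left_quot.
Proof.
move=> a q; have [p ->] := left_proj_surj q.
have [hl hx] := left_proj_hom.
pose pr : {linear Sym g -> left_quot} :=
  HB.pack left_proj (@GRing.isLinear.Build K (Sym g) left_quot *:%R left_proj hl).
rewrite -[left_proj p]/(pr p).
rewrite -(shift_ops_morph (f := leftS (soE a a)) (h := pr)); last first.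
  by move=> u; apply: left_proj_leftS.
(* Right multiplications commute with [leftS] and generate everything from 1, so it suffices to
   evaluate at 1, where the result is the power of [soE a a] in the ideal. *)
apply/left_proj_eq0; move: p; apply: (rightS_ind (k := k)) => [|p p' hp hp'|r p hp|x p hp].
- rewrite shift_leftS1; apply: ideal_span_gen.
  exact: (gl_span_soE _ eE).
- by rewrite raddfD; apply: ideal_spanD.
- by rewrite linearZ; apply: gl_idealZ.
- have := shift_ops_morph (f := leftS (soE a a)) (f' := leftS (soE a a)) (h := rightS x)
    (spin_vals K k) p.
  move=> <- //=; first exact: (gl_ideal_rightS rk2).
  by move=> u; rewrite rightS_leftS.
Qed.

End LeftModule.

Section Product.
Variables (K : fieldType) (L : lieAlgebra K) (M N : lieModule L).

Definition prod_act (x : L) (u : M * N) : M * N := (mod_act x u.1, mod_act x u.2).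

Fact prod_actP : lie_action prod_act.
Proof.
split=> [x r u v|u r x y|x y u]; rewrite /prod_act /=.
- by rewrite !mod_actD !mod_actZ.
- by rewrite !mod_act_lin_l.
- by rewrite !mod_act_bracket.
Qed.

Definition prod_mod : lieModule L := LieModule prod_actP.

End Product.

Section EnvActModules.
Variables (K : numFieldType) (m k : nat).
Local Notation g := (so K m).
Local Notation soE := (@soE K m).

Lemma env_act_stable (M : lieModule g) (N : M -> Prop) u p :
  subspace N -> stable N -> N u -> N (env_act k u p).
Proof.
move=> sN stN Nu; move: p; apply: (leftS_ind (k := k)) => [|p q hp hq|r p hp|x p hp].
- by rewrite env_act1.
- by rewrite env_actD; apply: subspaceD.
- by rewrite env_actZ; apply: subspaceZ.
- by rewrite env_act_left; apply: stN.
Qed.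

Variables M N : lieModule g.

Lemma prod_bounded : bounded k M -> bounded k N -> bounded k (prod_mod M N).
Proof.
move=> bM bN a [u v].
suff -> : shift_ops (@mod_act K g (prod_mod M N) (soE a a)) (spin_vals K k) (u, v) =
    (shift_ops (mod_act (soE a a)) (spin_vals K k) u,
     shift_ops (mod_act (soE a a)) (spin_vals K k) v) by rewrite bM bN.
by elim: (spin_vals K k) => [//|c cs /= ->].
Qed.

Lemma env_act_prod u v p :
  @env_act K m k (prod_mod M N) (u, v) p = (env_act k u p, env_act k v p).
Proof.
have e1 := @env_act_hom K m k (prod_mod M N) M fst.
have e2 := @env_act_hom K m k (prod_mod M N) N snd.
rewrite [LHS]surjective_pairing e1 ?e2 //; split=> //; by move=> r [x y] [x' y'].
Qed.

Lemma word_prod s t l w u : @word K m M s l w u ->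
  exists u', @word K m (prod_mod M N) (s, t) l w (u, u').
Proof.
elim=> [|{}w {}u a b _ [u' hu'] ab]; first by exists t; apply: word0.
by exists (mod_act (soE b a) u'); apply: (wordS hu' ab).
Qed.

(* If p annihilates a module with a highest weight vector of weight l then it
   annihilates the submodule generated by any other one: both are quotients of
   the submodule generated by the diagonal in the product. *)
Lemma env_act_wspan l s t p : bounded k M -> bounded k N ->
  @singular K m M l s -> @singular K m N l t ->
  (forall v : N, env_act k v p = 0) ->
  forall u, wspan s l u -> env_act k u p = 0.
Proof.
move=> bM bN hs ht pN.
have bP := prod_bounded bM bN.
have hst : @singular K m (prod_mod M N) l (s, t).
  split; first by apply: contra_neq (sing_neq0 hs) => -[].
    by move=> a; exact: (congr2 pair (sing_wv hs a) (sing_wv ht a)).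
  by move=> a b ab; exact: (congr2 pair (sing_pos hs ab) (sing_pos ht ab)).
have sW : subspace (@wspan K m (prod_mod M N) (s, t) l) by apply: lspan_subspace.
have stW := wspan_stable hst.
have pw u w : word s l w u -> env_act k u p = 0.
  move=> /(word_prod t)[u' hu']; apply/eqP/negPn/negP => ne.
  (* The kernel of the second projection. If nonzero it contains a singular vector, which is a
     multiple of [(s, t)] and therefore has a nonzero second component. *)
  pose N' (z : prod_mod M N) := @wspan K m (prod_mod M N) (s, t) l z /\ z.2 = 0.
  have sN' : subspace N'.
    split=> [|z1 z2 [h1 h1'] [h2 h2']|r z [h h']]; split.
    - exact: subspace0.
    - by [].
    - exact: subspaceD.
    - by rewrite /= h1' h2' addr0.
    - exact: subspaceZ.
    - by rewrite /= h' scaler0.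
  have stN' : stable N'.
    by move=> x z [h h']; split; [apply: stW | rewrite /= h' mod_act0].
  have Ny : N' (@env_act K m k (prod_mod M N) (u, u') p).
    split; last by rewrite env_act_prod /= pN.
    by apply: env_act_stable => //; apply: lspan_in; exists w.
  have y0 : @env_act K m k (prod_mod M N) (u, u') p != 0.
    by rewrite env_act_prod; apply: contra_neq ne => -[].
  have [w' [y [[yW y2] hy]]] := ex_singular bP sN' stN' Ny y0.
  have [_ [r ey]] := HW_unique bP hst yW hy.
  move: y2 (sing_neq0 hy); rewrite ey /= => /eqP.
  by rewrite scaler_eq0 (negPf (sing_neq0 ht)) orbF => /eqP ->; rewrite scale0r eqxx.
move=> u; elim=> [v [w wv']||v v' _ h _ h'|r v _ h].
- exact: pw wv'.
- exact: env_act0l.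
- by rewrite env_actDl h h' addr0.
- by rewrite env_actZl h scaler0.
Qed.

End EnvActModules.

(** * Highest weight modules *)

Section RowWeights.
Variables (K : numFieldType) (m : nat).
Local Notation g := (so K m).
Local Notation I := 'I_(m + m).
Local Notation mx x := (@vsval K _ (so_space K m) x).
Local Notation soE := (@soE K m).
Implicit Types (a b : I) (i j : 'I_m) (lam : 'rV[K]_m).

Definition row_weight lam a : K :=
  match split a with inl i => lam 0 i | inr i => - lam 0 i end.

Lemma row_weight_lshift lam i : row_weight lam (lshift m i) = lam 0 i.
Proof. by rewrite /row_weight -/(unsplit (inl _ i)) unsplitK. Qed.
Lemma row_weight_rshift lam i : row_weight lam (rshift m i) = - lam 0 i.
Proof. by rewrite /row_weight -/(unsplit (inr _ i)) unsplitK. Qed.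

Lemma cartan_soE (t : 'rV[K]_m) :
  cartan t = \sum_i t 0 i *: soE (lshift m i) (lshift m i).
Proof.
have lin (F : 'I_m -> g) : mx (\sum_a F a) = \sum_a mx (F a) by apply: raddf_sum.
apply: subvs_inj; rewrite /= lin cartanE; apply/matrixP => a b; rewrite summxE.
have -> : \sum_i mx (t 0 i *: soE (lshift m i) (lshift m i)) a b =
    \sum_i t 0 i * ((a == lshift m i) && (b == lshift m i))%:R -
    \sum_i t 0 i * ((a == rshift m i) && (b == rshift m i))%:R.
  rewrite -sumrB; apply: eq_bigr => i _.
  by rewrite val_soZ val_soE bar_lshift !mxE mulrBr.
have D i j : \sum_l t 0 l * ((i == l) && (j == l))%:R = t 0 i *+ (i == j).
  rewrite (bigD1 i) //= eqxx big1 => [|l li].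
    by rewrite addr0 eq_sym; case: eqP; rewrite ?mulr1 ?mulr0.
  by rewrite eq_sym (negPf li) mulr0.
have Z (F : 'I_m -> bool) : (forall l, F l = false) -> \sum_l t 0 l * (F l)%:R = 0.
  by move=> h; rewrite big1 // => l _; rewrite h mulr0.
case: (lrshiftP a) => i; case: (lrshiftP b) => j;
  rewrite ?(block_mxEul, block_mxEur, block_mxEdl, block_mxEdr).
- rewrite [X in _ - X]Z ?subr0 => [|l]; last by rewrite eq_lrshift.
  by under eq_bigr do rewrite !eq_lshift; rewrite D mxE.
- by rewrite !Z ?subr0 ?mxE // => l; rewrite ?eq_lrshift ?eq_rlshift ?andbF.
- by rewrite !Z ?subr0 ?mxE // => l; rewrite ?eq_lrshift ?eq_rlshift ?andbF.
- rewrite [X in X - _]Z ?sub0r => [|l]; last by rewrite eq_rlshift.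
  by under eq_bigr do rewrite !eq_rshift; rewrite D !mxE.
Qed.

Lemma weight_vector_wv (M : lieModule g) lam v :
  weight_vector (M := M) lam v -> wv (row_weight lam) v.
Proof.
move=> h; have hl i : mod_act (soE (lshift m i) (lshift m i)) v = lam 0 i *: v.
  have -> : soE (lshift m i) (lshift m i) = cartan (delta_mx 0 i).
    rewrite cartan_soE (bigD1 i) //= mxE !eqxx scale1r big1 ?addr0 // => j ji.
    by rewrite mxE (negPf ji) andbF scale0r.
  rewrite h (bigD1 i) //= mxE !eqxx mulr1 big1 ?addr0 // => j ji.
  by rewrite mxE (negPf ji) andbF mulr0.
move=> a; case: (lrshiftP a) => i; first by rewrite row_weight_lshift hl.
by rewrite row_weight_rshift -bar_lshift soE_bar mod_actNl hl scaleNr.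
Qed.

Lemma soE_neq0 a b : b != bar a -> b != a -> soE a b != 0.
Proof.
move=> ba ab; apply/eqP => /(congr1 (fun x => mx x a b)).
rewrite linear0 val_soE !mxE !eqxx [b == bar a](negPf ba) andbF subr0 => /eqP.
by rewrite oner_eq0.
Qed.

Lemma posr_root_vector a b : posr a b ->
  exists alpha, positive_root alpha /\ root_vector alpha (soE a b).
Proof.
move=> ab; exists (\row_j wt K a b (lshift m j)); split; last first.
  split; first exact: soE_neq0 (posr_bar ab) (posr_neq ab).
  move=> t; rewrite cartan_soE mod_act_suml scaler_suml; apply: eq_bigr => i _.
  rewrite mod_actZl [mod_act _ _]soE_weight scalerA mulrC.
  by rewrite mxE.
have row_eq (w : 'rV[K]_m) : (forall j, wt K a b (lshift m j) = w 0 j) ->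
    \row_j wt K a b (lshift m j) = w.
  by move=> h; apply/rowP => j; rewrite mxE h.
move: ab row_eq; case: (lrshiftP a) => i; case: (lrshiftP b) => j.
- rewrite posr_ll => ij row_eq; exists i, j; split=> //; left; apply: row_eq => l.
  by rewrite /wt !bar_lshift !eq_lshift !eq_lrshift !mxE eqxx subr0 addr0.
- rewrite posr_lr => ij row_eq.
  have e : \row_l wt K (lshift m i) (rshift m j) (lshift m l) = eps K i + eps K j.
    apply: row_eq => l.
    by rewrite /wt bar_lshift bar_rshift !eq_lshift !eq_lrshift !mxE eqxx !subr0.
  rewrite e; case: (ltngtP i j) => h.
  + by exists i, j; split=> //; right.
  + by exists j, i; split=> //; right; rewrite addrC.
  + by case/eqP: ij; apply: val_inj.
- by rewrite posr_rl.
- rewrite posr_rr => ij row_eq; exists j, i; split=> //; left; apply: row_eq => l.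
  rewrite /wt !bar_rshift !eq_lshift !eq_lrshift !mxE eqxx subrr sub0r.
  by rewrite addrC.
Qed.

Lemma highest_weight_singular (M : lieModule g) lam v :
  highest_weight_vector (M := M) lam v -> singular (row_weight lam) v.
Proof.
move=> [v0 wvv h]; split=> //; first exact: weight_vector_wv.
by move=> a b /posr_root_vector[alpha [pa ra]]; apply: h pa ra.
Qed.

End RowWeights.

(** * Weights of finite-dimensional modules *)

Section FiniteDimensional.
Variables (K : numFieldType) (m : nat).
Local Notation g := (so K m).
Local Notation I := 'I_(m + m).
Local Notation soE := (@soE K m).
Variable V : fdModule g.
Local Notation M := (mod_of_fd V).
Implicit Types (a b : I) (u v : M) (w : I -> K).

(** Boundedness of V is still to be shown, so finite dimension is used: otherwise [soE a a] would
    have infinitely many eigenvalues [w a + n]. *)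
Lemma fd_nilpotent w u a b : wv w u -> b != a -> b != bar a ->
  exists n, iter n (mod_act (soE a b)) u = 0.
Proof.
move=> wu ba bba; apply: boolp.contrapT => ne.
pose A := act_mx V (soE a a).
have ch0 : char_poly A != 0 by apply/monic_neq0/char_poly_monic.
pose rs := [seq w a + n%:R | n <- iota 0 (size (char_poly A))].
have ur : uniq rs.
  rewrite map_inj_uniq ?iota_uniq // => i j /addrI /eqP.
  by rewrite eqr_nat => /eqP.
have ar : all (root (char_poly A)) rs.
  apply/allP => c /mapP[n _ ->]; rewrite -eigenvalue_root_char.
  apply/eigenvalueP; exists (v2r (iter n (mod_act (soE a b)) u : V)).
    rewrite act_mxE -[fd_act _ _]/(@mod_act K g M _ _) (iter_wv a b n wu a).
    by rewrite wt_fst // mulr1 linearZ.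
  apply/eqP => e0; apply: ne; exists n.
  by apply: (can_inj (@v2rK _ V)); rewrite e0 linear0.
by have := max_poly_roots ch0 ar ur; rewrite size_map size_iota ltnn.
Qed.

Lemma fd_reflection w u a b : wv w u -> u != 0 -> b != a -> b != bar a ->
  exists w' u', [/\ wv w' u', u' != 0, w' a = w b & w' b = w a].
Proof.
have sP : subspace (fun x : M => x = 0).
  by split=> [//|x y -> ->|r x ->]; rewrite ?addr0 ?scaler0.
have stP : stable (fun x : M => x = 0) by move=> x y ->; rewrite mod_act0.
(* [r] counts the steps from u to the top of its sl2-string and [n] is the length of the string
   below the top. If [n - 2 r] is nonnegative, [n - r] steps down from the top reach the reflected
   weight. *)
have main a' b' : wv w u -> u != 0 -> b' != a' -> b' != bar a' ->
  exists n r : nat, w a' - w b' = n%:R - r%:R *+ 2 /\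
    ((r.*2 <= n)%N -> exists w' u', [/\ wv w' u', u' != 0, w' a' = w b' & w' b' = w a']).
  move=> wu u0 ba bba.
  have ab : a' != b' by rewrite eq_sym.
  have abb : a' != bar b' by rewrite eq_bar eq_sym.
  have exr : exists n, iter n.+1 (mod_act (soE a' b')) u == 0.
    have [[|n] hn] := fd_nilpotent wu ba bba; first by rewrite /= in hn; rewrite hn eqxx in u0.
    by exists n; apply/eqP.
  case: (ex_minnP exr) => r /eqP er minr.
  set v0 := iter r (mod_act (soE a' b')) u in er *.
  have v00 : v0 != 0.
    rewrite /v0; case: r minr {er v0} => [//|r] minr.
    by apply/negP => h; have := minr r h; rewrite ltnn.
  have wv0 := iter_wv a' b' r wu.
  have [|n [en hn]] := @sl2_dominant K m M (fun x => x = 0) _ v0 a' b' sP stP wv0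
      (elimN eqP v00) ba bba er.
    exact: fd_nilpotent wv0 ab abb.
  rewrite wt_fst // wt_snd // mulr1 mulrN1 in en.
  have en' : w a' - w b' = n%:R - r%:R *+ 2 by rewrite -en; ring.
  exists n, r; split=> //.
  move=> le; have wv1 := iter_wv b' a' (n - r) wv0.
  exists (fun c => w c + r%:R * wt K a' b' c + (n - r)%:R * wt K b' a' c),
    (iter (n - r) (mod_act (soE b' a')) v0); split; first exact: wv1.
  - by apply/eqP; apply: hn; rewrite leq_subr.
  - rewrite wt_fst // wt_snd // natrB; last by lia.
    have -> : w a' = w b' + (n%:R - r%:R *+ 2) by rewrite -en' addrC subrK.
    by ring.
  - rewrite wt_snd // wt_fst // natrB; last by lia.
    have -> : w a' = w b' + (n%:R - r%:R *+ 2) by rewrite -en' addrC subrK.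
    by ring.
move=> wu u0 ba bba.
have ab : a != b by rewrite eq_sym.
have abb : a != bar b by rewrite eq_bar eq_sym.
have [n [r [e1 h1]]] := main a b wu u0 ba bba.
have [n' [r' [e2 h2]]] := main b a wu u0 ab abb.
(* The weight differences for (a, b) and (b, a) are opposite, so at least one of them is
   nonnegative. *)
case: (leqP r.*2 n) => hr; first exact: h1.
have [|w' [u' [p1 p2 p3 p4]]] := h2; last by exists w', u'; split.
have : n%:R - r%:R *+ 2 + (n'%:R - r'%:R *+ 2) = 0 :> K.
  by rewrite -e1 -e2 addrA subrK subrr.
rewrite -!mulrnA => e; have : (n + n')%N%:R = (r * 2 + r' * 2)%N%:R :> K.
  apply/eqP; rewrite -subr_eq0 -e !natrD; apply/eqP; ring.
move/eqP; rewrite eqr_nat => /eqP.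
by lia.
Qed.

End FiniteDimensional.

Section HighestWeightModule.
Variables (K : numFieldType) (m k : nat).
Local Notation g := (so K m).
Local Notation I := 'I_(m + m).
Local Notation soE := (@soE K m).
Variable V : fdModule g.
Local Notation M := (mod_of_fd V).
Hypothesis irrV : irreducible M.
Implicit Types (a b : I) (u : M) (w : I -> K).
Variables (w : I -> K) (v : M).
Hypothesis hv : singular w v.

Lemma irreducible_all (N : M -> Prop) : subspace N -> stable N ->
  (exists2 u, N u & u != 0) -> forall u, N u.
Proof.
move=> sN stN [u Nu u0].
have [_ /(_ (Submodule (subspace0 sN) (subspaceD sN) (subspaceZ sN) stN))[|//]] :=
  irrV.
by move=> /(_ u Nu) e; rewrite e eqxx in u0.
Qed.

Lemma irreducible_wspan u : wspan v w u.
Proof.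
apply: irreducible_all; first exact: lspan_subspace.
  exact: wspan_stable.
by exists v; [apply: lspan_in; exists w; apply: word0 | exact: sing_neq0 hv].
Qed.

Variables (i0 i1 : 'I_m).
Hypotheses (i0_0 : i0 = 0%N :> nat) (i1_neq : i1 != i0).
Local Notation a1 := (lshift m i0).

Lemma word_first w' u : word v w w' u -> exists n : nat, w' a1 = w a1 - n%:R.
Proof.
elim=> [|{}w' {}u a b _ [n IH] ab]; first by exists 0; rewrite subr0.
have hm := ltn_ord i0.
have rho_le (c : I) : (rho c <= rho a1) /\ (- rho a1 <= rho c).
  rewrite rho_lshift i0_0 subn0; have l (i : 'I_m) : (m.-1 - i)%N%:Z <= m.-1%:Z.
    by rewrite lez_nat leq_subr.
  case: (lrshiftP c) => i; rewrite !(rho_lshift, rho_rshift) ?lerN2 l; split=> //.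
    by apply: le_trans (_ : 0 <= _); rewrite ?oppr_le0.
  by apply: (@le_trans _ _ 0); rewrite ?oppr_le0.
have /andP[ab' _] := ab.
have nb : (a1 == b) = false.
  by apply/negbTE; apply: contraTneq ab' => <-; rewrite -leNgt (proj1 (rho_le a)).
have na : (a1 == bar a) = false.
  apply/negbTE; apply: contraTneq ab' => e.
  by rewrite -leNgt -[rho a]opprK -rho_bar -e (proj2 (rho_le b)).
exists (n + ((a1 == a) + (a1 == bar b)))%N.
by rewrite IH /wt nb na !natrD !mulr0n; ring.
Qed.

Lemma eigen_first u (c : K) : u != 0 -> mod_act (soE a1 a1) u = c *: u ->
  exists n : nat, c = w a1 - n%:R.
Proof.
move=> u0 hu.
have [cs [hcs e]] : exists cs, (forall c, c \in cs -> exists n : nat, c = w a1 - n%:R)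
    /\ shift_ops (mod_act (soE a1 a1)) cs u = 0.
  elim: (irreducible_wspan u) => [x [w' hw]||x y _ [cs [h1 h2]] _ [cs' [h1' h2']]
    |r x _ [cs [h1 h2]]].
  - have [n hn] := word_first hw; exists [:: w' a1]; split.
      by move=> c'; rewrite inE => /eqP ->; exists n.
    by rewrite (shift_ops_eigen _ (word_wv (sing_wv hv) hw a1)) big_seq1 subrr scale0r.
  - by exists [::].
  - exists (cs ++ cs'); split.
      by move=> c'; rewrite mem_cat => /orP[/h1|/h1'].
    rewrite raddfD /= [X in X + _]shift_ops_catC [X in X + _]shift_ops_cat h2.
    by rewrite shift_ops_cat h2' !raddf0 addr0.
  - by exists cs; split=> //; rewrite linearZ /= h2 scaler0.
move/eqP: e; rewrite (shift_ops_eigen _ hu) scaler_eq0 (negPf u0) orbF.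
rewrite prodf_seq_eq0 => /hasP[c' /hcs[n ->] /=]; rewrite subr_eq0 => /eqP ->.
by exists n.
Qed.

(** Reflections carry any coordinate to the first one. A single sign change is not in the Weyl
    group, so for [bar a1] two reflections through a second index [i1] are combined. *)
Lemma weight_first w' u a : wv w' u -> u != 0 -> exists n : nat, w' a = w a1 - n%:R.
Proof.
move=> wu u0; have [->|ne] := eqVneq a a1; first exact: eigen_first u0 (wu a1).
have [ea|ne'] := eqVneq a (bar a1); last first.
  have [w2 [u2 [wu2 u20 e2 _]]] := fd_reflection wu u0 ne ne'.
  by rewrite -e2; apply: eigen_first u20 (wu2 a1).
have b1 : lshift m i1 != a1 by rewrite eq_lshift.
have b2 : lshift m i1 != bar a1 by rewrite bar_lshift eq_lrshift.
have [w2 [u2 [wu2 u20 e2 e3]]] := fd_reflection wu u0 b1 b2.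
have b3 : bar (lshift m i1) != a1 by rewrite bar_lshift eq_rlshift.
have b4 : bar (lshift m i1) != bar a1 by rewrite (inj_eq (@bar_inj m)).
have [w3 [u3 [wu3 u30 e4 _]]] := fd_reflection wu2 u20 b3 b4.
have -> : w' a = w3 a1.
  by rewrite e4 (wv_anti wu2 u20) e3 ea (wv_anti wu u0).
exact: eigen_first u30 (wu3 a1).
Qed.

Lemma irreducible_bounded (j : nat) : w a1 = k%:R / 2%:R - j%:R -> bounded k M.
Proof.
move=> e1 a u; elim: (irreducible_wspan u) => [x [w' hw]||x y _ h _ h'|r x _ h].
- have [->|x0] := eqVneq x 0; first exact: raddf0.
  have wx := word_wv (sing_wv hv) hw.
  rewrite (shift_ops_eigen _ (wx a)).
  have /eqP -> : \prod_(c <- spin_vals K k) (w' a - c) == 0; last by rewrite scale0r.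
  rewrite prodf_seq_eq0; apply/hasP; exists (w' a); last by rewrite /= subrr.
  have [n hn] := weight_first a wx x0; have [n' hn'] := weight_first (bar a) wx x0.
  (* The coordinates at [a] and [bar a] are opposite; adding their expressions gives
     [2 j + n + n' = k], hence [j + n <= k]. *)
  apply/spin_valsP; exists (j + n)%N; last by rewrite hn e1 natrD; ring.
  have : (j + n + (j + n'))%N%:R = k%:R :> K.
    have -> : k%:R = k%:R - (w' a + w' (bar a)) :> K.
      by rewrite (wv_anti wx x0) subrr subr0.
    rewrite hn' {1}hn e1.
    by rewrite !natrD; field.
  by move/eqP; rewrite eqr_nat => /eqP; lia.
- exact: raddf0.
- by rewrite raddfD; move: h h' => /= -> ->; rewrite addr0.
- by rewrite linearZ; move: h => /= ->; rewrite scaler0.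
Qed.

End HighestWeightModule.

(** * Coordinates of dominant weights *)

Section Weights.
Variables (K : numFieldType) (n : nat).
Local Notation m := n.+2.
Implicit Types (a b : 'I_m -> nat) (i j : 'I_m) (k : nat).

Lemma fund_weightE i j : fund_weight K i 0 j =
  if (i < n)%N then (j <= i)%N%:R else
  if (i < n.+1)%N then 2%:R^-1 * (if (j < n.+1)%N then 1 else -1) else 2%:R^-1.
Proof.
have sumE (P : pred 'I_m) (f : 'I_m -> K) :
    (\sum_(l < m | P l) f l *: eps K l) 0 j = (P j)%:R * f j.
  rewrite summxE; have [Pj|/negPf Pj] := boolP (P j).
    rewrite (bigD1 j) //= !mxE !eqxx mulr1 mul1r big1 ?addr0 // => l /andP[_ lj].
    by rewrite !mxE [j == l]eq_sym (negPf lj) andbF mulr0.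
  rewrite mul0r big1 // => l Pl; rewrite !mxE.
  by have [e|_] := eqVneq j l; [rewrite e Pl in Pj | rewrite andbF mulr0].
rewrite /fund_weight !ltnS; case: ifP => [i_n|_].
  rewrite (eq_bigr (fun l => 1 *: eps K l)) => [|l _]; last by rewrite scale1r.
  by rewrite sumE mulr1.
rewrite -ltnS; case: ifP => [i_n|_]; rewrite mxE.
  rewrite (eq_bigr (fun l : 'I_m => (if (l < n.+1)%N then 1 else -1) *: eps K l)).
    by rewrite sumE mul1r.
  by move=> l _; rewrite ltnS; case: ifP; rewrite ?scale1r ?scaleN1r.
rewrite (eq_bigr (fun l => 1 *: eps K l)) => [|l _]; last by rewrite scale1r.
by rewrite sumE !mulr1.
Qed.

(** Splits off the two spin nodes. *)
Lemma sum_ord_inord (T : nmodType) (F : 'I_m -> T) :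
  \sum_i F i = \sum_(0 <= i < n) F (inord i) + F (inord n) + F ord_max.
Proof.
rewrite big_ord_recr big_ord_recr /= big_mkord; congr (_ + _ + _).
  apply: eq_bigr => i _; congr F; apply: val_inj; rewrite /= inordK //.
  by have := ltn_ord i; lia.
by congr F; apply: val_inj; rewrite /= inordK.
Qed.

Lemma weight_ofE a j : weight_of K a 0 j =
  (\sum_(j <= i < n) a (inord i))%N%:R +
  ((a ord_max)%:R + (if (j < n.+1)%N then 1 else -1) * (a (inord n))%:R) / 2%:R.
Proof.
rewrite /weight_of summxE sum_ord_inord !mxE !fund_weightE /= !inordK // !ltnn ltnS leqnn.
have -> : \sum_(0 <= i < n) ((a (inord i))%:R *: fund_weight K (inord i)) 0 j =
    (\sum_(j <= i < n) a (inord i))%N%:R.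
  rewrite natr_sum (@big_nat_widenl _ _ _ j 0) // big_mkcond.
  apply: eq_big_nat => i /andP[_ i_n]; rewrite mxE fund_weightE inordK ?i_n.
    by case: (j <= i)%N; rewrite ?mulr1 ?mulr0.
  by apply: ltn_trans i_n _.
by rewrite [(n.+1 < n)%N]ltnNge leqnSn /=; case: ifP => _; field.
Qed.

Local Notation p := (inord n : 'I_m).

Lemma weight_of_diff a j (jn : (j < n.+1)%N) :
  weight_of K a 0 j - weight_of K a 0 (inord j.+1) = (a j)%:R.
Proof.
have ej : inord j = j by rewrite inord_val.
rewrite !weight_ofE inordK //; have [jn'|nj] := ltnP j n.
  by rewrite big_ltn // natrD jn [(j.+1 < n.+1)%N]ltnS jn' ej; ring.
have e : j = n :> nat by lia.
rewrite !big_geq; [|lia|lia]; rewrite -[in RHS]ej e ltnSn ltnn.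
by field.
Qed.

Lemma weight_of_last a : weight_of K a 0 p + weight_of K a 0 ord_max = (a ord_max)%:R.
Proof. by rewrite !weight_ofE inordK // ltnSn ltnn !big_geq //; field. Qed.

(** The hypotheses compare the pairings with the simple coroots. The last two of them determine the
    last coordinate, and the others follow by descent. *)
Lemma row_weight_eq (w : 'I_(m + m) -> K) (lam : 'rV[K]_m) : anti w ->
  (forall j, (j < n.+1)%N -> w (lshift m j) - w (lshift m (inord j.+1)) =
     lam 0 j - lam 0 (inord j.+1)) ->
  w (lshift m p) + w (lshift m ord_max) = lam 0 p + lam 0 ord_max ->
  w = row_weight lam.
Proof.
move=> aw hd hl; pose d j := w (lshift m j) - lam 0 j.
have pe : inord n.+1 = ord_max :> 'I_m by apply: val_inj; rewrite /= inordK.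
have dmax : d ord_max = 0.
  have e1 := hd p; rewrite inordK // pe in e1.
  apply: (@mulfI _ 2%:R); first by rewrite pnatr_eq0.
  transitivity (w (lshift m p) + w (lshift m ord_max) - (lam 0 p + lam 0 ord_max) -
    (w (lshift m p) - w (lshift m ord_max) - (lam 0 p - lam 0 ord_max))).
    by rewrite /d; ring.
  by rewrite hl (e1 (ltnSn n)) !subrr mulr0.
have d0 (i : nat) : forall j, (j + i = n.+1)%N -> d j = 0.
  elim: i => [|i IH] j e; first by rewrite (_ : j = ord_max) //; apply: val_inj => /=; lia.
  have jn : (j < n.+1)%N by lia.
  have := IH (inord j.+1); rewrite inordK // => /(_ ltac:(lia)) <-.
  have /eqP := hd _ jn; rewrite -subr_eq0 => /eqP h.
  by apply/eqP; rewrite -subr_eq0 -h /d; apply/eqP; ring.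
apply: boolp.funext => c; case: (lrshiftP c) => j.
  rewrite row_weight_lshift; apply/eqP; rewrite -subr_eq0; apply/eqP.
  by apply: (d0 (n.+1 - j)%N); have := ltn_ord j; lia.
rewrite row_weight_rshift -bar_lshift aw; congr (- _).
apply/eqP; rewrite -subr_eq0; apply/eqP.
by apply: (d0 (n.+1 - j)%N); have := ltn_ord j; lia.
Qed.

Lemma weight_of_inj a b : weight_of K a = weight_of K b -> a =1 b.
Proof.
move=> e j; apply/eqP; rewrite -(eqr_nat K); apply/eqP.
have [jn|nj] := ltnP j n.+1; first by rewrite -!weight_of_diff // e.
have -> : j = ord_max by apply: val_inj => /=; have := ltn_ord j; lia.
by rewrite -!weight_of_last e.
Qed.

Lemma dominant_weight_of (w : 'I_(m + m) -> K) : anti w -> dominant w ->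
  exists a, w = row_weight (weight_of K a).
Proof.
move=> aw dw; have hd j : exists x : nat,
    if (j < n.+1)%N then w (lshift m j) - w (lshift m (inord j.+1)) = x%:R
    else w (lshift m p) + w (lshift m ord_max) = x%:R.
  have [jn|_] := ltnP j n.+1.
    by apply: dw; rewrite posr_ll inordK.
  rewrite -[w (lshift m ord_max)]opprK -aw bar_lshift; apply: dw.
  by rewrite posr_lr -val_eqE /= inordK // ltn_eqF.
have [a ha] := fin_all_exists hd; exists a; apply: row_weight_eq => //.
  by move=> j jn; have := ha j; rewrite jn weight_of_diff.
by have := ha ord_max; rewrite /= ltnn weight_of_last.
Qed.

(** Twice the first coordinate is the left side of the bound. The bound says that its difference
    from [k] is nonnegative, the congruence that this difference is even. *)
Lemma weight_boundP k a : (0 < n)%N ->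
  reflect (exists x : nat, weight_of K a 0 ord0 = k%:R / 2%:R - x%:R) (weight_bound k a).
Proof.
move=> n0; rewrite weight_ofE /weight_bound.
have -> : (\sum_(i < m | (i.+2 < m)%N) 2 * a i = 2 * \sum_(0 <= i < n) a (inord i))%N.
  rewrite big_mkcond sum_ord_inord /= inordK // !ltnS ltnn ltnNge leqnSn /= !addr0.
  rewrite big_distrr /=; apply: eq_big_nat => i /andP[_ i_n].
  by rewrite inordK; [rewrite !ltnS i_n | lia].
have -> : (\sum_(i < m | (m <= i.+2)%N) a i = a p + a ord_max)%N.
  rewrite big_mkcond sum_ord_inord /= inordK // !ltnS leqnn leqnSn.
  rewrite [X in (X + _ + _)%R]big_nat big1 ?add0r // => i /andP[_ i_n].
  by rewrite inordK; [rewrite !ltnS leqNgt i_n | lia].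
set S := (\sum_(0 <= i < n) _)%N; rewrite ltn0Sn mul1r.
have E x : (S%:R + ((a ord_max)%:R + (a p)%:R) / 2%:R = k%:R / 2%:R - x%:R :> K) <->
    (S + S + (a p + a ord_max) + x + x = k)%N.
  split=> [e|<-].
    apply/eqP; rewrite -(eqr_nat K) !natrD; apply/eqP.
    transitivity (2%:R * (S%:R + ((a ord_max)%:R + (a p)%:R) / 2%:R) + 2%:R * x%:R : K).
      by field.
    by rewrite e; field.
  by rewrite !natrD; field.
apply: (iffP andP) => [[h1 /eqP h2]|[x /E h]].
  by exists ((k - (2 * S + (a p + a ord_max))) %/ 2)%N; apply/E; lia.
by split; [lia | apply/eqP; lia].
Qed.

End Weights.

(** * The highest root vector *)

Section HighestRoot.
Variables (K : numFieldType) (m : nat).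
Local Notation I := 'I_(m + m).
Local Notation mx x := (@vsval K _ (so_space K m) x).
Local Notation soE := (@soE K m).
Implicit Types (a b c d : I).

Lemma highest_rootE j : highest_root K m 0 j = (j < 2)%N%:R.
Proof.
rewrite summxE; have [j2|j2] := ltnP j 2.
  rewrite (bigD1 j) //= mxE !eqxx big1 ?addr0 // => l /andP[_ lj].
  by rewrite mxE [j == l]eq_sym (negPf lj) andbF.
rewrite big1 // => l l2; rewrite mxE.
by have [e|_] := eqVneq j l; [rewrite e leqNgt l2 in j2 | rewrite andbF].
Qed.

Lemma bracket_soE_entry a (x : so K m) c d :
  mx (bracket (soE a a) x) c d = wt K c d a * mx x c d.
Proof.
rewrite val_bracket val_soE /mx_bracket mulmxBl mulmxBr.
have El (b : I) (X : 'M[K]_(m + m)) : (delta_mx b b *m X) c d = (c == b)%:R * X c d.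
  rewrite mxE (bigD1 c) //= big1 ?addr0 => [|l lc].
    by rewrite mxE; case: eqVneq => [->|_]; rewrite ?mul0r ?eqxx ?mul1r.
  by rewrite mxE; case: eqVneq => [<-|_]; rewrite ?(negPf lc) ?mul0r.
have Er (b : I) (X : 'M[K]_(m + m)) : (X *m delta_mx b b) c d = (d == b)%:R * X c d.
  rewrite mxE (bigD1 d) //= big1 ?addr0 => [|l ld].
    by rewrite mxE andbb mulrC.
  by rewrite mxE; case: eqVneq => [<-|_]; rewrite ?andbF ?andbT ?[_ == l]eq_sym ?(negPf ld) ?mulr0.
have sub (X Y : 'M[K]_(m + m)) : (X - Y) c d = X c d - Y c d by rewrite !mxE.
rewrite !sub !El !Er /wt [a == c]eq_sym [a == d]eq_sym [a == bar c]eq_bar.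
by rewrite [a == bar d]eq_bar [bar a == c]eq_sym [bar a == d]eq_sym; ring.
Qed.

Lemma highest_root_vectorE (i0 i1 : 'I_m) e : i0 = 0%N :> nat -> i1 = 1%N :> nat ->
  root_vector (highest_root K m) e ->
  exists2 r : K, r != 0 & e = r *: soE (lshift m i0) (rshift m i1).
Proof.
move=> e0 e1 [e_neq0 we].
have we' := weight_vector_wv we.
have i01 : (i0 == i1) = false by rewrite -val_eqE /= e0 e1.
have supp c d : mx e c d != 0 ->
    (c == lshift m i0) && (d == rshift m i1) || (c == lshift m i1) && (d == rshift m i0).
  move=> ecd.
  have wtE j : wt K c d (lshift m j) = (j < 2)%N%:R.
    rewrite -highest_rootE -row_weight_lshift; apply: (mulIf ecd).
    by rewrite -bracket_soE_entry; have /= -> := we' (lshift m j); rewrite val_soZ mxE.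
  have wtE' (j : 'I_m) n : j = n :> nat -> (n < 2)%N -> wt K c d (lshift m j) = 1.
    by move=> ej n2; rewrite wtE ej n2.
  (* The weight of a matrix entry is a signed sum of indicators, so the equation can be moved from K
     to natural numbers and decided by cases. *)
  have nat_eq (p q r s : bool) : p%:R - q%:R - r%:R + s%:R = 1 :> K -> (p + s = 1 + q + r)%N.
    move=> e'; apply/eqP; rewrite -(eqr_nat K) !natrD; apply/eqP.
    by transitivity (p%:R - q%:R - r%:R + s%:R + q%:R + r%:R : K); [ring | rewrite e'].
  have := nat_eq _ _ _ _ (wtE' _ _ e0 isT); have := nat_eq _ _ _ _ (wtE' _ _ e1 isT).
  have excl (i : 'I_m) : ~~ ((i == i0) && (i == i1)).
    by apply/negP => /andP[/eqP -> /eqP]; apply/eqP; rewrite i01.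
  rewrite !eq_bar !bar_lshift.
  case: (lrshiftP c) => i; case: (lrshiftP d) => j; have := excl i; have := excl j;
    rewrite !(eq_lshift, eq_rshift, eq_lrshift, eq_rlshift) ?[i0 == _]eq_sym ?[i1 == _]eq_sym;
    by do 4! [case: (_ == _)].
have tr : mx e (lshift m i1) (rshift m i0) = - mx e (lshift m i0) (rshift m i1).
  by rewrite -[rshift m i0]bar_lshift -[lshift m i1]bar_rshift so_trEP.
have eE : e = mx e (lshift m i0) (rshift m i1) *: soE (lshift m i0) (rshift m i1).
  apply: subvs_inj; rewrite val_soZ val_soE bar_rshift bar_lshift.
  apply/matrixP => c d; rewrite !mxE.
  have [/eqP z|nz] := boolP (mx e c d == 0); last first.
    have /orP[] := supp c d nz => /andP[/eqP -> /eqP ->].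
      by rewrite !eqxx !(eq_lshift, eq_rshift) i01 subr0 mulr1.
    by rewrite tr !eqxx !(eq_lshift, eq_rshift) [i1 == _]eq_sym i01 sub0r mulrN1.
  rewrite z; have [/andP[/eqP ec /eqP ed]|_] := boolP ((c == lshift m i0) && (d == rshift m i1)).
    by rewrite -ec -ed z mul0r.
  have [/andP[/eqP ec /eqP ed]|_] := boolP ((c == lshift m i1) && (d == rshift m i0)).
    by rewrite -[mx e (lshift m i0) (rshift m i1)]opprK -tr -ec -ed z oppr0 mul0r.
  by rewrite subrr mulr0.
exists (mx e (lshift m i0) (rshift m i1)) => //.
by apply: contraNneq e_neq0 => z; rewrite eE z scale0r.
Qed.

End HighestRoot.

(** N is a mere predicate, so dimensions are counted through a matrix with columns in N and left
    kernel of least rank. A nonzero row of the kernel would be detected by one more column; so the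
    kernel is zero and the columns span. *)
Lemma trivial_annihilator (K : fieldType) (d : nat) (N : 'cV[K]_d -> Prop) :
  subspace N ->
  (forall r : 'rV[K]_d, (forall c, N c -> r *m c = 0) -> r = 0) ->
  forall c, N c.
Proof.
move=> sN annN c0.
pose P r := `[< exists n (B : 'M[K]_(d, n)),
  (forall j, N (col j B)) /\ \rank (kermx B) = r >].
have exP : exists r, P r.
  exists (\rank (kermx (0 : 'M[K]_(d, 0)))); apply/boolp.asboolP.
  by exists 0, 0; split=> // -[].
case: (ex_minnP exP) => r /boolp.asboolP[n [B [NB rB]]] min_r.
have kerB0 : kermx B = 0.
  apply: contrapT => /eqP/rowV0Pn[v vB v0].
  have [c Nc vc] : exists2 c, N c & v *m c != 0.
    apply: boolp.contrapT => h; case/eqP: v0; apply: annN => c Nc.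
    by apply: boolp.contrapT => /eqP vc; apply: h; exists c.
  have : P (\rank (kermx (row_mx B c))).
    apply/boolp.asboolP; exists (n + 1)%N, (row_mx B c); split=> // j.
    by case: (splitP j) => j' ej;
      [rewrite (_ : j = lshift 1 j') | rewrite (_ : j = rshift n j')];
      rewrite ?colKl ?colKr ?col_id //; apply: val_inj.
  move/min_r; rewrite -rB leqNgt => /negP[]; apply: rank_ltmx.
  rewrite ltmxE; apply/andP; split.
    rewrite sub_kermx; have := mulmx_ker (row_mx B c).
    by rewrite mul_mx_row => /eqP; rewrite row_mx_eq0 => /andP[].
  apply: contra vc => /(submx_trans vB); rewrite sub_kermx mul_mx_row.
  by rewrite row_mx_eq0 => /andP[].
have /row_freeP[B' BB'] : row_free B by rewrite -kermx_eq0 kerB0.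
rewrite -[c0]mul1mx -BB' -mulmxA.
have -> : B *m (B' *m c0) = \sum_j (B' *m c0) j 0 *: col j B.
  apply/colP => i; rewrite mxE summxE; apply: eq_bigr => j _.
  by rewrite [RHS]mxE [col j B i 0]mxE mulrC.
by apply: subspace_sum => // j _; apply: subspaceZ.
Qed.

Lemma quot_lift (K : fieldType) (L : lieAlgebra K) (M N : lieModule L)
    (S : submodule M) (f : M -> N) : lie_hom f -> (forall v, S v -> f v = 0) ->
  exists h : quot_mod S -> N, lie_hom h /\ forall v, h (quot_proj S v) = f v.
Proof.
move=> [fl fx] fS; have fB u v : f u - f v = f (u - v).
  by rewrite -scaleN1r addrC -fl scaleN1r addrC.
exists (fun q => f (mquot_repr q)).
have hE v : f (mquot_repr (mquot_proj S v)) = f v.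
  apply/eqP; rewrite -subr_eq0 fB; apply/eqP/fS.
  by apply/mquot_projP; rewrite mquot_reprK.
split=> //; split=> [r p q|x q].
- have e : r *: p + q = mquot_proj S (r *: mquot_repr p + mquot_repr q).
    by rewrite mquot_proj_linear !mquot_reprK.
  by rewrite e hE fl.
- by rewrite hE fx.
Qed.

(** * Decomposition of the quotient *)

Section OperatorTensor.
Variables (K : fieldType) (L : lieAlgebra K) (V : fdModule L).
Implicit Types (f g : V -> V) (u : V).

Definition coord_form f j : 'Hom(V, K^o) := linfun (fun u => v2r (f u) 0 j : K^o).

Lemma coord_formE f j u : linear f -> coord_form f j u = v2r (f u) 0 j.
Proof.
move=> fl; have hl : linear (fun u => v2r (f u) 0 j : K^o).
  by move=> r v w; rewrite fl linearP !mxE.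
pose h : {linear V -> K^o} := HB.pack (fun u => v2r (f u) 0 j : K^o)
  (@GRing.isLinear.Build K V K^o *:%R (fun u => v2r (f u) 0 j : K^o) hl).
exact: (lfunE h u).
Qed.

(* The tensor [\sum_j e_j (x) e_j^* \o f] of the endomorphism [f]. *)
Definition op_tens f : tensor_space V (dual_mod V) :=
  \matrix_j v2r (coord_form f j).

Lemma row_op_tens f j : row j (op_tens f) = v2r (coord_form f j).
Proof. exact: rowK. Qed.

Lemma op_tens_inj f g : linear f -> linear g -> op_tens f = op_tens g -> f =1 g.
Proof.
move=> fl gl e u; apply: (can_inj v2rK); apply/rowP => j.
rewrite -!coord_formE //; suff -> : coord_form f j = coord_form g j by [].
by apply: (can_inj v2rK); rewrite -!row_op_tens e.
Qed.

Lemma op_tens_linear r f g : linear f -> linear g ->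
  op_tens (fun u => r *: f u + g u) = r *: op_tens f + op_tens g.
Proof.
move=> fl gl; apply/row_matrixP => j; rewrite linearP /= !row_op_tens -linearP.
congr v2r; apply/lfunP => u.
rewrite add_lfunE scale_lfunE !coord_formE ?linearP ?mxE // => a v w.
by rewrite fl gl !scalerDr !scalerA [r * a]mulrC addrACA.
Qed.

Lemma op_tens_surj T : exists2 f, linear f & op_tens f = T.
Proof.
pose c j : 'Hom(V, K^o) := r2v (row j T).
exists (fun u => r2v (\row_j c j u)).
  move=> r u v; rewrite -linearP; congr r2v; apply/rowP => j.
  by rewrite !mxE linearP.
apply/row_matrixP => j; rewrite row_op_tens -[RHS]r2vK; congr v2r.
apply/lfunP => u; rewrite coord_formE ?r2vK ?mxE // => r v w.
rewrite -linearP; congr r2v; apply/rowP => l; by rewrite !mxE linearP.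
Qed.

Lemma op_tens_act x f : linear f ->
  op_tens (fun u => fd_act x (f u) - f (fd_act x u)) =
  tensor_act (V := V) (W := dual_mod V) x (op_tens f).
Proof.
move=> fl; have [actl _ _] := fd_actP V.
have xl : linear (fun u => fd_act x (f u) - f (fd_act x u)).
  move=> r u v; rewrite fl !actl fl scalerBr opprD addrACA //.
apply/row_matrixP => j; rewrite /tensor_act linearD /= row_op_tens row_mul row_mul.
rewrite row_op_tens (act_mxE (U := dual_mod V)).
have -> : row j (act_mx V x)^T *m op_tens f =
    v2r (\sum_i act_mx V x i j *: coord_form f i).
  rewrite linear_sum /= mulmx_sum_row; apply: eq_bigr => i _.
  by rewrite !mxE linearZ /= row_op_tens.
rewrite -linearD; congr v2r; apply/lfunP => u.
rewrite add_lfunE sum_lfunE coord_formE // dual_actE coord_formE //.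
rewrite linearB mxE [X in _ + X]mxE; congr (_ - _).
rewrite /= -(act_mxE x (f u)) mxE.
by apply: eq_bigr => i _; rewrite scale_lfunE coord_formE // mulrC.
Qed.

End OperatorTensor.

Section Main.
Variables (K : numFieldType) (n k : nat).
Hypothesis n_gt0 : (0 < n)%N.
Local Notation m := n.+2.
Local Notation g := (so K m).
Local Notation soE := (@soE K m).
Variable V : weight_index m k -> fdModule g.
Hypothesis hV : forall a, is_irr_of_highest_weight (index_weight K a) (V a).
Variables (e : g) (r0 : K).
Local Notation a0 := (lshift m (ord0 : 'I_m)).
Local Notation b0 := (rshift m (inord 1 : 'I_m)).
Hypotheses (eE : e = r0 *: soE a0 b0) (r0_neq0 : r0 != 0).

Let irrV a : irreducible (V a) := proj1 (hV a).

Let i1_neq : (inord 1 : 'I_m) != ord0.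
Proof. by rewrite -val_eqE /= inordK. Qed.
Let b0_bar : b0 != bar a0.
Proof. by rewrite bar_lshift eq_rshift. Qed.
Let b0_neq : b0 != a0.
Proof. by rewrite eq_rlshift. Qed.

Local Notation J := (ideal_span (@gl_span K m k e)).
Local Notation LQ := (left_quot k eE).
Local Notation act a := (@env_act K m k (mod_of_fd (V a))).
Local Notation lp := (left_proj k eE).

Lemma ex_highest a : exists v : V a, singular (M := V a) (row_weight (index_weight K a)) v.
Proof. by have [_ [v hv]] := hV a; exists v; apply: highest_weight_singular. Qed.

Lemma row_weight_inj : injective (@row_weight K m).
Proof.
move=> l l' ell; apply/rowP => j.
by rewrite -!row_weight_lshift ell.
Qed.

Lemma index_weight_inj : injective (@index_weight K m k).
Proof.
move=> a b /weight_of_inj ab; apply: val_inj; apply/ffunP => j; apply: val_inj.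
exact: ab.
Qed.

Lemma bounded_V a : bounded k (V a).
Proof.
have [v hv] := ex_highest a.
have /(@weight_boundP K n k _ n_gt0)[j ej] := valP a.
apply: (irreducible_bounded (irrV a) hv (i0 := ord0) (i1 := inord 1) _ i1_neq (j := j)) => //.
by rewrite row_weight_lshift.
Qed.

Lemma gl_ideal_act0 p : J p -> forall a u, act a u p = 0.
Proof.
by move=> Jp a u; apply: (gl_ideal_env_act eE b0_neq (bounded_V (a := a))).
Qed.

Lemma LQ_bounded : bounded k LQ.
Proof. exact: left_quot_bounded r0_neq0 b0_bar b0_neq. Qed.

Lemma singular_weight l (s : LQ) : singular l s ->
  exists a : weight_index m k, l = row_weight (index_weight K a).
Proof.
move=> hs; have [a ea] := dominant_weight_of (singular_anti hs)
  (dominant_singular LQ_bounded hs).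
have /spin_valsP[j _ ej] := wv_range LQ_bounded (sing_wv hs) (sing_neq0 hs) a0.
have bd : weight_bound k a.
  by apply/(weight_boundP K k a n_gt0); exists j; rewrite -ej ea row_weight_lshift.
pose f : {ffun 'I_m -> 'I_k.+1} := [ffun i => inord (a i)].
have fE i : f i = a i :> nat by rewrite ffunE inordK // ltnS (weight_bound_le i bd).
have fa : (fun i => f i : nat) = a by apply: boolp.funext.
have bf : weight_bound k (fun i => f i : nat) by rewrite fa.
by exists (exist _ f bf); rewrite ea /index_weight /= fa.
Qed.

Lemma gl_idealP p : (forall a u, act a u p = 0) -> J p.
Proof.
move=> h; apply/(left_proj_eq0 k eE); rewrite -env_act_left_proj.
elim: (hwspan_all LQ_bounded (lp 1)) => [u [s [l [w [hs _ wu]]]]||u v _ hu _ hv|r u _ hu].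
- have [a ea] := singular_weight hs; have [v hv] := ex_highest a.
  rewrite -ea in hv.
  apply: (env_act_wspan LQ_bounded (bounded_V (a := a)) hs hv (h a));
  by apply: lspan_in; exists w.
- exact: env_act0l.
- by rewrite env_actDl hu hv addr0.
- by rewrite env_actZl hu scaler0.
Qed.

(** A relation that p satisfies modulo J passes to the values of p on any vector annihilated by
    J. *)
Lemma left_proj_shift p x (r : K) (M : lieModule g) (u : M) :
  (forall q, J q -> env_act k u q = 0) ->
  mod_act x (lp p) = r *: lp p -> mod_act x (env_act k u p) = r *: env_act k u p.
Proof.
move=> uJ e1; rewrite -env_act_left -env_actZ.
apply/eqP; rewrite -subr_eq0 -env_actB; apply/eqP/uJ/(left_proj_eq0 k eE).
have [lpl _] := left_proj_hom k eE.
rewrite addrC -scaleN1r lpl left_proj_leftS e1 -[r *: p]addr0 lpl.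
have -> : lp 0 = 0 by apply/(left_proj_eq0 k eE)/ideal_span0.
by rewrite addr0 scaleN1r addNr.
Qed.

Definition acts a (T : V a -> V a) : Prop :=
  exists p, (forall u, act a u p = T u) /\ forall b, b != a -> forall u, act b u p = 0.

Lemma actsD a T T' : acts (a := a) T -> acts (a := a) T' ->
  acts (a := a) (fun u => T u + T' u).
Proof.
move=> [p [h1 h2]] [p' [h1' h2']]; exists (p + p'); split=> [u|b ba u].
  by rewrite env_actD h1 h1'.
by rewrite env_actD h2 // h2' // addr0.
Qed.

Lemma actsZ a r T : acts (a := a) T -> acts (a := a) (fun u => r *: T u).
Proof.
move=> [p [h1 h2]]; exists (r *: p); split=> [u|b ba u].
  by rewrite env_actZ h1.
by rewrite env_actZ h2 // scaler0.
Qed.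

Lemma acts_left a x T : acts (a := a) T -> acts (a := a) (fun u => fd_act x (T u)).
Proof.
move=> [p [h1 h2]]; exists (leftS k x p); split=> [u|b ba u].
  by rewrite env_act_left h1.
by rewrite env_act_left h2 // mod_act0.
Qed.

Lemma acts_right a x T : acts (a := a) T -> acts (a := a) (fun u => T (fd_act x u)).
Proof.
move=> [p [h1 h2]]; exists (- rightS k x p); split=> [u|b ba u].
  by rewrite -scaleN1r env_actZ env_act_right scaleN1r opprK h1.
by rewrite -scaleN1r env_actZ env_act_right scaleN1r opprK h2.
Qed.

Lemma acts_ext a T T' : T =1 T' -> acts (a := a) T -> acts (a := a) T'.
Proof. by move=> eT [p [h1 h2]]; exists p; split=> // u; rewrite h1 eT. Qed.

Lemma acts0 a : acts (a := a) (fun _ => 0).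
Proof. by exists 0; split=> [u|b _ u]; rewrite env_act0. Qed.

Lemma ex_separating a : exists p (u : V a) v, [/\ act a u p != 0,
  singular (M := V a) (row_weight (index_weight K a)) v,
  forall u, exists r, act a u p = r *: v & forall b, b != a -> forall u, act b u p = 0].
Proof.
pose N (q : LQ) := exists2 p, q = lp p & forall u, act a u p = 0.
have [lpl _] := left_proj_hom k eE.
have sN : subspace N.
  split.
  - by exists 0 => [|u]; rewrite ?env_act0 //; apply/esym/(left_proj_eq0 k eE)/ideal_span0.
  - move=> _ _ [p -> hp] [p' -> hp']; exists (p + p') => [|u]; last first.
      by rewrite env_actD hp hp' addr0.
    by rewrite -[in RHS](scale1r p) lpl scale1r.
  - move=> r _ [p -> hp]; exists (r *: p) => [|u]; last by rewrite env_actZ hp scaler0.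
    rewrite -[r *: p in RHS]addr0 lpl (_ : lp 0 = 0) ?addr0 //.
    exact/(left_proj_eq0 k eE)/ideal_span0.
have stN : stable N.
  move=> x _ [p -> hp]; exists (leftS k x p); first by rewrite left_proj_leftS.
  by move=> u; rewrite env_act_left hp mod_act0.
have [v hv] := ex_highest a.
(* Otherwise all highest weight submodules, hence the whole quotient, would lie in N, and 1 would
   act on [V a] by zero. *)
have [s [l [hs nNs]]] : exists s l, singular l s /\ ~ N s.
  apply: boolp.contrapT => h.
  have [p ep hp] : N (lp 1).
    apply: (lspan_min sN) (hwspan_all LQ_bounded (lp 1)) => u [s [l [w [hs _ wu]]]].
    have Ns : N s by apply: boolp.contrapT => nNs; apply: h; exists s, l.
    by elim: wu => // w' u' a' b' _ Nu' _; apply: stN.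
  have J1 : J (1 - p).
    apply/(left_proj_eq0 k eE); rewrite addrC -scaleN1r lpl -ep.
    by rewrite scaleN1r addNr.
  case/eqP: (sing_neq0 hv); have <- : act a v 1 = v by apply: env_act1.
  by rewrite -[1](subrK p) env_actD hp addr0; apply: gl_ideal_act0.
have [p ep] := left_proj_surj s.
have [u up] : exists u, act a u p != 0.
  apply: boolp.contrapT => h; apply: nNs; exists p => // u.
  by apply: boolp.contrapT => /eqP nz; apply: h; exists u.
(* As p is singular of weight [l] in the quotient, its values on each module are zero or singular of
   weight [l]. By [HW_unique] and injectivity of the weights only [V a] has such vectors, all on one
   line. *)
have sp b w : act b w p != 0 -> singular (M := V b) l (act b w p).
  move=> nz; split=> // [c|c d cd].
    apply: left_proj_shift; first by move=> q Jq; apply: gl_ideal_act0.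
    by rewrite -ep; apply: (sing_wv hs).
  rewrite -[RHS](scale0r (act b w p)).
  apply: left_proj_shift; first by move=> q Jq; apply: gl_ideal_act0.
  by rewrite -ep scale0r; apply: (sing_pos hs).
have spv b w v' : singular (M := V b) (row_weight (index_weight K b)) v' ->
    act b w p != 0 -> l = row_weight (index_weight K b) /\ exists r, act b w p = r *: v'.
  move=> hv' /sp; apply: (HW_unique (bounded_V (a := b)) hv').
  exact: (irreducible_wspan (irrV b) hv').
have [la _] := spv a u v hv up.
exists p, u, v; split=> // [w|b ba w].
  have [->|/(spv a w v hv)[]//] := eqVneq (act a w p) 0.
  by exists 0; rewrite scale0r.
apply: boolp.contrapT => /eqP nz; have [v' hv'] := ex_highest b.
have [lb _] := spv b w v' hv' nz.
case/eqP: ba; apply/index_weight_inj/row_weight_inj; by rewrite -la -lb.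
Qed.

(** It suffices to realise the rank one operators [form c u *: w]. For one nonzero form all w occur,
    since left multiplication makes the admissible w a submodule. Right multiplication makes the set
    N of admissible forms stable, so its annihilator is a proper submodule of [V a], hence zero. *)
Lemma acts_linear a T : (forall r (u v : V a), T (r *: u + v) = r *: T u + T v) ->
  acts (a := a) T.
Proof.
move=> Tl; have [p [u [v [up hv pv pb]]]] := ex_separating a.
pose d := dim (V a).
pose form (c : 'cV[K]_d) (u : V a) : K := (v2r u *m c) 0 0.
have formD c c' w : form (c + c') w = form c w + form c' w by rewrite /form mulmxDr mxE.
have formZ r c w : form (r *: c) w = r * form c w by rewrite /form -scalemxAr mxE.
have form_act c x w : form c (fd_act x w) = form (act_mx (V a) x *m c) w.
  by rewrite /form -act_mxE mulmxA.
pose N c := forall w, acts (a := a) (fun u => form c u *: w).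
have sN : subspace N.
  split=> [w|c c' Nc Nc' w|r c Nc w].
  - by apply: acts_ext (acts0 a) => u'; rewrite /form mulmx0 mxE scale0r.
  - by apply: acts_ext (actsD (Nc w) (Nc' w)) => u'; rewrite formD scalerDl.
  - by apply: acts_ext (actsZ r (Nc w)) => u'; rewrite formZ scalerA.
have stN x c : N c -> N (act_mx (V a) x *m c).
  by move=> Nc w; apply: acts_ext (acts_right x (Nc w)) => u'; rewrite form_act.
have [c Nc cu] : exists2 c, N c & form c u != 0.
  have [j vj] : exists j, v2r v 0 j != 0.
    by apply/rV0Pn; rewrite -(linear0 v2r) (can_eq v2rK) (sing_neq0 hv).
  have Fl : linear (fun u : V a => act a u p : V a).
    by move=> r x y; have := env_act_linear_l (M := V a) k r x y p.
  pose F : {linear V a -> V a} := HB.pack (fun u => act a u p)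
    (@GRing.isLinear.Build K (V a) (V a) *:%R (fun u => act a u p) Fl).
  pose A : 'M[K]_d := lin1_mx (v2r \o F \o r2v).
  (* A form with value 1 at v, read off at a nonzero coordinate [j]; composed with the operator of p
     it gives the coefficient of v. *)
  pose z : 'cV[K]_d := (v2r v 0 j)^-1 *: delta_mx j 0.
  have cE w r : act a w p = r *: v -> form (A *m z) w = r.
    move=> e1; rewrite /form mulmxA.
    have -> : v2r w *m A = r *: v2r v by rewrite -linearZ -e1 mul_rV_lin1 /= v2rK.
    by rewrite /z -scalemxAl -scalemxAr -colE !mxE mulVf ?mulr1.
  exists (A *m z).
    move=> w.
    pose Q w := acts (a := a) (fun u => form (A *m z) u *: w).
    apply: (irreducible_all (irrV a) (N := Q)).
    - split=> [|w1 w2 h1 h2|r w1 h1].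
      + by apply: acts_ext (acts0 a) => u'; rewrite scaler0.
      + by apply: acts_ext (actsD h1 h2) => u'; rewrite scalerDr.
      + by apply: acts_ext (actsZ r h1) => u'; rewrite !scalerA mulrC.
    - move=> x w1 h1; apply: acts_ext (acts_left x h1) => u' /=.
      by have := mod_actZ (M := V a) x (form (A *m z) u') w1.
    exists v; last exact: sing_neq0 hv.
    by exists p; split=> // u'; have [r e1] := pv u'; rewrite (cE _ _ e1).
  have [r e1] := pv u; rewrite (cE _ _ e1).
  by apply: contraNneq up => r00; rewrite e1 r00 scale0r.
have Nall : forall c, N c.
  apply: trivial_annihilator => // r hr.
  pose Q (w : V a) := forall c, N c -> form c w = 0.
  apply/eqP; apply: contraNT cu => r0'.
  pose vr : V a := @r2v _ (V a) r.
  have Qr : Q vr by move=> c' Nc'; rewrite /form r2vK hr // mxE.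
  have : forall w, Q w.
    apply: (irreducible_all (irrV a)).
    - split=> [c' _|w w' h h' c' Nc'|s w h c' Nc']; rewrite /form.
      + by rewrite linear0 mul0mx mxE.
      + by rewrite linearD mulmxDl mxE -!/(form _ _) h // h' // addr0.
      + by rewrite linearZ -scalemxAl mxE -/(form _ _) h // mulr0.
    - by move=> x w h c' Nc'; rewrite form_act; apply: h; apply: stN.
    exists vr => //.
    by rewrite -(can_eq v2rK) r2vK linear0.
  by move=> h; apply/eqP; apply: h.
have sumT (s : seq 'I_d) : acts (a := a)
    (fun u => \sum_(j <- s) form (delta_mx j 0) u *: T (@coord_vec K (V a) j)).
  elim: s => [|j s IH]; first by apply: acts_ext (acts0 a) => u'; rewrite big_nil.
  by apply: acts_ext (actsD (Nall _ _) IH) => u'; rewrite big_cons.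
pose Tf : {linear V a -> V a} := HB.pack T (@GRing.isLinear.Build K (V a) (V a) *:%R T Tl).
apply: acts_ext (sumT (index_enum _)) => u'.
have -> : T u' = Tf (\sum_j v2r u' 0 j *: @coord_vec K (V a) j) by rewrite coord_vec_sum.
by rewrite linear_sum; apply: eq_bigr => j _; rewrite linearZ /form -colE mxE.
Qed.

Definition op_sum p : peter_weyl_sum V :=
  [ffun a => op_tens (V := V a) (fun u => act a u p)].

Lemma act_linear a p : linear (fun u : V a => act a u p : V a).
Proof. by move=> r x y; have := env_act_linear_l (M := V a) k r x y p. Qed.

Lemma op_sum_hom : @lie_hom K g (Sym_mod (adjoint g)) (peter_weyl_sum V) op_sum.
Proof.
split=> [r p q|x p]; apply/ffunP => a; rewrite !ffunE.
  rewrite -op_tens_linear; try exact: act_linear.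
  by congr op_tens; apply: boolp.funext => u; rewrite env_actD env_actZ.
rewrite /= -op_tens_act; last exact: act_linear.
congr op_tens; apply: boolp.funext => u.
by rewrite glS_so env_act_gl.
Qed.

Lemma op_sum_eq0 p : op_sum p = 0 <-> J p.
Proof.
split=> [z|Jp].
  apply: gl_idealP => a u; have /ffunP/(_ a) := z; rewrite !ffunE => z1.
  have z2 : op_tens (V := V a) (fun u => act a u p) = op_tens (V := V a) (fun _ => 0).
    rewrite z1; apply/esym; apply/row_matrixP => j; rewrite row_op_tens row0.
    rewrite -(linear0 v2r); congr v2r; apply/lfunP => w.
    rewrite coord_formE; last by move=> ? ? ?; rewrite scaler0 addr0.
    by rewrite linear0 mxE lfunE.
  apply: (op_tens_inj _ _ z2); first exact: act_linear.
  by move=> ? ? ?; rewrite scaler0 addr0.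
apply/ffunP => a; rewrite !ffunE; apply/row_matrixP => j; rewrite row_op_tens row0.
rewrite -(linear0 v2r); congr v2r; apply/lfunP => w.
rewrite coord_formE; last exact: act_linear.
by rewrite gl_ideal_act0 // linear0 mxE lfunE.
Qed.

Lemma op_sum_surj w : exists p, op_sum p = w.
Proof.
have h a : exists p, op_tens (V := V a) (fun u => act a u p) = w a /\
    forall b, b != a -> forall u, act b u p = 0.
  have [f fl fw] := op_tens_surj (w a); have [p [h1 h2]] := acts_linear fl.
  by exists p; split=> //; rewrite -fw; congr op_tens; apply: boolp.funext.
have [P hP] := fin_all_exists h.
exists (\sum_a P a); apply/ffunP => a; rewrite ffunE -(proj1 (hP a)).
congr op_tens; apply: boolp.funext => u.
have sumE (s : seq (weight_index m k)) :
    act a u (\sum_(b <- s) P b) = \sum_(b <- s) act a u (P b).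
  by elim: s => [|b s IH]; rewrite ?big_nil ?env_act0 // !big_cons env_actD IH.
rewrite sumE (bigD1 a) //= big1 ?addr0 // => b ba.
by apply: (proj2 (hP b)); rewrite eq_sym.
Qed.

Lemma so_ideal_gl_ideal p : so_ideal k e p -> J p.
Proof.
elim=> [q|||]; last 3 first.
- exact: ideal_span0.
- by move=> *; apply: ideal_spanD.
- by move=> *; apply: ideal_spanM.
move=> so_q; apply: ideal_span_gen; elim: so_q => [||q1 q' _ h _ h'|r q1 _ h|x q1 _ h].
- exact: U_span_gen.
- exact: U_span0.
- exact: U_spanD.
- exact: U_spanZ.
- exact: gl_span_act.
Qed.

End Main.

Theorem gl_quotient_peter_weyl (K : numFieldType) (m k : nat) (hm : (3 <= m)%N)
    (e : so K m) (he : root_vector (highest_root K m) e)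
    (V : weight_index m k -> fdModule (so K m))
    (hV : forall a, is_irr_of_highest_weight (index_weight K a) (V a)) :
  exists phi : gl_quotient k e -> peter_weyl_sum V,
    [/\ lie_hom phi, bijective phi
      & exists psi : C2_algebra k e -> peter_weyl_sum V,
          [/\ lie_hom psi,
              forall w, exists q, psi q = w
            & forall p : Sym (so K m),
                psi (quot_proj (so_ideal k e) p) =
                phi (quot_proj (gl_ideal k e) p)]].
Proof.
(* The shape [m = n + 2] separates the two spin nodes; [ord0] and [inord 1] are the coordinates in
   the highest root. *)
case: m hm e he V hV => [|[|n]] // n_gt0 e he V hV.
have [r r0 eE] := highest_root_vectorE (i0 := ord0) (i1 := inord 1) erefl
  (inordK (isT : 1 < n.+2)%N) he.
pose f := @op_sum K n k V.
have fhom := @op_sum_hom K n k V.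
have f0 p := @op_sum_eq0 K n k n_gt0 V hV e r eE r0 p.
have [phi [phi_hom phiE]] := @quot_lift _ _ _ _ (gl_ideal k e) f fhom (fun p => proj2 (f0 p)).
have so0 p : so_ideal k e p -> f p = 0 by move=> h; apply/f0/so_ideal_gl_ideal.
have [psi [psi_hom psiE]] := @quot_lift _ _ _ _ (so_ideal k e) f fhom so0.
have f_surj w : exists p, f p = w := @op_sum_surj K n k n_gt0 V hV e r eE r0 w.
exists phi; split=> //; last first.
  exists psi; split=> // [w|p]; last by rewrite psiE phiE.
  by have [p <-] := f_surj w; exists (quot_proj (so_ideal k e) p); rewrite psiE.
have surj w : exists q, phi q = w.
  by have [p <-] := f_surj w; exists (quot_proj (gl_ideal k e) p); rewrite phiE.
have inj q q' : phi q = phi q' -> q = q'.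
  rewrite -[q]mquot_reprK -[q']mquot_reprK => eq.
  apply/mquot_projP/f0.
  have [fl _] := fhom.
  have fB (p p' : Sym_mod (adjoint (so K n.+2))) : f (p - p') = f p - f p'.
    by rewrite /f addrC -scaleN1r fl scaleN1r addrC.
  by apply: etrans (fB _ _) _; apply/eqP; rewrite subr_eq0 -phiE -phiE; apply/eqP.
have [h hE] := boolp.choice surj.
by exists h => [q|w //]; apply: inj; rewrite hE.
Qed.

Local Open Scope complex_scope.

Theorem proposition5p13 (R : realType) (m k : nat) (hm : (3 <= m)%N)
    (e : so R[i] m) (he : root_vector (highest_root R[i] m) e)
    (V : weight_index m k -> fdModule (so R[i] m))
    (hV : forall a, is_irr_of_highest_weight (index_weight R[i] a) (V a)) :
  exists phi : gl_quotient k e -> peter_weyl_sum V,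
    [/\ lie_hom phi, bijective phi
      & exists psi : C2_algebra k e -> peter_weyl_sum V,
          [/\ lie_hom psi,
              forall w, exists q, psi q = w
            & forall p : Sym (so R[i] m),
                psi (quot_proj (so_ideal k e) p) =
                phi (quot_proj (gl_ideal k e) p)]].
Proof. exact: gl_quotient_peter_weyl. Qed.
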